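(* Let $\gamma$ be a centered Gaussian measure on a separable Fréchet space $F$ such that the Cameron--Martin space $H=H(\gamma)$ is dense in $F$, and let $\iota\colon H\to F$ be the natural embedding. Then $(\iota,H,F)$ is an abstract Wiener space over a Fréchet space.
   Context: All spaces are real. For a separable Hilbert space $H$, let $P(H)$ be the set of orthogonal projections in $H$ with finite-dimensional range. The canonical cylindrical Gaussian measure $\nu$ on $H$ is the finitely additive set function on cylinder sets given by $\nu(\{x: Px\in B\})=$ the standard Gaussian measure of $B$ on the Euclidean space $\mathrm{Ran}(P)$, for $P\in P(H)$ and $B\subset\mathrm{Ran}(P)$ Borel. A seminorm $q$ on $H$ is Gross measurable if for every $\varepsilon>0$ there is $P_\varepsilon\in P(H)$ such that $\nu(x\in H: q(Px)>\varepsilon)<\varepsilon$ for all $P\in P(H)$ with $P\perp P_\varepsilon$ (i.e. with range orthogonal to that of $P_\varepsilon$). A triple $(\iota,H,F)$ is an abstract Wiener space (over a Fréchet space) if $F$ is a separable Fréchet space with topology defined by seminorms $q_1\le q_2\le\dots$, $H$ is a separable Hilbert space, $\iota\colon H\to F$ is a continuous linear embedding (injective) with dense range, and every seminorm $q_k\circ\iota$ is Gross measurable on $H$. A Gaussian measure on $F$ is a Borel probability measure under which every $f\in F^*$ (continuous dual) has a (possibly degenerate) Gaussian law; it is centered if all these laws have mean zero. For a centered Gaussian measure $\gamma$, the Cameron--Martin space is $H(\gamma)=\{h\in F: |h|_{H(\gamma)}<\infty\}$, where $|h|_{H(\gamma)}=\sup\{f(h): f\in F^*,\ \|f\|_{L^2(\gamma)}\le1\}$;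 it is a Hilbert space with this norm. *)

(* Defs.v *)
From HB Require Import structures.
From mathcomp Require Import all_boot all_order all_algebra.
From mathcomp Require Import all_classical all_reals all_analysis.

Set Implicit Arguments.
Unset Strict Implicit.
Unset Printing Implicit Defensive.

Import Order.TTheory GRing.Theory Num.Theory.
Import numFieldTopology.Exports numFieldNormedType.Exports.

Local Open Scope classical_set_scope.
Local Open Scope ring_scope.

Section seminorms.
Context {R : realType}.

Definition is_seminorm {V : lmodType R} (q : V -> R) : Prop :=
  (forall x y, q (x + y) <= q x + q y) /\
  (forall (a : R) x, q (a *: x) = `|a| * q x).

(* The balls of the single seminorms q k form a base of the topology because
   the family is assumed to be nondecreasing in separable_frechet. *)
Definition seminorms_define_topology {F : topologicalLmodType R}
    (q : nat -> F -> R) : Prop :=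
  forall (x : F) (A : set F),
    nbhs x A <-> exists k e, 0 < e /\ [set y | q k (y - x) < e] `<=` A.

(* Completeness is stated for the translation-invariant uniformity.  The uniform
   structure of a tvsType is not used: that interface does not relate it to the
   addition.  Sequences suffice, the topology being first countable. *)
Definition tvs_complete (F : topologicalLmodType R) : Prop :=
  forall u : nat -> F,
    (forall U : set F, nbhs 0 U -> \forall m & n \near \oo, U (u m - u n)) ->
    exists l : F, u @ \oo --> l.

Definition separable_frechet (F : topologicalLmodType R) (q : nat -> F -> R) :
    Prop :=
  [/\ forall k, is_seminorm (q k),
      forall k x, q k x <= q k.+1 x,
      seminorms_define_topology q,
      hausdorff_space F /\ tvs_complete F &
      exists2 D : set F, countable D & dense D].

End seminorms.

Section hilbert.
Context {R : realType} {H : lmodType R} (dot : H -> H -> R).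

Definition is_inner_product : Prop :=
  [/\ forall x y, dot x y = dot y x,
      forall (a : R) x y z, dot (a *: x + y) z = a * dot x z + dot y z &
      forall x, x != 0 -> 0 < dot x x].

Definition hnorm (x : H) : R := Num.sqrt (dot x x).

Definition hball (x : H) (e : R) : set H := [set y | hnorm (y - x) < e].

Definition hnbhs (x : H) : set_system H :=
  filter_from [set e : R | 0 < e] (hball x).

Definition hcomplete : Prop :=
  forall u : nat -> H,
    (forall e, 0 < e -> \forall m & n \near \oo, hnorm (u m - u n) < e) ->
    exists l : H, hnorm (u n - l) @[n --> \oo] --> (0 : R).

Definition hseparable : Prop :=
  exists2 D : set H, countable D &
    forall x e, 0 < e -> exists2 d, D d & hball x e d.

Definition separable_hilbert : Prop :=
  [/\ is_inner_product, hcomplete & hseparable].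

Definition fin_rank (P : H -> H) : Prop :=
  exists n (v : n.-tuple H), forall x, exists c : n.-tuple R,
    P x = \sum_(i < n) tnth c i *: tnth v i.

Definition fin_orth_proj (P : {linear H -> H}) : Prop :=
  [/\ forall x, P (P x) = P x,
      forall x y, dot (P x) y = dot x (P y) &
      fin_rank P].

Definition lincomb n (e : n.-tuple H) (t : n.-tuple R) : H :=
  \sum_(i < n) tnth t i *: tnth e i.

Definition orthonormal_basis (V : set H) n (e : n.-tuple H) : Prop :=
  (forall i j, dot (tnth e i) (tnth e j) = (i == j)%:R) /\
  range (lincomb e) = V.

Definition rel_open (V : set H) : set (set H) :=
  [set U | U `<=` V /\
    forall x, U x -> exists2 e, 0 < e & hball x e `&` V `<=` U].

Definition borel_in (V : set H) : set (set H) := <<s V, rel_open V >>.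

End hilbert.

Section gaussian.
Context {R : realType}.
Local Open Scope ereal_scope.

Definition uncurried_cons n (p : measurableTypeR R * n.-tuple R) :
    n.+1.-tuple R :=
  [the n.+1.-tuple R of p.1 :: p.2].

Lemma measurable_uncurried_cons n :
  measurable_fun [set: measurableTypeR R * n.-tuple R] (@uncurried_cons n).
Proof. exact: measurable_cons. Qed.

HB.instance Definition _ n :=
  isMeasurableFun.Build _ _ _ _ (@uncurried_cons n)
    (@measurable_uncurried_cons n).

(* The standard Gaussian measure on R^n, i.e. the n-fold product of N(0, 1). *)
Fixpoint std_gaussian n : probability (n.-tuple R) R :=
  match n with
  | 0 => \d_([tuple])
  | m.+1 => distribution (normal_prob 0 1 \x std_gaussian m) (@uncurried_cons m)
  end.

(* normal_prob m 0 is not a Dirac mass in the library, hence the case split. *)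
Definition gaussian_law (m s : R) (B : set R) : \bar R :=
  if s == 0%R then \d_m B else normal_prob m s B.

End gaussian.

Section cylindrical.
Context {R : realType} {H : lmodType R} (dot : H -> H -> R).
Local Open Scope ereal_scope.

(* The cylinder set A = {x | P x \in B} has measure v.  The Euclidean space
   Ran(P) is identified with R^n by an orthonormal basis e. *)
Definition cylinder_value (A : set H) (v : \bar R) : Prop :=
  exists (P : {linear H -> H}) (B : set H) n (e : n.-tuple H),
    [/\ fin_orth_proj dot P,
        borel_in dot (range P) B,
        A = P @^-1` B,
        orthonormal_basis dot (range P) e &
        v = std_gaussian n (lincomb e @^-1` B)].

(* The value does not depend on the representation of the cylinder set.  The
   default 0 is only taken on sets that are not cylinder sets. *)
Definition cylindrical_gaussian (A : set H) : \bar R :=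
  xget 0 (cylinder_value A).

Definition gross_measurable (q : H -> R) : Prop :=
  is_seminorm q /\
  forall eps : R, (0 < eps)%R ->
  exists2 P0 : {linear H -> H}, fin_orth_proj dot P0 &
  forall P : {linear H -> H}, fin_orth_proj dot P ->
    (forall x y, dot (P x) (P0 y) = 0%R) ->
    cylindrical_gaussian [set x | (eps < q (P x))%R] < eps%:E.

End cylindrical.

Definition abstract_wiener_space {R : realType} (F : topologicalLmodType R)
    (q : nat -> F -> R) (H : lmodType R) (dot : H -> H -> R)
    (iota : {linear H -> F}) : Prop :=
  [/\ separable_frechet q,
      separable_hilbert dot,
      injective iota /\ (forall x, iota @ hnbhs dot x --> iota x),
      dense (range iota) &
      forall k, gross_measurable dot (q k \o iota)].

(* The Borel sigma-algebra of F; sigma-algebras live on pointed types, and the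
   point of F (here 0) comes from its Z-module structure. *)
Definition borel {R : realType} (F : topologicalLmodType R) :=
  @g_sigma_algebraType (GRing.Zmodule.sort F) (@open F).

HB.instance Definition _ {R : realType} (F : topologicalLmodType R) :=
  Measurable.on (borel F).

Section gaussian_measure.
Context {R : realType} {F : topologicalLmodType R}.
Variable gamma : probability (borel F) R.
Local Open Scope ereal_scope.

Definition is_gaussian : Prop :=
  forall f : {linear F -> R^o}, continuous f ->
  exists m s : R, forall B : set R, measurable B ->
    gamma (f @^-1` B) = gaussian_law m s B.

Definition is_centered : Prop :=
  forall f : {linear F -> R^o}, continuous f -> \int[gamma]_x (f x)%:E = 0.

Definition dual_unit_ball : set {linear F -> R^o} :=
  [set f : {linear F -> R^o} |
    continuous f /\ 'N[gamma]_2%:E[EFin \o f] <= 1].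

Definition cm_norm (h : F) : \bar R :=
  ereal_sup [set (f h)%:E | f in dual_unit_ball].

Lemma dual_unit_ball0 : dual_unit_ball (GRing.null_fun R^o : {linear F -> R^o}).
Proof.
split; first exact: cst_continuous.
by rewrite (_ : EFin \o _ = cst 0)// Lnorm0// lee_fin ler01.
Qed.

Lemma dual_unit_ballN (f : {linear F -> R^o}) :
  dual_unit_ball f -> dual_unit_ball (GRing.opp_fun f : {linear F -> R^o}).
Proof.
move=> [cf f1]; split => [x|].
  by apply: (@cvgN _ R^o); exact: cf.
rewrite (_ : EFin \o _ = \- (EFin \o f))%E; last exact/funext.
by rewrite oppe_Lnorm.
Qed.

Lemma cm_norm_ub (f : {linear F -> R^o}) h :
  dual_unit_ball f -> (f h)%:E <= cm_norm h.
Proof. by move=> f1; apply: ereal_sup_ubound; exists f. Qed.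

Lemma cm_norm_ub_abs (f : {linear F -> R^o}) h :
  dual_unit_ball f -> `|f h|%:E <= cm_norm h.
Proof.
move=> f1; have [fh|fh] := leP 0%R (f h).
  by rewrite ger0_norm// cm_norm_ub.
by rewrite ltr0_norm//; exact: (cm_norm_ub h (dual_unit_ballN f1)).
Qed.

Lemma cm_norm_ge0 h : 0 <= cm_norm h.
Proof. exact: (cm_norm_ub h dual_unit_ball0). Qed.

Lemma cm_norm0 : cm_norm 0%R = 0.
Proof.
apply/eqP; rewrite eq_le cm_norm_ge0 andbT.
by apply: ge_ereal_sup => _ [f _ <-]; rewrite linear0.
Qed.

Lemma cm_normZ (a : R) h : cm_norm (a *: h)%R = `|a|%:E * cm_norm h.
Proof.
have le_cmZ b k : cm_norm (b *: k)%R <= `|b|%:E * cm_norm k.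
  apply: ge_ereal_sup => _ [f f1 <-].
  rewrite linearZ/=.
  apply: (@le_trans _ _ (`|b|%:E * `|f k|%:E)).
    by rewrite -EFinM lee_fin -normrM ler_norm.
  by rewrite lee_wpmul2l ?lee_fin// cm_norm_ub_abs.
have [->|a0] := eqVneq a 0%R; first by rewrite scale0r cm_norm0 normr0 mul0e.
apply/eqP; rewrite eq_le le_cmZ/=.
have := le_cmZ a^-1%R (a *: h)%R; rewrite scalerA mulVf// scale1r => h1.
apply: (@le_trans _ _ (`|a|%:E * (`|a^-1|%:E * cm_norm (a *: h)%R))).
  by rewrite lee_wpmul2l ?lee_fin.
by rewrite muleA -EFinM -normrM divff// normr1 mul1e.
Qed.

Lemma cm_normD h k : cm_norm (h + k)%R <= cm_norm h + cm_norm k.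
Proof.
apply: ge_ereal_sup => _ [f f1 <-].
by rewrite linearD/= EFinD leeD// cm_norm_ub.
Qed.

Definition in_cm : {pred F} := [pred h | cm_norm h < +oo].

Lemma in_cm_submod : subsemimod_closed in_cm.
Proof.
split; [split|]; rewrite /in_cm.
- by rewrite inE cm_norm0.
- move=> h k; rewrite !inE => hy ky.
  by rewrite (le_lt_trans (cm_normD h k))// lte_add_pinfty.
- move=> a h; rewrite !inE => hy.
  by rewrite cm_normZ lte_mul_pinfty.
Qed.

HB.instance Definition _ := GRing.isSubmodClosed.Build R F in_cm in_cm_submod.

Record cameron_martin := CameronMartin {
  cm_val :> F;
  cm_valP : in_cm cm_val
}.

HB.instance Definition _ := [isSub for cm_val].
HB.instance Definition _ := [Choice of cameron_martin by <:].
HB.instance Definition _ := [SubChoice_isSubLmodule of cameron_martin by <:].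

Definition cm_embedding : {linear cameron_martin -> F} := \val.

(* The only candidate for an inner product inducing the norm of H(gamma), by
   polarization; its norm is cm_norm (hnorm_cm_dot). *)
Definition cm_dot (h k : cameron_martin) : R :=
  ((fine (cm_norm (h + k)) ^+ 2 - fine (cm_norm (h - k)) ^+ 2) / 4)%R.

Lemma hnorm_cm_dot (h : cameron_martin) : hnorm cm_dot h = fine (cm_norm h).
Proof.
rewrite /hnorm /cm_dot subrr cm_norm0/= expr0n/= subr0.
rewrite -mulr2n -scaler_nat cm_normZ.
have hf : cm_norm h \is a fin_num
  by rewrite ge0_fin_numE ?cm_norm_ge0//; exact: (cm_valP h).
rewrite fineM//= normr_nat exprMn.
rewrite -natrX mulrAC divff ?mul1r ?pnatr_eq0// sqrtr_sqr.
by rewrite ger0_norm// fine_ge0// cm_norm_ge0.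
Qed.

End gaussian_measure.

(* Main.v *)
From HB Require Import structures.
Require Import Defs.
From mathcomp Require Import all_boot all_order all_algebra.
From mathcomp Require Import all_classical all_reals all_analysis.
From mathcomp Require Import measurable_realfun ring lra.
Import numFieldTopology.Exports numFieldNormedType.Exports.
Import Order.TTheory GRing.Theory Num.Theory.
Set Implicit Arguments.
Unset Strict Implicit.
Unset Printing Implicit Defensive.

(** The space H is Hilbert and embeds continuously.  For f in the dual of F let
   cov f f be its variance under gamma; then |f h| <= sqrt (cov f f) N h, where N
   is the Cameron-Martin norm, and N h is the least such constant
   (cm_norm_dual, cm_norm_le).  The functionals bounded by q k have bounded
   variances (dual_cov_bounded), so by Hahn-Banach q k <= C N on H
   (cm_norm_continuous).  Countably many functionals norm all the q k on a dense
   sequence; Gram-Schmidt turns them into functionals f i that are orthonormal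
   for cov, or null.  The vector e i of F with g (e i) = cov g (f i) for all g
   is the barycenter of gamma weighted by f i (exists_barycenter).  Every h of H
   is the sum of the f i h *: e i (cm_expansion); with the completeness of H
   (cm_complete) this makes H a separable Hilbert space with the e i as coordinate
   vectors.

   For the Gross measurability of q k, let P be a projection orthogonal to the
   first N vectors e.  On the range of P a functional g agrees with its residual
   g - \sum_(i < N) cov g (f i) *: f i, that is, with g evaluated at the tail
   x - \sum_(i < N) f i x *: e i of a point x.  Hence the variance of g under the
   standard Gaussian measure of the range of P is at most that of its residual
   under gamma.  A Gaussian vector dominated in covariance by another one has
   smaller tails for every seminorm, up to factors 2 (gaussian_comparison):
   adding and subtracting an independent Gaussian vector that makes up for the
   difference of the covariances produces the larger law twice.  It remains to
   see that the tail is small in probability for the seminorm q k when N is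
   large (residual_small).  By comparison again, the tail is as tight as gamma:
   it stays close to a fixed compact set, uniformly in N.  A finite net of this
   set is normed by functionals whose residuals are null for large N, so the
   tail is close to 0.

   Laws are compared through expectations of cosines only.  These determine the
   probabilities of boxes up to a factor 2 of the sides, by trigonometric
   polynomials that approximate the indicator functions (trig_tail_le); for
   Gaussian families the expectation of a cosine is exp (- variance / 2), which
   is computed from the density of the normal law. *)

Local Open Scope classical_set_scope.
Local Open Scope ring_scope.

(** * Positive semidefinite forms and orthonormalization *)

(** Degenerate forms are allowed: a covariance vanishes on the functionals that
   are almost surely 0, and no quotient by them is taken. *)
Definition psd_form (R : realType) (V : lmodType R) (B : V -> V -> R) : Prop :=
  [/\ forall u v, B u v = B v u,
      forall (a : R) u v w, B (a *: u + v) w = a * B u w + B v w &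
      forall u, 0 <= B u u].

Section psd.
Context {R : realType} {V : lmodType R} (B : V -> V -> R).
Hypothesis psdB : psd_form B.

Lemma form_sym u v : B u v = B v u. Proof. by case: psdB. Qed.

Lemma form_ge0 u : 0 <= B u u. Proof. by case: psdB. Qed.

Lemma formPl (a : R) u v w : B (a *: u + v) w = a * B u w + B v w.
Proof. by case: psdB. Qed.

Lemma form0l w : B 0 w = 0.
Proof. by have := formPl 1 0 0 w; rewrite scale1r addr0 => ?; lra. Qed.

Lemma formDl u v w : B (u + v) w = B u w + B v w.
Proof. by have := formPl 1 u v w; rewrite scale1r mul1r. Qed.

Lemma formZl a u w : B (a *: u) w = a * B u w.
Proof. by have := formPl a u 0 w; rewrite addr0 form0l addr0. Qed.

Lemma formNl u w : B (- u) w = - B u w.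
Proof. by rewrite -scaleN1r formZl mulN1r. Qed.

Lemma formBl u v w : B (u - v) w = B u w - B v w.
Proof. by rewrite formDl formNl. Qed.

Lemma formDr u v w : B w (u + v) = B w u + B w v.
Proof. by rewrite form_sym formDl !(form_sym w). Qed.

Lemma formZr a u w : B w (a *: u) = a * B w u.
Proof. by rewrite form_sym formZl (form_sym w). Qed.

Lemma formBr u v w : B w (u - v) = B w u - B w v.
Proof. by rewrite form_sym formBl !(form_sym w). Qed.

Lemma form_suml (I : Type) (s : seq I) (P : pred I) (f : I -> V) w :
  B (\sum_(i <- s | P i) f i) w = \sum_(i <- s | P i) B (f i) w.
Proof.
apply: (big_morph (B^~ w)); first by move=> *; exact: formDl.
exact: form0l.
Qed.

Lemma form_sumr (I : Type) (s : seq I) (P : pred I) (f : I -> V) w :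
  B w (\sum_(i <- s | P i) f i) = \sum_(i <- s | P i) B w (f i).
Proof. by rewrite form_sym form_suml; apply: eq_bigr => i _; rewrite form_sym. Qed.

Lemma form_cauchy_schwarz u v : B u v ^+ 2 <= B u u * B v v.
Proof.
have H (t : R) : 0 <= B u u + 2 * t * B u v + t ^+ 2 * B v v.
  have := form_ge0 (u + t *: v).
  by rewrite formDl !formDr !formZl !formZr (form_sym v u); lra.
have [v0|v0] := eqVneq (B v v) 0; last first.
  have vp : 0 < B v v by rewrite lt_neqAle eq_sym v0 form_ge0.
  have := H (- (B u v / B v v)).
  rewrite -(ler_pM2r vp) mul0r.
  suff -> : (B u u + 2 * - (B u v / B v v) * B u v +
     (- (B u v / B v v)) ^+ 2 * B v v) * B v v = B u u * B v v - B u v ^+ 2 by lra.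
  by field.
rewrite v0 mulr0.
have [->|uv0] := eqVneq (B u v) 0; first by rewrite expr0n.
have := H (- ((B u u + 1) / (2 * B u v))).
rewrite v0 mulr0 addr0.
have -> : 2 * - ((B u u + 1) / (2 * B u v)) * B u v = - (B u u + 1) by field.
by lra.
Qed.

Lemma form_null u v : B u u = 0 -> B u v = 0.
Proof.
move=> u0; apply/eqP; rewrite -sqrf_eq0 eq_le sqr_ge0 andbT.
by have := form_cauchy_schwarz u v; rewrite u0 mul0r.
Qed.

(** Zero norms are allowed: a dependent vector is orthonormalized to a vector
   of norm 0, so that no vector of the given sequence has to be discarded. *)
Definition subnormal_seq (w : nat -> V) : Prop :=
  (forall i j, i != j -> B (w i) (w j) = 0) /\
  (forall i, B (w i) (w i) = 0 \/ B (w i) (w i) = 1).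

Definition form_proj (w : nat -> V) N u : V := \sum_(i < N) B u (w i) *: w i.

Section subnormal.
Variable w : nat -> V.
Hypothesis sw : subnormal_seq w.

Lemma subnormalM u i : B u (w i) * B (w i) (w i) = B u (w i).
Proof.
case: sw => _ /(_ i)[wi|->]; last by rewrite mulr1.
by rewrite (form_sym u) (form_null _ wi) mul0r.
Qed.

Lemma form_projw N u i : (i < N)%N -> B (form_proj w N u) (w i) = B u (w i).
Proof.
move=> iN; rewrite /form_proj form_suml (bigD1 (Ordinal iN))//= big1 ?addr0.
  by rewrite formZl subnormalM.
move=> j ji; rewrite formZl; case: sw => -> //; first by rewrite mulr0.
Qed.

Lemma form_projw_ge N u i : (N <= i)%N -> B (form_proj w N u) (w i) = 0.
Proof.
move=> Ni; rewrite /form_proj form_suml big1// => j _.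
by rewrite formZl; case: sw => ->; rewrite ?mulr0// neq_ltn (leq_trans _ Ni).
Qed.

Lemma form_projC N u v :
  B (form_proj w N u) v = \sum_(i < N) B u (w i) * B v (w i).
Proof.
by rewrite /form_proj form_suml; apply: eq_bigr => i _; rewrite formZl (form_sym v).
Qed.

Lemma form_proj_proj N u v : B (form_proj w N u) (form_proj w N v) =
  \sum_(i < N) B u (w i) * B v (w i).
Proof.
by rewrite form_projC; apply: eq_bigr => i _; rewrite form_projw.
Qed.

Lemma form_residual N u v : B (u - form_proj w N u) (v - form_proj w N v) =
  B u v - \sum_(i < N) B u (w i) * B v (w i).
Proof.
rewrite formBl !formBr form_proj_proj form_projC (form_sym u (form_proj _ _ _)).
rewrite form_projC.
under [X in B u v - X]eq_bigr do rewrite mulrC.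
by rewrite subrr subr0.
Qed.

Lemma form_comb_le n (a : nat -> R) :
  B (\sum_(i < n) a i *: w i) (\sum_(i < n) a i *: w i) <= \sum_(i < n) a i ^+ 2.
Proof.
rewrite form_suml; apply: ler_sum => i _.
rewrite formZl form_sumr (bigD1 i)//= big1 => [|j ji].
  rewrite addr0 formZr mulrA -expr2; case: sw => _ /(_ i)[->|->].
    by rewrite mulr0 sqr_ge0.
  by rewrite mulr1.
by rewrite formZr sw.1 ?mulr0// eq_sym.
Qed.

End subnormal.

Section gram_schmidt.
Variable v : nat -> V.

(** Since the inverse of 0 is 0, a vector of norm 0 is sent to 0. *)
Definition form_normalize u := (Num.sqrt (B u u))^-1 *: u.

(** The list of all the previous vectors makes the recursion structural. *)
Fixpoint gs_list n : seq V :=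
  if n is m.+1 then
    rcons (gs_list m)
      (form_normalize (v m - \sum_(w <- gs_list m) B (v m) w *: w))
  else [::].

Definition gram_schmidt i : V := nth 0 (gs_list i.+1) i.

Lemma size_gs_list n : size (gs_list n) = n.
Proof. by elim: n => //= n IH; rewrite size_rcons IH. Qed.

Lemma nth_gs_list n i : (i < n)%N -> nth 0 (gs_list n) i = gram_schmidt i.
Proof.
elim: n => // n IH; rewrite ltnS leq_eqVlt => /orP[/eqP->//|iN].
by rewrite /= nth_rcons size_gs_list iN IH.
Qed.

Lemma gram_schmidtE n : gram_schmidt n =
  form_normalize (v n - form_proj gram_schmidt n (v n)).
Proof.
rewrite /gram_schmidt/= nth_rcons size_gs_list ltnn eqxx.
congr (form_normalize (_ - _)); rewrite (big_nth 0) size_gs_list big_mkord.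
by apply: eq_bigr => i _; rewrite nth_gs_list.
Qed.

Lemma form_normalize_norm u :
  B (form_normalize u) (form_normalize u) = 0 \/
  B (form_normalize u) (form_normalize u) = 1.
Proof.
rewrite /form_normalize formZl formZr mulrA -expr2 exprVn sqr_sqrtr ?form_ge0//.
have [->|u0] := eqVneq (B u u) 0; first by left; rewrite mulr0.
by right; rewrite mulVf.
Qed.

Lemma gram_schmidt_subnormal : subnormal_seq gram_schmidt.
Proof.
split; last by move=> i; rewrite gram_schmidtE; exact: form_normalize_norm.
suff H n i : (i < n)%N -> B (gram_schmidt n) (gram_schmidt i) = 0.
  move=> i j; rewrite neq_ltn => /orP[ij|ij]; last exact: H.
  by rewrite form_sym H.
elim/ltn_ind: n i => n IH i iN.
rewrite [gram_schmidt n]gram_schmidtE /form_normalize formZl.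
suff -> : B (v n - form_proj gram_schmidt n (v n)) (gram_schmidt i) = 0.
  by rewrite mulr0.
rewrite formBl /form_proj form_suml (bigD1 (Ordinal iN))//= big1 => [|j ji].
  rewrite addr0 formZl.
  have [gi|->] : B (gram_schmidt i) (gram_schmidt i) = 0 \/
      B (gram_schmidt i) (gram_schmidt i) = 1.
  - by rewrite gram_schmidtE; exact: form_normalize_norm.
  - by rewrite (form_sym (v n)) (form_null _ gi) mul0r subr0.
  - by rewrite mulr1 subrr.
rewrite formZl; have : val j != i by [].
rewrite neq_ltn => /orP[ji'|ij'].
  by rewrite (form_sym (gram_schmidt j)) (IH _ iN _ ji') mulr0.
by rewrite (IH _ (ltn_ord j) _ ij') mulr0.
Qed.

Let null n : let r := v n - form_proj gram_schmidt n.+1 (v n) in B r r = 0.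
Proof.
rewrite /= (form_residual gram_schmidt_subnormal) big_ord_recr/=.
set u := v n - form_proj gram_schmidt n (v n).
have Bu : B u u = B (v n) (v n) -
    \sum_(i < n) B (v n) (gram_schmidt i) * B (v n) (gram_schmidt i).
  by rewrite (form_residual gram_schmidt_subnormal).
have gu : B (v n) (gram_schmidt n) = B u (gram_schmidt n).
  by rewrite formBl (form_projw_ge gram_schmidt_subnormal)// subr0.
rewrite opprD addrA -Bu gu gram_schmidtE -/u /form_normalize formZr.
have [->|u0] := eqVneq (B u u) 0; first by rewrite mulr0 mulr0 subr0.
rewrite mulrACA -expr2 exprVn sqr_sqrtr ?form_ge0//.
by rewrite mulrA mulVf// mul1r subrr.
Qed.

(** The residual of v n is orthogonal to everything, hence the further
   coefficients of v n vanish and the bound N is immaterial. *)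
Lemma gram_schmidt_null N n : (n < N)%N ->
  let r := v n - form_proj gram_schmidt N (v n) in B r r = 0.
Proof.
move=> /= /subnKC <-; elim: (N - n.+1)%N => [|m IH]; first by rewrite addn0 null.
rewrite addnS; move: IH; rewrite !(form_residual gram_schmidt_subnormal) => E.
rewrite big_ord_recr opprD addrA E sub0r.
set r := v n - form_proj gram_schmidt n.+1 (v n).
suff -> : B (v n) (gram_schmidt (n.+1 + m)) = 0 by rewrite /= mulr0 oppr0.
have := form_null (gram_schmidt (n.+1 + m)) (null n).
by rewrite formBl (form_projw_ge gram_schmidt_subnormal) ?leq_addr// subr0.
Qed.

End gram_schmidt.

End psd.

(** * The Hahn-Banach theorem for seminorms *)

Section hahn_banach.
Context {R : realType} {V : lmodType R}.
Implicit Types p q : V -> R.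

Definition sublinear p : Prop :=
  (forall x y, p (x + y) <= p x + p y) /\
  (forall (a : R) x, 0 <= a -> p (a *: x) = a * p x).

Lemma sublinear0 p : sublinear p -> p 0 = 0.
Proof. by move=> [_ pZ]; have := pZ 0 0 (lexx _); rewrite scale0r mul0r. Qed.

Lemma sublinearN_le p x : sublinear p -> - p (- x) <= p x.
Proof.
move=> sp; have := sp.1 x (- x).
by rewrite subrr (sublinear0 sp); lra.
Qed.

(** This serves twice: for the lower bounds of chains and for lower_along. *)
Lemma inf_sublinear (S : V -> set R) :
  (forall x, has_inf (S x)) ->
  (forall x y a b, S x a -> S y b -> exists2 c, S (x + y) c & c <= a + b) ->
  (forall x a r, 0 < r -> S x a -> S (r *: x) (r * a)) ->
  (forall a, S 0 a -> a = 0) ->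
  sublinear (fun x => inf (S x)).
Proof.
move=> Sinf SD SZ S0; split.
  move=> x y; rewrite -inf_sumE//; apply: lb_le_inf.
    have [[[a Sa] _] [[b Sb] _]] := (Sinf x, Sinf y).
    by exists (a + b); exists a => //; exists b.
  move=> _ [a Sa [b Sb <-]]; have [c Sc cab] := SD _ _ _ _ Sa Sb.
  by apply: le_trans cab; apply: ge_inf => //; exact: (Sinf _).2.
have invZ (r : R) x : 0 < r -> inf (S (r *: x)) <= r * inf (S x).
  move=> r0; rewrite -ler_pdivrMl//; apply: lb_le_inf; first exact: (Sinf _).1.
  move=> a Sa; rewrite ler_pdivrMl//.
  by apply: ge_inf; [exact: (Sinf _).2|exact: SZ].
move=> r x; rewrite le_eqVlt => /predU1P[<-|r0].
  have [[a Sa] _] := Sinf 0; rewrite scale0r mul0r.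
  suff -> : S 0 = [set 0] by rewrite inf1.
  by apply/seteqP; split => [b /S0//|_ ->]; rewrite -(S0 _ Sa).
apply/eqP; rewrite eq_le invZ//=.
have ri0 : 0 < r^-1 by rewrite invr_gt0.
have := invZ _ (r *: x) ri0; rewrite scalerA mulVf ?gt_eqF// scale1r.
by rewrite -(ler_pM2l r0) mulrA divff ?gt_eqF// mul1r.
Qed.

(** For t = 1 and x = - x0 the expression is - p x0, so this functional is at
   most - p x0 at - x0: where p fails to be additive along x0, it lies strictly
   below p. *)
Definition lower_along p x0 x : R :=
  inf [set p (x + t *: x0) - t * p x0 | t in [set t : R | 0 <= t]].

Section lower_along.
Variables (p : V -> R) (x0 : V).
Hypothesis sp : sublinear p.

Let lb x : lbound [set p (x + t *: x0) - t * p x0 | t in [set t : R | 0 <= t]]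
  (- p (- x)).
Proof.
move=> _ [t t0 <-]; have := sp.1 (x + t *: x0) (- x).
by rewrite addrAC subrr add0r sp.2//; lra.
Qed.

Let hi x : has_inf [set p (x + t *: x0) - t * p x0 | t in [set t : R | 0 <= t]].
Proof.
split; last by exists (- p (- x)); exact: lb.
by exists (p (x + 0 *: x0) - 0 * p x0); exists 0 => /=.
Qed.

Lemma lower_along_le x t : 0 <= t ->
  lower_along p x0 x <= p (x + t *: x0) - t * p x0.
Proof. by move=> t0; apply: ge_inf; [exact: (hi x).2|exists t]. Qed.

Lemma sublinear_lower_along : sublinear (lower_along p x0).
Proof.
apply: inf_sublinear => // [x y _ _ [t t0 <-] [s s0 <-]|x _ r r0 [t t0 <-]|].
- exists (p (x + y + (t + s) *: x0) - (t + s) * p x0).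
    by exists (t + s) => //=; exact: addr_ge0.
  have := sp.1 (x + t *: x0) (y + s *: x0).
  by rewrite addrACA -scalerDl; lra.
- exists (r * t); first by rewrite /= mulr_ge0// ltW.
  by rewrite -scalerA -scalerDr sp.2 ?ltW// mulrBr mulrA.
- by move=> _ [t t0 <-]; rewrite add0r sp.2// subrr.
Qed.

End lower_along.

(** Chains are bounded below because every sublinear p <= q satisfies
   - q (- x) <= p x. *)
Lemma minimal_sublinear q : sublinear q ->
  exists p, [/\ sublinear p, (forall x, p x <= q x) &
    forall p', sublinear p' -> (forall x, p' x <= p x) ->
      forall x, p x <= p' x].
Proof.
move=> sq; pose T := {p : V -> R | sublinear p /\ forall x, p x <= q x}.
pose le_T (p p' : T) := `[< forall x, sval p' x <= sval p x >].
have qT : T by exists q.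
have [|||[p [sp pq]] pmin] := @ZL_preorder T qT le_T.
- by move=> p; apply/asboolP.
- move=> p1 p2 p3 /asboolP h1 /asboolP h2; apply/asboolP => x.
  exact: le_trans (h2 x) (h1 x).
- move=> A totA; have [[p0 Ap0]|A0] := pselect (exists t : T, A t); last first.
    by exists qT => p Ap; exfalso; apply: A0; exists p.
  pose S x := [set sval t x | t in A].
  have Slb x : has_inf (S x).
    split; first by exists (sval p0 x), p0.
    exists (- q (- x)) => _ [[p [sp pq]] Ap <-] /=.
    by apply: le_trans (sublinearN_le x sp); rewrite lerN2.
  have sS : sublinear (fun x => inf (S x)).
    apply: inf_sublinear => //.
    - move=> x y _ _ [p1 Ap1 <-] [p2 Ap2 <-].
      have [/asboolP le12|/asboolP le21] := totA _ _ Ap1 Ap2.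
        exists (sval p2 (x + y)); first by exists p2.
        rewrite (le_trans ((svalP p2).1.1 x y))// lerD2r; exact: le12.
      exists (sval p1 (x + y)); first by exists p1.
      rewrite (le_trans ((svalP p1).1.1 x y))// lerD2l; exact: le21.
    - move=> x _ r r0 [p Ap <-]; exists p => //.
      by rewrite (svalP p).1.2// ltW.
    - by move=> _ [p Ap <-]; rewrite (sublinear0 (svalP p).1).
  have Sq x : inf (S x) <= q x.
    apply: le_trans ((svalP p0).2 x); apply: ge_inf; first exact: (Slb x).2.
    by exists p0.
  exists (exist (fun p => sublinear p /\ forall x, p x <= q x) _ (conj sS Sq)) => p Ap; apply/asboolP => x /=.
  by apply: ge_inf; [exact: (Slb x).2|exists p].
exists p; split => // p' sp' p'p x.
have p'q y : p' y <= q y by exact: le_trans (pq y).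
by have /asboolP := pmin (exist (fun p => sublinear p /\ forall x, p x <= q x) _ (conj sp' p'q)) (introT (asboolP _) p'p); exact.
Qed.

(** Lowering a minimal p along y changes nothing; the term t = 1 of the infimum
   then gives p x + p y <= p (x + y). *)
Lemma minimal_sublinear_linear p : sublinear p ->
  (forall p', sublinear p' -> (forall x, p' x <= p x) ->
    forall x, p x <= p' x) ->
  forall (a : R) x y, p (a *: x + y) = a * p x + p y.
Proof.
move=> sp pmin.
have pD x y : p (x + y) = p x + p y.
  apply/eqP; rewrite eq_le sp.1/=.
  have lle z : lower_along p y z <= p z.
    have := lower_along_le y sp z (lexx 0).
    by rewrite scale0r addr0 mul0r subr0.
  have := pmin _ (sublinear_lower_along y sp) lle x.
  have := lower_along_le y sp x ler01.
  by rewrite scale1r mul1r; lra.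
have pN x : p (- x) = - p x.
  have := pD x (- x); rewrite subrr (sublinear0 sp); lra.
move=> a x y; rewrite pD; congr (_ + _).
have [a0|a0] := leP 0 a; first by rewrite sp.2.
have := sp.2 (- a) x; rewrite scaleNr pN oppr_ge0 => /(_ (ltW a0)); lra.
Qed.

(** A minimal functional below lower_along q x0, instead of below q, is at most
   - q x0 at - x0, which gives the equality at x0. *)
Theorem hahn_banach_support q x0 : is_seminorm q ->
  exists g : V -> R, [/\ forall (a : R) x y, g (a *: x + y) = a * g x + g y,
    forall x, `|g x| <= q x & g x0 = q x0].
Proof.
move=> [qD qZ].
have sq : sublinear q by split => // a x a0; rewrite qZ ger0_norm.
have [p [sp pl pmin]] := minimal_sublinear (sublinear_lower_along x0 sq).
have lq x : lower_along q x0 x <= q x.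
  have := lower_along_le x0 sq x (lexx 0).
  by rewrite scale0r addr0 mul0r subr0.
have plin := minimal_sublinear_linear sp pmin.
have pN x : p (- x) = - p x.
  by have := plin (-1) x 0; rewrite addr0 scaleN1r mulN1r (sublinear0 sp) addr0.
have pq x : p x <= q x := le_trans (pl x) (lq x).
exists p; split => //.
  move=> x; rewrite ler_norml pq andbT lerNl -pN (le_trans (pq _))//.
  by have := qZ (-1) x; rewrite scaleN1r normrN1 mul1r => ->.
apply/eqP; rewrite eq_le pq/= -[leRHS]opprK -pN lerNr.
have := lower_along_le x0 sq (- x0) ler01.
rewrite scale1r addNr (sublinear0 sq) mul1r sub0r; exact: le_trans.
Qed.

End hahn_banach.

(** * The normal law: moments and characteristic function *)

Section normal_integral.
Context {R : realType}.
Variables (m s : R).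
Hypothesis s0 : s != 0.
Notation mu := (@lebesgue_measure R).
Local Open Scope ereal_scope.

Lemma ae_eq_density_normal :
  ae_eq mu setT (Radon_Nikodym_SigmaFinite.f (normal_prob m s) mu)
    (EFin \o normal_pdf m s).
Proof.
apply: integral_ae_eq => //.
- by apply: Radon_Nikodym_SigmaFinite.f_integrable; exact: normal_prob_dominates.
- apply/measurable_EFinP; exact: measurable_normal_pdf.
- move=> A _ mA; rewrite -Radon_Nikodym_SigmaFinite.f_integral//.
  exact: normal_prob_dominates.
Qed.

Lemma ge0_integral_normal (f : R -> \bar R) : (forall x, 0 <= f x) ->
  measurable_fun setT f ->
  \int[normal_prob m s]_x f x = \int[mu]_x (f x * (normal_pdf m s x)%:E).
Proof.
move=> f0 mf; have dom := normal_prob_dominates m s.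
rewrite -(Radon_Nikodym_SigmaFinite.change_of_variables dom)//.
apply: ae_eq_integral => //.
- apply: emeasurable_funM => //; apply: (measurable_int mu).
  exact: Radon_Nikodym_SigmaFinite.f_integrable.
- apply: emeasurable_funM => //; apply/measurable_EFinP.
  exact: measurable_normal_pdf.
- exact/ae_eqe_mul2l/ae_eq_density_normal.
Qed.

Lemma normal_integrable (f : R -> R) : measurable_fun setT f ->
  mu.-integrable setT (fun x => (f x * normal_pdf m s x)%:E) ->
  (normal_prob m s).-integrable setT (EFin \o f).
Proof.
move=> mf /integrableP[_ intf]; apply/integrableP; split.
  exact/measurable_EFinP.
rewrite ge0_integral_normal//; last first.
  by apply: measurableT_comp => //; exact/measurable_EFinP.
apply: le_lt_trans intf; apply: ge0_le_integral => //.
- by move=> x _; rewrite mule_ge0// lee_fin normal_pdf_ge0.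
- have : measurable_fun setT (fun x => (`|f x| * normal_pdf m s x)%:E); last exact.
  apply/measurable_EFinP/measurable_funM; first exact: measurableT_comp.
  exact: measurable_normal_pdf.
- have : measurable_fun setT (fun x : R => (`|f x * normal_pdf m s x|%R)%:E); last exact.
  apply/measurable_EFinP; apply: measurableT_comp => //.
  by apply: measurable_funM => //; exact: measurable_normal_pdf.
- by move=> x _; rewrite /= normrM EFinM (ger0_norm (normal_pdf_ge0 _ _ _)).
Qed.

Lemma Rintegral_normal (f : R -> R) : measurable_fun setT f ->
  mu.-integrable setT (fun x => (f x * normal_pdf m s x)%:E) ->
  (\int[normal_prob m s]_x f x = \int[mu]_x (f x * normal_pdf m s x))%R.
Proof.
move=> mf intf; have If := normal_integrable mf intf.
have dom := normal_prob_dominates m s; congr fine.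
have mfe : measurable_fun setT (EFin \o f) by exact/measurable_EFinP.
rewrite integralE [RHS]integralE; congr (_ - _).
  rewrite ge0_integral_normal//; last exact: measurable_funepos.
  apply: eq_integral => x _; rewrite !funeposE EFinM muleC maxe_pMr ?mule0 1?muleC//.
  by rewrite lee_fin normal_pdf_ge0.
rewrite ge0_integral_normal//; last exact: measurable_funeneg.
apply: eq_integral => x _; rewrite !funenegE EFinM -mulNe muleC.
by rewrite maxe_pMr ?mule0 1?muleC// lee_fin normal_pdf_ge0.
Qed.

End normal_integral.

Section integral_derivative.
Context {R : realType}.
Notation mu := (@lebesgue_measure R).

Lemma cvg_integral_itv_centered (f : R -> R) (m : R) :
  mu.-integrable setT (EFin \o f) ->
  (\int[mu]_(x in [set` `[m - n.+1%:R, m + n.+1%:R]%R]) (f x)%:E)%E @[n --> \oo] -->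
  (\int[mu]_x (f x)%:E)%E.
Proof.
move=> intf; have mf := measurable_int mu intf.
pose I n : set R := `[m - n.+1%:R, m + n.+1%:R]%classic.
have mfI n : measurable_fun setT ((EFin \o f) \_ (I n)).
  apply/(measurable_restrictT _ _).1; first exact: measurable_itv.
  exact: measurable_funTS.
have [|||_ _ H] := @dominated_convergence _ _ _ mu _ measurableT
  (fun n => (EFin \o f) \_ (I n)) (EFin \o f) (abse \o (EFin \o f)) mfI mf.
- apply/aeW => x _; apply: cvg_near_cst.
  near=> n; rewrite patchE ifT// inE /I/= in_itv/=.
  have : `|x - m| <= n.+1%:R.
    near: n; exists (Num.truncn `|x - m|) => //= n /= hn.
    by rewrite ltW// (lt_le_trans (truncnS_gt _))// ler_nat ltnS.
  by rewrite ler_norml; lra.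
- by apply: integrable_abse.
- apply/aeW => x n _; rewrite patchE; case: ifP => // _.
  by rewrite abse0 abse_ge0.
- by under eq_fun do rewrite integral_mkcond.
Unshelve. all: end_near. Qed.

(** Every Gaussian integration by parts below is an instance: the decay of F
   makes the boundary terms vanish. *)
Lemma integral_derivative_eq0 (F f : R -> R) (m K : R) :
  (forall x : R, is_derive x 1 F (f x)) -> continuous f ->
  mu.-integrable setT (EFin \o f) ->
  (forall x, `|x - m| * `|F x| <= K) ->
  \int[mu]_x f x = 0.
Proof.
move=> dF cf intf FK.
have cF : continuous F.
  move=> x; apply: differentiable_continuous; apply/derivable1_diffP.
  by have [] := dF x.
have E n : (\int[mu]_(x in [set` `[m - n.+1%:R, m + n.+1%:R]%R]) (f x)%:E =
    (F (m + n.+1%:R) - F (m - n.+1%:R))%R%:E)%E.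
  rewrite (@continuous_FTC2 _ f F)//.
  - by rewrite ltrBlDr -addrA ltrDl -natrD ltr0n.
  - exact: continuous_subspaceT.
  - split.
    + by move=> x _; have [] := dF x.
    + exact/cvg_at_right_filter/cF.
    + exact/cvg_at_left_filter/cF.
  - by move=> x _; rewrite derive1E; have [] := dF x.
have := cvg_integral_itv_centered m intf.
under eq_fun do rewrite E.
have fin : (\int[mu]_x (f x)%:E)%E \is a fin_num by exact: integrable_fin_num.
rewrite -(fineK fin) => /fine_cvgP[_ /=] cvg1.
apply: (@cvg_unique _ (@Rhausdorff R) _ _ _ _ cvg1) => /=.
apply: norm_cvg0; apply: (@squeeze_cvgr _ _ _ _ (cst 0)
  (fun n => 2 * K * n.+1%:R^-1)).
- apply/nearW => n; rewrite /cst normr_ge0/=.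
  have n0 : 0 < n.+1%:R :> R by [].
  rewrite ler_pdivlMr//.
  apply: (@le_trans _ _ (n.+1%:R * `|F (m + n.+1%:R)| +
      n.+1%:R * `|F (m - n.+1%:R)|)).
    by rewrite -mulrDr mulrC ler_pM2l// ler_normB.
  have := FK (m + n.+1%:R); have := FK (m - n.+1%:R).
  rewrite -!(addrAC _ (- m)) subrr !add0r normrN ger0_norm//; lra.
- exact: cvg_cst.
- rewrite -[X in _ --> X](mulr0 (2 * K)); apply: cvgMr.
  exact: cvg_harmonic.
Qed.

End integral_derivative.

Lemma norm_le_1Dsqr (R : realType) (y : R) : `|y| <= 1 + y ^+ 2.
Proof.
rewrite -(real_normK (num_real y)).
by have := sqr_ge0 (`|y| - 1); have := normr_ge0 y; nra.
Qed.

Section normal_moments.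
Context {R : realType}.
Variables (m s : R).
Hypothesis s0 : s != 0.
Notation mu := (@lebesgue_measure R).
Notation phi := (normal_pdf m s).

Let s2gt0 : 0 < s ^+ 2. Proof. by rewrite exprn_even_gt0. Qed.

Lemma is_derive_normal_pdf (x : R) :
  is_derive x 1 phi (- (x - m) / s ^+ 2 * phi x).
Proof.
rewrite normal_pdfE//.
have -> : (fun x => normal_peak s * normal_fun m s x) =
    normal_peak s *: (expR \o (- (s ^+ 2 *+ 2)^-1 *: ((@id R - cst m) ^+ 2))).
  apply/funext => y; rewrite /normal_fun !fctE /=; congr (_ * expR _).
  by rewrite mulNr mulrC -mulNr.
apply: is_derive_eq; rewrite /= !fctE /GRing.scale/=.
have -> : - (s ^+ 2 *+ 2)^-1 * (x - m) ^+ 2 = - (x - m) ^+ 2 / (s ^+ 2 *+ 2).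
  by rewrite !mulNr mulrC.
rewrite -/(normal_fun m s x) subr0 mulr1 expr1; generalize (normal_fun m s x).
by move=> E; rewrite -(mulr_natr (s ^+ 2)); field.
Qed.

Let peak2 := normal_peak (Num.sqrt 2 * s).

Let s20 : Num.sqrt 2 * s != 0 :> R.
Proof. by rewrite mulf_neq0// gt_eqF// sqrtr_gt0. Qed.

Let peak2_gt0 : 0 < peak2. Proof. exact: normal_peak_gt0. Qed.

(** The quadratic factor costs a doubling of the variance. *)
Let normal_pdf_quadratic (x : R) : (x - m) ^+ 2 * phi x <=
  (4 * s ^+ 2 * normal_peak s / peak2) * normal_pdf m (Num.sqrt 2 * s) x.
Proof.
rewrite !normal_pdfE// -/peak2.
have -> : 4 * s ^+ 2 * normal_peak s / peak2 *
    (peak2 * normal_fun m (Num.sqrt 2 * s) x) =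
    normal_peak s * (4 * s ^+ 2 * normal_fun m (Num.sqrt 2 * s) x).
  by field; rewrite gt_eqF.
rewrite (mulrCA _ (normal_peak s)) ler_pM2l ?normal_peak_gt0// /normal_fun.
rewrite exprMn sqr_sqrtr// -(mulr_natr (s ^+ 2)) -(mulr_natr (2 * s ^+ 2)).
set u := (x - m) ^+ 2 / (4 * s ^+ 2).
have -> : (x - m) ^+ 2 = 4 * s ^+ 2 * u by rewrite /u; field.
have -> : - (4 * s ^+ 2 * u) / (s ^+ 2 * 2%:R) = - u + - u by field.
have -> : - (4 * s ^+ 2 * u) / (2 * s ^+ 2 * 2%:R) = - u by field.
rewrite -(mulrA (4 * s ^+ 2)) ler_pM2l; last by rewrite mulr_gt0.
rewrite expRD mulrA -[leRHS]mul1r ler_pM2r ?expR_gt0// expRN.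
by rewrite ler_pdivrMr ?expR_gt0// mul1r; have := expR_ge1Dx u; lra.
Qed.

Lemma normal_pdf_decay : exists K : R, forall x, (1 + (x - m) ^+ 2) * phi x <= K.
Proof.
exists (normal_peak s + 4 * s ^+ 2 * normal_peak s) => x.
rewrite mulrDl mul1r lerD ?normal_pdf_ub//.
apply: (le_trans (normal_pdf_quadratic x)).
rewrite -mulrA ler_piMr//.
  by rewrite mulr_ge0 ?normal_peak_ge0// mulr_ge0// ltW.
by rewrite ler_pdivrMl// mulr1 normal_pdf_ub.
Qed.

Lemma integrable_normal_quadratic :
  mu.-integrable setT (fun x => ((1 + (x - m) ^+ 2) * phi x)%:E).
Proof.
have mphi := measurable_normal_pdf m s.
have mx : measurable_fun setT (fun x : R => x - m) by exact: measurable_funB.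
apply: (@le_integrable _ _ _ mu _ measurableT _
  (fun x => (phi x + (4 * s ^+ 2 * normal_peak s / peak2) *
     normal_pdf m (Num.sqrt 2 * s) x)%:E)).
- apply/measurable_EFinP; apply: measurable_funM => //.
  by apply: measurable_funD => //; exact: measurable_funX.
- move=> x _; rewrite lee_fin !ger0_norm.
  + by rewrite mulrDl mul1r lerD2l normal_pdf_quadratic.
  + apply: addr_ge0; first exact: normal_pdf_ge0.
    rewrite mulr_ge0 ?normal_pdf_ge0// divr_ge0 ?(ltW peak2_gt0)//.
    by rewrite mulr_ge0 ?normal_peak_ge0// mulr_ge0// ltW.
  + by rewrite mulr_ge0 ?normal_pdf_ge0// addr_ge0// sqr_ge0.
- under eq_fun do rewrite EFinD EFinM.
  apply: integrableD => //; first exact: integrable_normal_pdf.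
  by apply: integrableZl => //; exact: integrable_normal_pdf.
Qed.

Lemma integrable_normal_dominated (f : R -> R) : measurable_fun setT f ->
  (forall x, `|f x| <= 1 + (x - m) ^+ 2) ->
  mu.-integrable setT (fun x => (f x * phi x)%:E).
Proof.
move=> mf fle; apply: le_integrable integrable_normal_quadratic => //.
- apply/measurable_EFinP; apply: measurable_funM => //.
  exact: measurable_normal_pdf.
- move=> x _; rewrite lee_fin !normrM ler_wpM2r//.
  by apply: (le_trans (fle x)); exact: ler_norm.
Qed.

End normal_moments.

Section normal_characteristic.
Context {R : realType}.
Variables (m s : R).
Hypothesis s0 : s != 0.
Notation mu := (@lebesgue_measure R).
Notation phi := (normal_pdf m s).

Let phi_continuous : continuous phi. Proof. exact: continuous_normal_pdf. Qed.

Let sub_continuous : continuous (fun x : R => x - m).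
Proof. by move=> x; apply: cvgB; [exact: cvg_id|exact: cvg_cst]. Qed.

Lemma integral_normal_pdf_linear : \int[mu]_x ((x - m) * phi x) = 0.
Proof.
have [K decay] := normal_pdf_decay m s0.
apply: (@integral_derivative_eq0 _ (fun x => (- s ^+ 2) * phi x)
  (fun x => (x - m) * phi x) m (s ^+ 2 * K)).
- move=> x; have dphi := is_derive_normal_pdf m s0 x.
  rewrite (_ : (fun x => _) = (- s ^+ 2) *: phi)//.
  by apply: is_derive_eq; rewrite /GRing.scale/=; field.
- move=> x; apply: cvgM; [exact: sub_continuous|exact: phi_continuous].
- apply: integrable_normal_dominated => //; first exact: measurable_funB.
  by move=> x; exact: norm_le_1Dsqr.
- move=> x; rewrite normrM normrN (ger0_norm (sqr_ge0 _)) mulrCA.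
  rewrite ler_wpM2l ?sqr_ge0// (le_trans _ (decay x))//.
  by rewrite ger0_norm ?normal_pdf_ge0// ler_wpM2r ?normal_pdf_ge0 ?norm_le_1Dsqr.
Qed.

Let integral_phi : \int[mu]_x phi x = 1.
Proof. by rewrite /Rintegral integral_normal_pdf. Qed.

Lemma integral_normal_pdf_quadratic :
  \int[mu]_x ((x - m) ^+ 2 * phi x) = s ^+ 2.
Proof.
have [K decay] := normal_pdf_decay m s0.
have I2 : mu.-integrable setT (fun x => ((x - m) ^+ 2 * phi x)%:E).
  apply: integrable_normal_dominated => //.
    by apply: measurable_funX; exact: measurable_funB.
  by move=> x; rewrite ger0_norm ?sqr_ge0//; lra.
have I0 : mu.-integrable setT (fun x => (s ^+ 2 * phi x)%:E).
  under eq_fun do rewrite EFinM.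
  by apply: integrableZl => //; exact: integrable_normal_pdf.
apply/eqP; rewrite -subr_eq0; apply/eqP.
have -> : s ^+ 2 = \int[mu]_x (s ^+ 2 * phi x).
  by rewrite RintegralZl ?integral_phi ?mulr1//; exact: integrable_normal_pdf.
rewrite -RintegralB//.
apply: (@integral_derivative_eq0 _ (fun x => (- s ^+ 2) * ((x - m) * phi x))
  (fun x => (x - m) ^+ 2 * phi x - s ^+ 2 * phi x) m (s ^+ 2 * K)).
- move=> x; have dphi := is_derive_normal_pdf m s0 x.
  rewrite (_ : (fun x => _) = (- s ^+ 2) *: (((@id R) - cst m) * phi))//.
  by apply: is_derive_eq; rewrite /= !fctE /GRing.scale/=; field.
- move=> x; apply: cvgB.
    apply: cvgM; last exact: phi_continuous.
    by apply: (@continuous_comp _ _ _ (fun x => x - m) (fun x => x ^+ 2));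
      [exact: sub_continuous|exact: exprn_continuous].
  by apply: cvgM; [exact: cvg_cst|exact: phi_continuous].
- exact: (integrableB measurableT I2 I0).
- move=> x; rewrite !normrM normrN (ger0_norm (sqr_ge0 _)) mulrCA.
  rewrite ler_wpM2l ?sqr_ge0// (le_trans _ (decay x))//.
  rewrite (ger0_norm (normal_pdf_ge0 _ _ _)) mulrA.
  rewrite ler_wpM2r ?normal_pdf_ge0// -expr2 (real_normK (num_real _)).
  by rewrite lerDr.
Qed.

Let arg t th (x : R) := t * (x - m) + th.

Let measurable_arg t th : measurable_fun setT (arg t th).
Proof.
apply: measurable_funD => //; apply: measurable_funM => //.
exact: measurable_funB.
Qed.

Let continuous_arg t th : continuous (arg t th).
Proof.
move=> x; apply: cvgD; last exact: cvg_cst.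
by apply: cvgM; [exact: cvg_cst|exact: sub_continuous].
Qed.

Let trig_quadratic (t : R) (x : R) : `|t| <= 1 -> `|t| <= 1 + (x - m) ^+ 2.
Proof. by move=> /le_trans; apply; rewrite lerDl sqr_ge0. Qed.

Let integrable_cos t th : mu.-integrable setT (fun x => (cos (arg t th x) * phi x)%:E).
Proof.
apply: integrable_normal_dominated => //.
  apply: measurableT_comp => //; exact: continuous_measurable_fun (@continuous_cos R).
by move=> x; apply: trig_quadratic; rewrite ler_norml cos_geN1 cos_le1.
Qed.

Let measurable_xsin t th :
  measurable_fun setT (fun x : R => (x - m) * sin (arg t th x)).
Proof.
apply: measurable_funM; first exact: measurable_funB.
apply: measurableT_comp => //; exact: continuous_measurable_fun (@continuous_sin R).
Qed.

Let xsin_quadratic t th x : `|(x - m) * sin (arg t th x)| <= 1 + (x - m) ^+ 2.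
Proof.
rewrite normrM (le_trans _ (norm_le_1Dsqr (x - m)))// ler_piMr//.
by rewrite ler_norml sin_geN1 sin_le1.
Qed.

Let integrable_xsin t th :
  mu.-integrable setT (fun x => ((x - m) * sin (arg t th x) * phi x)%:E).
Proof. exact: integrable_normal_dominated. Qed.

Let psi th t := \int[mu]_x (cos (arg t th x) * phi x).

(** Integration by parts with the primitive - s^2 phi of (x - m) phi. *)
Let integral_xsin t th :
  \int[mu]_x ((x - m) * sin (arg t th x) * phi x) = s ^+ 2 * t * psi th t.
Proof.
have [K decay] := normal_pdf_decay m s0.
have IZ : mu.-integrable setT
    (fun x => (s ^+ 2 * t * (cos (arg t th x) * phi x))%:E).
  by under eq_fun do rewrite EFinM; exact: integrableZl.
rewrite /psi -RintegralZl//; last exact: integrable_cos.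
apply/eqP; rewrite -subr_eq0; apply/eqP.
rewrite -(RintegralB measurableT (integrable_xsin t th) IZ).
apply: (@integral_derivative_eq0 _
  (fun x => (- s ^+ 2) * (sin (arg t th x) * phi x))
  (fun x => (x - m) * sin (arg t th x) * phi x -
    s ^+ 2 * t * (cos (arg t th x) * phi x)) m (s ^+ 2 * K)).
- move=> x; have dphi := is_derive_normal_pdf m s0 x.
  rewrite (_ : (fun x => _) = (- s ^+ 2) *:
    ((sin \o (t *: ((@id R) - cst m) + cst th)) * phi))//.
  apply: is_derive_eq; rewrite /= !fctE /GRing.scale/= /arg; by field.
- move=> x; apply: cvgB.
    apply: cvgM; last exact: phi_continuous.
    apply: cvgM; first exact: sub_continuous.
    by apply: continuous_comp; [exact: continuous_arg|exact: continuous_sin].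
  apply: cvgM; first exact: cvg_cst.
  apply: cvgM; last exact: phi_continuous.
  by apply: continuous_comp; [exact: continuous_arg|exact: continuous_cos].
- exact: (integrableB measurableT (integrable_xsin t th) IZ).
- move=> x; rewrite !normrM normrN (ger0_norm (sqr_ge0 _)) mulrCA.
  rewrite ler_wpM2l ?sqr_ge0// (le_trans _ (decay x))//.
  rewrite (ger0_norm (normal_pdf_ge0 _ _ _)) mulrA.
  rewrite ler_wpM2r ?normal_pdf_ge0// (le_trans _ (norm_le_1Dsqr (x - m)))// ler_piMr//.
  by rewrite ler_norml sin_geN1 sin_le1.
Qed.

Let is_derive_psi th (t : R) : is_derive t 1 (psi th) (- (s ^+ 2 * t * psi th t)).
Proof.
pose f t x := cos (arg t th x) * phi x.
have df u x : is_derive (u : R) 1 (f^~ x) (- ((x - m) * sin (arg u th x) * phi x)).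
  rewrite (_ : f^~ x = phi x *: (cos \o ((x - m) *: (@id R) + cst th))); last first.
    by apply/funext => v; rewrite /f /arg !fctE/= /GRing.scale/= [RHS]mulrC (mulrC v).
  apply: is_derive_eq; rewrite /= !fctE /GRing.scale/= /arg (mulrC u); ring.
have d1f u x : partial1of2 f u x = - ((x - m) * sin (arg u th x) * phi x).
  by rewrite partial1of2E; have [] := df u x.
have G0 x : 0 <= (1 + (x - m) ^+ 2) * phi x.
  by rewrite mulr_ge0 ?normal_pdf_ge0// addr_ge0 ?sqr_ge0.
have tI : [set` `]t - 1, t + 1[%R] t by rewrite /= in_itv/=; apply/andP; split; lra.
have intf u : [set` `]t - 1, t + 1[%R] u -> mu.-integrable setT (EFin \o f u).
  by move=> _; exact: integrable_cos.
have derf u y : [set` `]t - 1, t + 1[%R] u -> setT y -> derivable (f^~ y) u 1.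
  by move=> _ _; have [] := df u y.
have Gub u y : [set` `]t - 1, t + 1[%R] u -> setT y ->
    `|partial1of2 f u y| <= (1 + (y - m) ^+ 2) * phi y.
  move=> _ _; rewrite d1f normrN normrM (ger0_norm (normal_pdf_ge0 _ _ _)).
  by rewrite ler_wpM2r ?normal_pdf_ge0.
apply: DeriveDef.
  exact: (derivable_under_integral measurableT tI intf derf G0
    (integrable_normal_quadratic m s0) Gub).
rewrite -derive1E (differentiation_under_integral measurableT tI intf derf G0
    (integrable_normal_quadratic m s0) Gub).
under eq_Rintegral do rewrite d1f -mulN1r.
rewrite RintegralZl//; last exact: integrable_xsin.
by rewrite integral_xsin mulN1r.
Qed.

(** The integral psi satisfies psi' = - s^2 t psi, so psi times
   exp (s^2 t^2 / 2) is constant.  The phase th stands for the real and imaginary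
   parts of the complex characteristic function at once. *)
Lemma integral_normal_pdf_cos t th :
  \int[mu]_x (cos (t * (x - m) + th) * phi x) =
  expR (- (s ^+ 2 * t ^+ 2 / 2)) * cos th.
Proof.
pose h t := psi th t * expR (s ^+ 2 * t ^+ 2 / 2).
have : h t = h 0.
  apply: is_derive_0_is_cst => u; have dpsi := is_derive_psi th u.
  rewrite (_ : h = psi th * (expR \o ((s ^+ 2 / 2) *: (@id R) ^+ 2))).
    by apply: is_derive_eq; rewrite /= !fctE /GRing.scale/=; field.
  by apply/funext => v; rewrite /h !fctE/= /GRing.scale/= [in RHS]mulrAC.
rewrite /h expr0n/= mulr0 mul0r expR0 mulr1.
have -> : psi th 0 = cos th.
  rewrite /psi /arg; under eq_Rintegral do rewrite mul0r add0r.
  by rewrite RintegralZl ?integral_phi ?mulr1//; exact: integrable_normal_pdf.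
by move=> <-; rewrite expRN mulrC mulfK // gt_eqF ?expR_gt0.
Qed.

End normal_characteristic.

(** * Bounded expectations and the standard Gaussian measure *)

Lemma Rintegral_probability_cst (R : realType) d (T : measurableType d)
  (P : probability T R) (r : R) : \int[P]_x r = r.
Proof. by rewrite Rintegral_cst//= probability_setT mulr1. Qed.

Section normal_probability_moments.
Context {R : realType}.
Variables (m s : R).
Hypothesis s0 : s != 0.
Notation N := (normal_prob m s).

Lemma normal_integrable_quadratic (f : R -> R) : measurable_fun setT f ->
  (forall x, `|f x| <= 1 + (x - m) ^+ 2) -> N.-integrable setT (EFin \o f).
Proof.
by move=> mf fle; apply: normal_integrable => //; exact: integrable_normal_dominated.
Qed.

Lemma normal_mean : \int[N]_x x = m.
Proof.
have mB : measurable_fun setT (fun x : R => x - m) by exact: measurable_funB.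
have I1 : N.-integrable setT (EFin \o (fun x : R => x - m)).
  by apply: normal_integrable_quadratic => // x; exact: norm_le_1Dsqr.
have Im : N.-integrable setT (EFin \o (fun x : R => m)).
  exact: finite_measure_integrable_cst.
have -> : \int[N]_x x = \int[N]_x ((x - m) + m).
  by apply: eq_Rintegral => x _; rewrite subrK.
rewrite RintegralD// (Rintegral_probability_cst (normal_prob m s)).
rewrite Rintegral_normal ?integral_normal_pdf_linear ?add0r//.
by apply: integrable_normal_dominated => // x; exact: norm_le_1Dsqr.
Qed.

Lemma normal_variance : \int[N]_x ((x - m) ^+ 2) = s ^+ 2.
Proof.
rewrite Rintegral_normal ?integral_normal_pdf_quadratic//.
  by apply: measurable_funX; exact: measurable_funB.
apply: integrable_normal_dominated => //.
  by apply: measurable_funX; exact: measurable_funB.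
by move=> x; rewrite ger0_norm ?sqr_ge0// lerDr.
Qed.

Lemma normal_cos (t th : R) : \int[N]_x cos (t * (x - m) + th) =
  expR (- (s ^+ 2 * t ^+ 2 / 2)) * cos th.
Proof.
have mc : measurable_fun setT (fun x : R => cos (t * (x - m) + th)).
  apply: measurableT_comp; first exact: continuous_measurable_fun (@continuous_cos R).
  by apply: measurable_funD => //; apply: measurable_funM => //; exact: measurable_funB.
rewrite Rintegral_normal ?integral_normal_pdf_cos//.
apply: integrable_normal_dominated => // x.
apply: (@le_trans _ _ 1); first by rewrite ler_norml cos_geN1 cos_le1.
by rewrite lerDl sqr_ge0.
Qed.

End normal_probability_moments.

Section bounded_expectation.
Context {R : realType}.

Lemma bounded_integrable d (T : measurableType d) (P : probability T R)
    (f : T -> R) (M : R) (D : set T) : measurable D ->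
  measurable_fun setT f -> (forall x, `|f x| <= M) ->
  P.-integrable D (EFin \o f).
Proof.
move=> mD mf fM; apply: (@le_integrable _ _ _ P _ mD _ (EFin \o cst M)).
- by apply/measurable_EFinP; exact: measurable_funTS.
- by move=> x _; rewrite lee_fin /= (le_trans (fM x))// ler_norm.
- apply: (integrableS measurableT) => //.
  exact: finite_measure_integrable_cst.
Qed.

Lemma Rintegral_product d1 d2 (T1 : measurableType d1) (T2 : measurableType d2)
    (P1 : probability T1 R) (P2 : probability T2 R) (f : T1 * T2 -> R) (M : R) :
  measurable_fun setT f -> (forall x, `|f x| <= M) ->
  \int[(P1 \x P2)%E]_z f z = \int[P1]_x \int[P2]_y f (x, y).
Proof.
move=> mf fM; rewrite /Rintegral.
have If : (P1 \x P2)%E.-integrable setT (EFin \o f).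
  exact: (bounded_integrable (P1 \x P2)%E measurableT mf fM).
rewrite -integral12_prod_meas1//; congr fine; apply: eq_integral => x _.
rewrite /fubini_F fineK//; apply: integrable_fin_num => //.
apply: (@bounded_integrable _ _ _ _ M) => //.
exact: measurableT_comp.
Qed.

Lemma Rintegral_distribution d1 d2 (T1 : measurableType d1)
    (T2 : measurableType d2) (P : probability T1 R) (X : {mfun T1 >-> T2})
    (f : T2 -> R) (M : R) : measurable_fun setT f -> (forall x, `|f x| <= M) ->
  \int[distribution P X]_y f y = \int[P]_x f (X x).
Proof.
move=> mf fM; rewrite /Rintegral integral_pushforward//.
- exact/measurable_EFinP.
- rewrite preimage_setT; apply: (@bounded_integrable _ _ _ _ M) => //.
  by apply: measurableT_comp.
Qed.

Lemma measurable_fun_cos d (T : measurableType d) (f : T -> R) :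
  measurable_fun setT f -> measurable_fun setT (fun x => cos (f x)).
Proof.
by move=> mf; apply: measurableT_comp => //;
  exact: continuous_measurable_fun (@continuous_cos R).
Qed.

Lemma cos_norm_le1 (x : R) : `|cos x| <= 1.
Proof. by rewrite ler_norml cos_geN1 cos_le1. Qed.

(** The induction on the dimension needs the phase th: once the other
   coordinates are integrated out, the first one is left inside it. *)
Lemma std_gaussian_cos n (c : nat -> R) (th : R) :
  \int[std_gaussian n]_x cos (\sum_(i < n) c i * tnth x i + th) =
  expR (- (\sum_(i < n) c i ^+ 2) / 2) * cos th.
Proof.
elim: n c th => [|n IH] c th.
  rewrite /Rintegral integral_dirac//=; last first.
    apply/measurable_EFinP/measurable_fun_cos; apply: measurable_funD => //.
    by apply: measurable_sum => -[].
  by rewrite indicT mul1r !big_ord0 add0r oppr0 mul0r expR0 mul1r.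
have mf : measurable_fun setT
    (fun x : n.+1.-tuple R => cos (\sum_(i < n.+1) c i * tnth x i + th)).
  apply: measurable_fun_cos; apply: measurable_funD => //.
  apply: measurable_sum => i; apply: measurable_funM => //.
  exact: measurable_tnth.
rewrite /= (@Rintegral_distribution _ _ _ _ _ _ _ 1)//; last by move=> x; exact: cos_norm_le1.
rewrite (@Rintegral_product _ _ _ _ _ _ _ 1); last by move=> x; exact: cos_norm_le1.
  have E (x : R) : \int[std_gaussian n]_y
      cos (\sum_(i < n.+1) c i * tnth (uncurried_cons (x, y)) i + th) =
      expR (- (\sum_(i < n) c i.+1 ^+ 2) / 2) * cos (c 0%N * (x - 0) + th).
    rewrite -(IH (fun i => c i.+1)); apply: eq_Rintegral => y _.
    rewrite big_ord_recl subr0 [_ + (_ + th)]addrCA addrA; congr (cos (_ + _ + _)).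
    apply: eq_bigr => i _; congr (_ * _).
    by rewrite !(tnth_nth 0).
  under eq_Rintegral do rewrite E.
  rewrite RintegralZl//; last first.
    apply: (@bounded_integrable _ _ _ _ 1) => //; last by move=> x; exact: cos_norm_le1.
    apply: measurable_fun_cos; apply: measurable_funD => //.
    by apply: measurable_funM => //; exact: measurable_funB.
  rewrite normal_cos ?oner_neq0// mulrA -expRD big_ord_recl; congr (expR _ * _).
  by rewrite expr1n mul1r; lra.
exact: (measurableT_comp mf (@measurable_uncurried_cons R n)).
Qed.

End bounded_expectation.

(** * Trigonometric bump functions *)

Section trigonometric_bump.
Context {R : realType}.

Lemma sin_mean_value (z : R) : 0 <= z ->
  exists2 c, 0 <= c <= z & sin z = cos c * z.
Proof.
move=> z0.
have [|c cz] := @MVT_segment R sin cos _ _ z0.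
- by apply: continuous_subspaceT => x; exact: continuous_sin.
- by rewrite sin0 !subr0 => ->; exists c.
Qed.

Lemma sin_sqr_le (z : R) : sin z ^+ 2 <= z ^+ 2.
Proof.
wlog z0 : z / 0 <= z.
  move=> H; have [/H//|/ltW z0] := leP 0 z.
  by have := H (- z); rewrite sinN !sqrrN oppr_ge0; exact.
have [c _ ->] := sin_mean_value z0.
by rewrite exprMn ler_piMl ?sqr_ge0// -(cos2Dsin2 c) lerDl sqr_ge0.
Qed.

Lemma cos_ge_half (x : R) : `|x| <= 1 -> 1 / 2 <= cos x.
Proof.
move=> x1; have := sin_sqr_le (x / 2); have := sin2cos2 (x / 2).
have -> : cos x = cos (x / 2) ^+ 2 *+ 2 - 1.
  by rewrite -cos_mulr2n -[x / 2 *+ 2]mulr_natr divfK.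
have -> : (x / 2) ^+ 2 = x ^+ 2 / 4 by field.
have : x ^+ 2 <= 1 by rewrite -(real_normK (num_real x)) exprn_ile1.
lra.
Qed.

Lemma sin_sqr_ge (z : R) : `|z| <= 1 -> (z / 2) ^+ 2 <= sin z ^+ 2.
Proof.
wlog z0 : z / 0 <= z.
  move=> H; have [/H//|/ltW z0] := leP 0 z.
  rewrite -normrN => /H; rewrite oppr_ge0 z0 sinN mulNr !sqrrN; exact.
rewrite ger0_norm// => z1; have [c /andP[c0 cz] ->] := sin_mean_value z0.
have cc : 1 / 2 <= cos c by rewrite cos_ge_half// ger0_norm// (le_trans cz).
rewrite lerXn2r ?nnegrE ?mulr_ge0// ?divr_ge0//; first by apply: le_trans cc.
by rewrite mulrC -[2^-1]mul1r ler_wpM2r.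
Qed.

Lemma bernoulli_le (y : R) N : 0 <= y <= 1 -> 1 - N%:R * y <= (1 - y) ^+ N.
Proof.
move=> /andP[y0 y1]; elim: N => [|N IH]; first by rewrite mul0r subr0.
rewrite exprS -natr1; apply: (@le_trans _ _ ((1 - y) * (1 - N%:R * y))).
  by have : 0 <= N%:R :> R by []; nra.
by rewrite ler_wpM2l// subr_ge0.
Qed.

Lemma bernoulli_ge (y : R) N : 0 <= y <= 1 -> (1 - y) ^+ N * (1 + N%:R * y) <= 1.
Proof.
move=> /andP[y0 y1]; elim: N => [|N IH]; first by rewrite mul0r addr0 mulr1.
apply: le_trans IH; rewrite exprSr -mulrA ler_wpM2l ?exprn_ge0 ?subr_ge0//.
by rewrite -natr1; have : 0 <= N%:R :> R by []; nra.
Qed.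

(** With K = k + 1 this is close to (y / t)^2 / K for large k, while remaining a
   trigonometric polynomial in y. *)
Definition sin2_scaled (t : R) k (y : R) : R :=
  sin (y / (t * Num.sqrt k.+1%:R)) ^+ 2.

(** By the Bernoulli inequalities this is between 1 - S and 1 / (1 + S), where S
   is the sum of the (K sin2_scaled)^K, which are at most (y / t)^(2 K).  Hence it
   tends to 1 if all the y are below t in absolute value, and to 0 if one of them
   is above 2 t.  Dividing by the size of v keeps the base in [0, 1]. *)
Definition trig_bump (t : R) k (v : seq R) : R :=
  (1 - (size v)%:R^-1 * \sum_(y <- v) sin2_scaled t k y ^+ k.+1)
    ^+ (size v * k.+1 ^ k.+1).

Let mean (t : R) k (v : seq R) :=
  (size v)%:R^-1 * \sum_(y <- v) sin2_scaled t k y ^+ k.+1.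

Let sin2_01 t k y : 0 <= sin2_scaled t k y <= 1.
Proof.
by rewrite /sin2_scaled sqr_ge0/= -[leRHS](cos2Dsin2 (y / (t * Num.sqrt k.+1%:R)))
  lerDr sqr_ge0.
Qed.

Let mean_01 t k v : 0 <= mean t k v <= 1.
Proof.
rewrite /mean mulr_ge0 ?invr_ge0//=; last first.
  by apply: sumr_ge0 => y _; rewrite exprn_ge0//; case/andP: (sin2_01 t k y).
case: v => [|y v]; first by rewrite big_nil mulr0.
rewrite ler_pdivrMl ?ltr0n// mulr1.
elim: (y :: v) => {y v} [|y v IH]; first by rewrite big_nil.
rewrite big_cons -natr1 addrC lerD// exprn_ile1//;
  by case/andP: (sin2_01 t k y).
Qed.

Lemma trig_bump_01 t k v : 0 <= trig_bump t k v <= 1.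
Proof.
have /andP[m0 m1] := mean_01 t k v.
by rewrite exprn_ge0 ?exprn_ile1 ?subr_ge0 ?lerBlDr ?lerDl.
Qed.

Let scaled_sum t k v : (size v * k.+1 ^ k.+1)%:R * mean t k v =
  \sum_(y <- v) (k.+1%:R * sin2_scaled t k y) ^+ k.+1.
Proof.
rewrite /mean; case: v => [|y v]; first by rewrite !big_nil !mulr0.
rewrite natrM mulrACA divff ?mul1r ?pnatr_eq0// mulr_sumr.
by apply: eq_bigr => z _; rewrite [RHS]exprMn natrX.
Qed.

Let sqrtk_gt0 k : 0 < Num.sqrt k.+1%:R :> R.
Proof. by rewrite sqrtr_gt0. Qed.

Let scaled_arg t k y : t != 0 ->
  k.+1%:R * (y / (t * Num.sqrt k.+1%:R)) ^+ 2 = (y / t) ^+ 2 :> R.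
Proof.
move=> t0; rewrite -{1}(sqr_sqrtr (ler0n R k.+1)).
by field; rewrite t0 gt_eqF.
Qed.

Lemma cvg_trig_bump1 (t : R) (v : seq R) : 0 < t ->
  (forall y, y \in v -> `|y| < t) -> trig_bump t k v @[k --> \oo] --> (1 : R).
Proof.
move=> t0 vt.
have lb k : 1 - \sum_(y <- v) ((y / t) ^+ 2) ^+ k.+1 <= trig_bump t k v.
  apply: le_trans (bernoulli_le _ (mean_01 t k v)).
  rewrite lerB// scaled_sum; apply: ler_sum => y _.
  have s0 : 0 <= sin2_scaled t k y by case/andP: (sin2_01 t k y).
  have Ks0 : 0 <= k.+1%:R * sin2_scaled t k y by rewrite mulr_ge0.
  rewrite ler_pXn2r// ?nnegrE ?sqr_ge0//.
  by rewrite -(scaled_arg k y (lt0r_neq0 t0)) ler_wpM2l// sin_sqr_le.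
pose l k : R := 1 - \sum_(y <- v) ((y / t) ^+ 2) ^+ k.+1.
apply: (@squeeze_cvgr _ _ _ R l (fun=> 1)).
- by apply/nearW => k; rewrite lb/=; case/andP: (trig_bump_01 t k v).
- rewrite /l -[X in _ --> X]subr0; apply: cvgB; first exact: cvg_cst.
  clear l lb; elim: v vt => [|y v IH] vt.
    by under eq_fun do rewrite big_nil; exact: cvg_cst.
  under eq_fun do rewrite big_cons.
  have cy : ((y / t) ^+ 2) ^+ k.+1 @[k --> \oo] --> (0 : R).
    rewrite (cvg_shiftS (fun k => ((y / t) ^+ 2) ^+ k)); apply: cvg_expr.
    rewrite ger0_norm ?sqr_ge0// -(real_normK (num_real _)) expr_lt1//.
    by rewrite normf_div (gtr0_norm t0) ltr_pdivrMr// mul1r vt// inE eqxx.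
  have {}IH := IH (fun z zv => vt z (mem_behead (s := y :: v) zv)).
  by have := cvgD cy IH; rewrite addr0; exact.
- exact: cvg_cst.
Qed.

(** The margin 2 makes up for the lower bound |sin z| >= |z| / 2. *)
Lemma cvg_trig_bump0 (t : R) (v : seq R) (y : R) : 0 < t ->
  y \in v -> 2 * t < `|y| -> trig_bump t k v @[k --> \oo] --> (0 : R).
Proof.
move=> t0 yv ty; pose rho := ((y / t) / 2) ^+ 2.
have rho1 : 1 < rho.
  rewrite /rho -(real_normK (num_real _)) expr_gt1//.
  rewrite !normf_div (gtr0_norm t0) (gtr0_norm (ltr0n R 2)).
  by rewrite ltr_pdivlMr// ltr_pdivlMr// mul1r.
have rho0 : 0 < rho by apply: lt_trans rho1.
have ub : \forall k \near \oo, trig_bump t k v <= (rho^-1) ^+ k.+1.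
  near=> k; set A := trig_bump t k v; set B := rho ^+ k.+1.
  have B0 : 0 < B by rewrite exprn_gt0.
  rewrite exprVn -[leLHS](mulfK (lt0r_neq0 B0)) ler_pdivrMr// mulVf ?gt_eqF//.
  apply: le_trans (bernoulli_ge (size v * k.+1 ^ k.+1) (mean_01 t k v)).
  rewrite -/(trig_bump t k v) -/A ler_wpM2l//; first by case/andP: (trig_bump_01 t k v).
  rewrite scaled_sum (big_rem y)//= addrA addrAC.
  apply: (@le_trans _ _ ((k.+1%:R * sin2_scaled t k y) ^+ k.+1)); last first.
    rewrite lerDr addr_ge0//; apply: sumr_ge0 => z _; rewrite exprn_ge0// mulr_ge0//.
    by case/andP: (sin2_01 t k z).
  have s0 : 0 <= sin2_scaled t k y by case/andP: (sin2_01 t k y).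
  have Ks0 : 0 <= k.+1%:R * sin2_scaled t k y by rewrite mulr_ge0.
  rewrite ler_pXn2r// ?nnegrE ?(ltW rho0)//.
  have -> : rho = k.+1%:R * (y / (t * Num.sqrt k.+1%:R) / 2) ^+ 2.
    rewrite /rho; have := scaled_arg k y (lt0r_neq0 t0).
    move: (y / t) (y / (t * Num.sqrt k.+1%:R)) => a b ab; rewrite mulrA in ab.
    have -> : (a / 2) ^+ 2 = a ^+ 2 / 4 by field.
    by rewrite -ab; field.
  rewrite ler_wpM2l// sin_sqr_ge// normf_div.
  rewrite (gtr0_norm (mulr_gt0 t0 (sqrtk_gt0 k))).
  rewrite ler_pdivrMr ?mul1r ?mulr_gt0// -ler_pdivrMl//.
  rewrite -(ler_pXn2r (ltn0Sn 1)) ?nnegrE ?mulr_ge0 ?invr_ge0 ?(ltW t0)//.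
  rewrite sqr_sqrtr// -natr1 (le_trans (ltW (truncnS_gt _)))// -natr1 lerD2r ler_nat.
  by near: k; apply: nbhs_infty_ge.
apply: (@squeeze_cvgr _ _ _ R (fun=> 0) (fun k => (rho^-1) ^+ k.+1)).
- near=> k; rewrite (near ub k)//.
  by case/andP: (trig_bump_01 t k v) => ->.
- exact: cvg_cst.
- rewrite (cvg_shiftS (fun k => rho^-1 ^+ k)); apply: cvg_expr.
  by rewrite ger0_norm ?invr_ge0 ?(ltW rho0)// invf_lt1.
Unshelve. all: end_near. Qed.

End trigonometric_bump.

(** * Trigonometric polynomials in a linear family *)

Section trigonometric_polynomials.
Context {R : realType} {E : lmodType R}.

(** A Gaussian vector indexed by its dual space, stripped of its law: xi e is the
   value of the functional e at the random vector. *)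
Definition linear_family d (T : measurableType d) (xi : E -> T -> R) : Prop :=
  (forall e, measurable_fun setT (xi e)) /\
  (forall x (a : R) e e', xi (a *: e + e') x = a * xi e x + xi e' x).

Section one_family.
Context d (T : measurableType d) (xi : E -> T -> R).
Hypothesis lxi : linear_family xi.

Lemma linear_family0 x : xi 0 x = 0.
Proof. by have := lxi.2 x 1 0 0; rewrite scale1r addr0 mul1r; lra. Qed.

Lemma linear_familyD e e' x : xi (e + e') x = xi e x + xi e' x.
Proof. by have := lxi.2 x 1 e e'; rewrite scale1r mul1r. Qed.

Lemma linear_familyZ a e x : xi (a *: e) x = a * xi e x.
Proof. by have := lxi.2 x a e 0; rewrite !addr0 linear_family0 addr0. Qed.

Lemma linear_familyB e e' x : xi (e - e') x = xi e x - xi e' x.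
Proof. by rewrite linear_familyD -scaleN1r linear_familyZ mulN1r. Qed.

Definition trig_eval (s : seq (R * E)) x := \sum_(p <- s) p.1 * cos (xi p.2 x).

Lemma Rintegral_trig_eval (P : probability T R) s :
  \int[P]_x trig_eval s x = \sum_(p <- s) p.1 * \int[P]_x cos (xi p.2 x).
Proof.
have icos e : P.-integrable setT (EFin \o (fun x => cos (xi e x))).
  apply: (@bounded_integrable R _ _ _ _ 1) => //; last by move=> x; exact: cos_norm_le1.
  by apply: measurable_fun_cos; exact: lxi.1.
rewrite /trig_eval; elim: s => [|p s IH].
  rewrite big_nil; under eq_Rintegral do rewrite big_nil.
  by rewrite Rintegral_probability_cst.
rewrite big_cons; under eq_Rintegral do rewrite big_cons.
have ip : P.-integrable setT (EFin \o (fun x => p.1 * cos (xi p.2 x))).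
  rewrite /comp; under eq_fun do rewrite EFinM.
  exact: (integrableZl measurableT _ (icos p.2)).
rewrite RintegralD//; first by rewrite IH RintegralZl//; exact: icos.
elim: s {IH} => [|r s IHs].
  rewrite (_ : _ \o _ = EFin \o cst 0); last first.
    by apply/funext => x; rewrite /= big_nil.
  exact: finite_measure_integrable_cst.
rewrite (_ : _ \o _ = (fun x => (r.1 * cos (xi r.2 x))%:E +
    (\sum_(j <- s) j.1 * cos (xi j.2 x))%:E)%E); last first.
  by apply/funext => x; rewrite /= big_cons EFinD.
apply: integrableD => //; under eq_fun do rewrite EFinM.
exact: (integrableZl measurableT _ (icos r.2)).
Qed.

(** The product-to-sum formula for cosines. *)
Definition trig_mul (s s' : seq (R * E)) : seq (R * E) :=
  [seq (p.1 * r.1 / 2, p.2 + r.2) | p <- s, r <- s'] ++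
  [seq (p.1 * r.1 / 2, p.2 - r.2) | p <- s, r <- s'].

Lemma trig_evalM s s' x :
  trig_eval (trig_mul s s') x = trig_eval s x * trig_eval s' x.
Proof.
rewrite /trig_eval /trig_mul big_cat/= !big_allpairs_dep -big_split/= mulr_suml.
apply: eq_bigr => p _; rewrite -big_split/= mulr_sumr; apply: eq_bigr => r _ /=.
by rewrite linear_familyD linear_familyB cosD cosB; field.
Qed.

End one_family.

Section two_families.
Context d1 d2 (T1 : measurableType d1) (T2 : measurableType d2).
Variables (xi : E -> T1 -> R) (eta : E -> T2 -> R).
Hypotheses (lxi : linear_family xi) (leta : linear_family eta).

(** The same trigonometric polynomial evaluated in two families.  Such functions
   form an algebra, and their expectations agree as soon as those of all the
   cosines do. *)
Definition trig_pair (u : T1 -> R) (v : T2 -> R) : Prop :=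
  exists s, u =1 trig_eval xi s /\ v =1 trig_eval eta s.

Lemma trig_pair_cos e : trig_pair (fun x => cos (xi e x)) (fun x => cos (eta e x)).
Proof.
exists [:: (1, e)]; split => x; rewrite /trig_eval big_cons big_nil addr0 mul1r//.
Qed.

Lemma trig_pair_cst c : trig_pair (fun=> c) (fun=> c).
Proof.
exists [:: (c, 0)]; split => x; rewrite /trig_eval big_cons big_nil addr0.
  by rewrite linear_family0// cos0 mulr1.
by rewrite linear_family0// cos0 mulr1.
Qed.

Lemma trig_pairD u v u' v' : trig_pair u v -> trig_pair u' v' ->
  trig_pair (fun x => u x + u' x) (fun x => v x + v' x).
Proof.
move=> [s [us vs]] [s' [us' vs']]; exists (s ++ s').
by split => x; rewrite /trig_eval big_cat; congr (_ + _).
Qed.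

Lemma trig_pairM u v u' v' : trig_pair u v -> trig_pair u' v' ->
  trig_pair (fun x => u x * u' x) (fun x => v x * v' x).
Proof.
move=> [s [us vs]] [s' [us' vs']]; exists (trig_mul s s').
by split => x; rewrite trig_evalM// ?us ?us' ?vs ?vs'.
Qed.

Lemma trig_pairX u v n : trig_pair u v ->
  trig_pair (fun x => u x ^+ n) (fun x => v x ^+ n).
Proof.
move=> uv; elim: n => [|n IH]; first exact: trig_pair_cst.
have [s [h1 h2]] := trig_pairM uv IH.
by exists s; split => x; rewrite exprS ?h1 ?h2.
Qed.

Lemma trig_pair_sum (I : Type) (r : seq I) (u : I -> T1 -> R) (v : I -> T2 -> R) :
  (forall i, trig_pair (u i) (v i)) ->
  trig_pair (fun x => \sum_(i <- r) u i x) (fun x => \sum_(i <- r) v i x).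
Proof.
move=> uv; elim: r => [|i r IH].
  have [s [h1 h2]] := trig_pair_cst 0.
  by exists s; split => x; rewrite big_nil ?h1 ?h2.
have [s [h1 h2]] := trig_pairD (uv i) IH.
by exists s; split => x; rewrite big_cons ?h1 ?h2.
Qed.

Lemma trig_pair_bump t k (g : seq E) :
  trig_pair (fun x => trig_bump t k [seq xi e x | e <- g])
            (fun x => trig_bump t k [seq eta e x | e <- g]).
Proof.
have Hs e : trig_pair (fun x => sin2_scaled t k (xi e x))
                      (fun x => sin2_scaled t k (eta e x)).
  have sinE (y b : R) : sin (y / b) ^+ 2 = 2^-1 + - 2^-1 * cos (2 / b * y).
    have -> : 2 / b * y = (y / b) *+ 2 by rewrite mulrAC -mulrA mulrC mulr_natr.
    by rewrite cos_mulr2n cos2sin2 -[_ *+ 2]mulr_natr; field.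
  have [s [h1 h2]] := trig_pairD (trig_pair_cst 2^-1)
    (trig_pairM (trig_pair_cst (- 2^-1))
      (trig_pair_cos ((2 / (t * Num.sqrt k.+1%:R)) *: e))).
  exists s; split => x; rewrite /sin2_scaled sinE.
    by rewrite -(linear_familyZ lxi) h1.
  by rewrite -(linear_familyZ leta) h2.
have [s [h1 h2]] := trig_pairX (size g * k.+1 ^ k.+1)%N
  (trig_pairD (trig_pair_cst 1) (trig_pairM (trig_pair_cst (- (size g)%:R^-1))
    (trig_pair_sum g (fun e => trig_pairX k.+1 (Hs e))))).
exists s; split => x; rewrite -?h1 -?h2 /trig_bump size_map big_map mulNr//.
Qed.

Variables (P1 : probability T1 R) (P2 : probability T2 R).
Hypothesis cosE : forall e, \int[P1]_x cos (xi e x) = \int[P2]_x cos (eta e x).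

Lemma Rintegral_trig_pair u v : trig_pair u v -> \int[P1]_x u x = \int[P2]_x v x.
Proof.
move=> [s [us vs]]; rewrite (@eq_Rintegral _ _ _ _ _ (trig_eval xi s))//.
rewrite [RHS](@eq_Rintegral _ _ _ _ _ (trig_eval eta s))// !Rintegral_trig_eval//.
by apply: eq_bigr => p _; rewrite cosE.
Qed.

End two_families.
End trigonometric_polynomials.

(** * Tail probabilities from cosine expectations *)

Section bounded_convergence.
Context {R : realType} d (T : measurableType d) (P : probability T R).

Lemma cvg_Rintegral_bounded (D : set T) (f_ : nat -> T -> R) (f : T -> R) (M : R) :
  measurable D -> (forall n, measurable_fun setT (f_ n)) ->
  (forall n x, `|f_ n x| <= M) -> (forall x, D x -> f_ n x @[n --> \oo] --> f x) ->
  \int[P]_(x in D) f_ n x @[n --> \oo] --> \int[P]_(x in D) f x.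
Proof.
move=> mD mf fM f_f.
have iM : P.-integrable D (EFin \o cst M).
  by apply: (integrableS measurableT) => //; exact: finite_measure_integrable_cst.
have mfE n : measurable_fun D (EFin \o f_ n).
  by apply/measurable_EFinP; exact: measurable_funTS.
have ff x : D x -> (EFin \o f_ n) x @[n --> \oo] --> (EFin \o f) x.
  by move=> Dx; apply: cvg_EFin; [exact: nearW|exact: f_f].
have fM' n x : D x -> (`|(EFin \o f_ n) x| <= (EFin \o cst M) x)%E.
  by move=> _; rewrite lee_fin.
have mfl : measurable_fun D (EFin \o f).
  exact: (emeasurable_fun_cvg (fun n => EFin \o f_ n)).
have [intf _ H] := @dominated_convergence _ _ _ P D mD (fun n => EFin \o f_ n)
  (EFin \o f) (EFin \o cst M) mfE mfl (aeW _ ff) iM (aeW _ (fun x n Dx => fM' n x Dx)).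
apply: fine_cvg; rewrite fineK; last exact: integrable_fin_num.
exact: H.
Qed.

Lemma probability_bigcup_le (F : nat -> set T) (c : \bar R) :
  (forall n, measurable (F n)) -> {homo F : m n / (m <= n)%N >-> m `<=` n} ->
  (forall n, P (F n) <= c)%E -> (P (\bigcup_n F n) <= c)%E.
Proof.
move=> mF hF Fc.
have ndF : {homo F : m n / (m <= n)%N >-> (m <= n)%O}.
  by move=> m n mn; apply/subsetPset; exact: hF.
have cvgF : (P \o F) n @[n --> \oo] --> P (\bigcup_n F n).
  by apply: nondecreasing_cvg_mu => //; exact: bigcupT_measurable.
rewrite -(cvg_lim (@ereal_hausdorff _) cvgF).
apply: lime_le; first by apply/cvg_ex; exists (P (\bigcup_n F n)).
exact: nearW.
Qed.

End bounded_convergence.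

Lemma measurable_forall_in (R : realType) (E : eqType) d (T : measurableType d)
    (z : E -> T -> R) (D : set R) (g : seq E) : measurable D ->
  (forall e, measurable_fun setT (z e)) ->
  measurable [set x | forall e, e \in g -> D (z e x)].
Proof.
move=> mD mz; elim: g => [|e g IH].
  by rewrite (_ : [set _ | _] = setT)//; apply/seteqP; split.
rewrite (_ : [set _ | _] = z e @^-1` D `&`
    [set x | forall e, e \in g -> D (z e x)]); last first.
  apply/seteqP; split => x /=.
    move=> H; split; first by apply: H; rewrite inE eqxx.
    by move=> e' e'g; apply: H; rewrite inE e'g orbT.
  by move=> [h H] e'; rewrite inE => /predU1P[->//|]; exact: H.
by apply: measurableI => //; rewrite -[X in measurable X]setTI; exact: mz.
Qed.

Lemma measurable_norm_lt (R : realType) (t : R) : measurable [set y : R | `|y| < t].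
Proof.
rewrite (_ : [set _ | _] = [set` `]- t, t[%R]); first exact: measurable_itv.
by apply/seteqP; split => y /=; rewrite in_itv/= ltr_norml.
Qed.

Lemma measurable_norm_le (R : realType) (t : R) : measurable [set y : R | `|y| <= t].
Proof.
rewrite (_ : [set _ | _] = [set` `[- t, t]%R]); first exact: measurable_itv.
by apply/seteqP; split => y /=; rewrite in_itv/= ler_norml.
Qed.

Section trigonometric_comparison.
Context {R : realType} {E : lmodType R}.
Context d1 d2 (T1 : measurableType d1) (T2 : measurableType d2).
Variables (P1 : probability T1 R) (P2 : probability T2 R).
Variables (xi : E -> T1 -> R) (eta : E -> T2 -> R).
Hypotheses (lxi : linear_family xi) (leta : linear_family eta).
Hypothesis cosE : forall e, \int[P1]_x cos (xi e x) = \int[P2]_x cos (eta e x).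

Let bump d (T : measurableType d) (z : E -> T -> R) t (g : seq E) k x :=
  trig_bump t k [seq z e x | e <- g].

Let measurable_bump d (T : measurableType d) (z : E -> T -> R) t g k :
  (forall e, measurable_fun setT (z e)) -> measurable_fun setT (bump z t g k).
Proof.
move=> mz; rewrite /bump /trig_bump.
under eq_fun do rewrite size_map big_map.
apply: measurable_funX; apply: measurable_funB => //.
apply: measurable_funM => //; apply: measurable_sum => e.
apply: measurable_funX; rewrite /sin2_scaled; apply: measurable_funX.
apply: measurableT_comp; first exact: continuous_measurable_fun (@continuous_sin R).
exact: measurable_funM.
Qed.

(** The bump functions of the two families have the same expectation and tend to
   1 on the first event and to 0 off the second one.  The factor 2 is the gap
   between the two regimes of trig_bump. *)
Lemma trig_tail_le (t : R) (g : seq E) : 0 < t ->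
  (P1 [set x | forall e, e \in g -> (`|xi e x| < t)%R]
   <= P2 [set x | forall e, e \in g -> (`|eta e x| <= 2 * t)%R])%E.
Proof.
move=> t0; set A := [set x | _]; set B := [set x | _].
have mA : measurable A.
  apply: (measurable_forall_in (D := [set y : R | `|y| < t])) => //; last exact: lxi.1.
  exact: measurable_norm_lt.
have mB : measurable B.
  apply: (measurable_forall_in (D := [set y : R | `|y| <= 2 * t])) => //; last exact: leta.1.
  exact: measurable_norm_le.
have mx k := measurable_bump t g k lxi.1.
have me k := measurable_bump t g k leta.1.
have bump01 d (T : measurableType d) (z : E -> T -> R) k x :
    0 <= bump z t g k x <= 1 by exact: trig_bump_01.
have bump1 d (T : measurableType d) (z : E -> T -> R) k x : `|bump z t g k x| <= 1.
  by have /andP[b0 b1] := bump01 _ _ z k x; rewrite ger0_norm.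
have cvgA : \int[P1]_(x in A) bump xi t g k x @[k --> \oo] --> \int[P1]_(x in A) 1.
  apply: (@cvg_Rintegral_bounded R _ _ P1 A (bump xi t g) (fun=> 1) 1) => // x Ax.
  by apply: cvg_trig_bump1 => // y /mapP[e eg ->]; exact: Ax.
have cvgB : \int[P2]_(x in ~` B) bump eta t g k x @[k --> \oo] --> \int[P2]_(x in ~` B) 0.
  apply: (@cvg_Rintegral_bounded R _ _ P2 (~` B) (bump eta t g) (fun=> 0) 1) => //; first exact: measurableC.
  move=> x /existsNP[e /not_implyP[eg /negP]]; rewrite -ltNge => te.
  by apply: (cvg_trig_bump0 t0 (map_f (eta^~ x) eg)).
have int1 D (mD : measurable D) k : P1.-integrable D (EFin \o bump xi t g k).
  exact: (bounded_integrable P1 mD (mx k) (bump1 _ _ xi k)).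
have int2 D (mD : measurable D) k : P2.-integrable D (EFin \o bump eta t g k).
  exact: (bounded_integrable P2 mD (me k) (bump1 _ _ eta k)).
have le k : \int[P1]_(x in A) bump xi t g k x <=
    fine (P2 B) + \int[P2]_(x in ~` B) bump eta t g k x.
  apply: (@le_trans _ _ (\int[P1]_x bump xi t g k x)).
    rewrite [leLHS]Rintegral_mkcond; apply: le_Rintegral => //.
    - rewrite (_ : EFin \o _ = (EFin \o bump xi t g k) \_ A); last first.
        by apply/funext => x /=; rewrite !patchE; case: ifP.
      apply/(integrable_mkcond _ mA).
      exact: int1.
    - exact: int1.
    - move=> x _; rewrite patchE; case: ifP => // _.
      by have /andP[] := bump01 _ _ xi k x.
  rewrite (Rintegral_trig_pair lxi leta cosE (trig_pair_bump lxi leta t k g)).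
  rewrite -(setUv B) Rintegral_setU//; last 3 first.
  - exact: measurableC.
  - by rewrite setUv; exact: int2.
  - exact/disj_setPRL.
  rewrite lerD2r; apply: (@le_trans _ _ (\int[P2]_(x in B) 1)).
    apply: le_Rintegral => //; first exact: int2.
      by apply: (integrableS measurableT) => //; exact: finite_measure_integrable_cst.
    by move=> x _; have /andP[] := bump01 _ _ eta k x.
  by rewrite Rintegral_cst// mul1r.
have : \int[P1]_(x in A) 1 <= fine (P2 B) + \int[P2]_(x in ~` B) 0.
  apply: (ler_cvg_to cvgA (cvgD (cvg_cst _) cvgB)).
  exact: nearW.
rewrite !Rintegral_cst//; last exact: measurableC.
by rewrite mul0r addr0 mul1r -lee_fin !fineK ?fin_num_measure.
Qed.

End trigonometric_comparison.

(** * Comparison of Gaussian families *)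

Lemma measurable_exists_in (R : realType) d (T : measurableType d)
    (z : nat -> T -> R) (D : set R) (A : set nat) : measurable D ->
  (forall l, measurable_fun setT (z l)) ->
  measurable [set x | exists2 l, A l & D (z l x)].
Proof.
move=> mD mz.
rewrite (_ : [set _ | _] = \bigcup_(l in A) z l @^-1` D).
  by apply: bigcup_measurable => l _; rewrite -[X in measurable X]setTI; exact: mz.
by apply/seteqP; split.
Qed.

Lemma measurable_exists (R : realType) d (T : measurableType d)
    (z : nat -> T -> R) (D : set R) : measurable D ->
  (forall l, measurable_fun setT (z l)) ->
  measurable [set x | exists l, D (z l x)].
Proof.
move=> mD mz; have := measurable_exists_in setT mD mz.
by congr (measurable _); apply/seteqP; split => x [l]; exists l.
Qed.

Lemma measurable_norm_gt (R : realType) (t : R) : measurable [set y : R | t < `|y|].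
Proof.
rewrite (_ : [set _ | _] = ~` [set y : R | `|y| <= t]).
  by apply: measurableC; exact: measurable_norm_le.
by apply/seteqP; split => y /=; rewrite ltNge => /negP.
Qed.

Lemma measurable_norm_ge (R : realType) (t : R) : measurable [set y : R | t <= `|y|].
Proof.
rewrite (_ : [set _ | _] = ~` [set y : R | `|y| < t]).
  by apply: measurableC; exact: measurable_norm_lt.
by apply/seteqP; split => y /=; rewrite leNgt => /negP.
Qed.

Section gaussian_comparison.
Context {R : realType} {E : lmodType R}.
Context d1 d2 (T1 : measurableType d1) (T2 : measurableType d2).
Variables (P1 : probability T1 R) (P2 : probability T2 R).
Variables (W : E -> T1 -> R) (Z : E -> T2 -> R).
Variables (B1 B2 : E -> E -> R).
Hypotheses (lW : linear_family W) (lZ : linear_family Z).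
Hypotheses (psd1 : psd_form B1) (psd2 : psd_form B2).
Hypothesis B12 : forall e, B1 e e <= B2 e e.
Hypothesis cosW : forall e, \int[P1]_x cos (W e x) = expR (- B1 e e / 2).
Hypothesis cosZ : forall e, \int[P2]_x cos (Z e x) = expR (- B2 e e / 2).

Section finitely_many.
Variables (g : nat -> E) (L : nat).

Let emb (c : 'rV[R]_L) : E := \sum_(l < L) c 0 l *: g l.

Let embP (a : R) c c' : emb (a *: c + c') = a *: emb c + emb c'.
Proof.
rewrite /emb scaler_sumr -big_split/=; apply: eq_bigr => l _.
by rewrite !mxE scalerDl scalerA.
Qed.

Let D (c c' : 'rV[R]_L) : R := B2 (emb c) (emb c') - B1 (emb c) (emb c').

Let psdD : psd_form D.
Proof.
split; rewrite /D.
- by move=> c c'; rewrite (form_sym psd2) (form_sym psd1).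
- by move=> a u v w; rewrite !embP (formPl psd2) (formPl psd1); ring.
- by move=> u; rewrite subr_ge0.
Qed.

Let base l : 'rV[R]_L := if insub l is Some i then delta_mx 0 i else 0.
Let w := gram_schmidt D base.

(** All the vectors of the basis lie, up to vectors of norm 0, in the span of the
   first L vectors w; so L independent normal variables with coefficients
   D c (w j) have the covariance D. *)
Let parseval c : \sum_(j < L) D c (w j) ^+ 2 = D c c.
Proof.
have sw : subnormal_seq D w := gram_schmidt_subnormal psdD base.
pose r c := c - form_proj D w L c.
have rlin : r c = \sum_(l < L) c 0 l *: r (base l).
  have -> : r c = \sum_(l < L) c 0 l *: base l -
      form_proj D w L (\sum_(l < L) c 0 l *: base l).
    have -> // : \sum_(l < L) c 0 l *: base l = c.
    rewrite [RHS]row_sum_delta; apply: eq_bigr => l _.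
    by rewrite /base insubT// => lL; congr (_ *: delta_mx _ _); exact: val_inj.
  have -> : form_proj D w L (\sum_(l < L) c 0 l *: base l) =
      \sum_(l < L) c 0 l *: form_proj D w L (base l).
    rewrite /form_proj; under [RHS]eq_bigr do rewrite scaler_sumr.
    rewrite exchange_big/=; apply: eq_bigr => j _.
    rewrite (form_suml psdD) scaler_suml; apply: eq_bigr => l _.
    by rewrite (formZl psdD) scalerA.
  by rewrite -sumrB; apply: eq_bigr => l _; rewrite scalerBr.
have : D (r c) (r c) = 0.
  rewrite [in LHS]rlin (form_suml psdD) big1// => l _.
  rewrite (formZl psdD) (form_null psdD) ?mulr0//.
  exact: (gram_schmidt_null psdD).
rewrite (form_residual psdD sw) => /eqP; rewrite subr_eq0 => /eqP ->.
by apply: eq_bigr => j _; rewrite expr2.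
Qed.

Notation N := (std_gaussian L).

(* b is a sign: W + zeta and W - zeta both have the cosine expectations of Z *)
Let xi (b : R) (c : 'rV[R]_L) (x : T1 * L.-tuple R) : R :=
  W (emb c) x.1 + b * \sum_(j < L) D c (w j) * tnth x.2 j.

Let linear_xi b : linear_family (xi b).
Proof.
split.
- move=> c; apply: measurable_funD.
    exact: (measurableT_comp (lW.1 (emb c)) measurable_fst).
  apply: measurable_funM => //; apply: measurable_sum => j.
  apply: measurable_funM => //.
  exact: (measurableT_comp (measurable_tnth j) measurable_snd).
- move=> x a c c'; rewrite /xi embP lW.2.
  under eq_bigr do rewrite (formPl psdD) mulrDl -mulrA.
  by rewrite big_split/= -mulr_sumr; ring.
Qed.

Let linear_Z : linear_family (fun c : 'rV[R]_L => Z (emb c)).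
Proof. by split => [c|x a c c']; [exact: lZ.1|rewrite embP lZ.2]. Qed.

Let cosE b : b ^+ 2 = 1 -> forall c,
  \int[P2]_x cos (Z (emb c) x) = \int[(P1 \x N)%E]_x cos (xi b c x).
Proof.
move=> b1 c; rewrite cosZ.
rewrite (@Rintegral_product _ _ _ _ _ _ _ _ 1); last by move=> x; exact: cos_norm_le1.
  have E1 x : \int[N]_y cos (xi b c (x, y)) = expR (- D c c / 2) * cos (W (emb c) x).
    rewrite /xi/= -parseval.
    have := std_gaussian_cos L (fun j => b * D c (w j)) (W (emb c) x).
    under eq_bigr do rewrite exprMn b1 mul1r.
    move=> <-; apply: eq_Rintegral => y _; congr cos.
    rewrite addrC mulr_sumr; congr (_ + _).
    by apply: eq_bigr => j _; rewrite mulrA.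
  under eq_Rintegral do rewrite E1.
  rewrite RintegralZl//.
    by rewrite cosW -expRD /D; congr expR; lra.
  apply: (@bounded_integrable _ _ _ _ _ 1) => //; last by move=> x; exact: cos_norm_le1.
  by apply: measurable_fun_cos; exact: lW.1.
by apply: measurable_fun_cos; exact: (linear_xi b).1.
Qed.

(** Let zeta be a Gaussian family of covariance B2 - B1 independent of W.  Since
   W is the mean of W + zeta and W - zeta, one of the two exceeds 2 t when W
   does, and both are distributed as Z.  The two signs give the factor 2 of the
   probability; that of the threshold comes from trig_tail_le. *)
Lemma gaussian_comparison_finite (t : R) : 0 < t ->
  (P1 [set x | exists2 l, (l < L)%N & (2 * t < `|W (g l) x|)%R]
   <= 2%:E * P2 [set x | exists2 l, (l < L)%N & (t <= `|Z (g l) x|)%R])%E.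
Proof.
move=> t0; pose gs := [seq base l | l <- iota 0 L].
have embB l : (l < L)%N -> emb (base l) = g l.
  move=> lL; rewrite /emb /base insubT (bigD1 (Ordinal lL))//= mxE !eqxx scale1r.
  rewrite big1 ?addr0// => i il; rewrite mxE eqxx/= (negbTE il) ?scale0r//.
set A := (X in (P1 X <= _)%E); set G := (X in (_ <= _ * P2 X)%E).
pose bad b := ~` [set z | forall c, c \in gs -> `|xi b c z| <= 2 * t].
pose C := [set x | forall c, c \in gs -> `|Z (emb c) x| < t].
have mC : measurable C.
  apply: (measurable_forall_in (z := fun c => Z (emb c)) (D := [set y : R | `|y| < t])).
    exact: measurable_norm_lt.
  by move=> c; exact: lZ.1.
have mbadC b : measurable [set z | forall c, c \in gs -> `|xi b c z| <= 2 * t].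
  apply: (measurable_forall_in (z := xi b) (D := [set y : R | `|y| <= 2 * t])).
    exact: measurable_norm_le.
  exact: (linear_xi b).1.
have mbad b : measurable (bad b) by exact: measurableC.
have mA : measurable A.
  apply: (measurable_exists_in (z := fun l => W (g l)) (D := [set y : R | 2 * t < `|y|])
    [set l | (l < L)%N]); first exact: measurable_norm_gt.
  by move=> l; exact: lW.1.
have mG : measurable G.
  apply: (measurable_exists_in (z := fun l => Z (g l)) (D := [set y : R | t <= `|y|])
    [set l | (l < L)%N]); first exact: measurable_norm_ge.
  by move=> l; exact: lZ.1.
have P2C : (P2 (~` C) <= P2 G)%E.
  apply: le_measure; rewrite ?inE//; first exact: measurableC.
  move=> x /existsNP[c /not_implyP[/mapP[l]]]; rewrite mem_iota add0n => /andP[_ lL] ->.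
  by move=> /negP; rewrite -leNgt embB// => ?; exists l.
have Pbad b : b ^+ 2 = 1 -> ((P1 \x N) (bad b) <= P2 (~` C))%E.
  move=> b1; rewrite !probability_setC//.
  apply: leeB => //; exact: (trig_tail_le linear_Z (linear_xi b) (cosE b1) gs t0).
have cover : A `*` setT `<=` bad 1 `|` bad (-1).
  move=> [x y] [[l lL Wl] _]; apply: contrapT => /not_orP[/contrapT H1 /contrapT H2].
  have lgs : base l \in gs by apply: map_f; rewrite mem_iota.
  have := H1 _ lgs; have := H2 _ lgs; rewrite /xi/= embB// => h1 h2.
  move: Wl; apply/negP; rewrite -leNgt.
  move: h1 h2; set s := \sum_(_ < _) _; rewrite !ler_norml; lra.
have -> : P1 A = (P1 \x N)%E (A `*` setT).
  by rewrite product_measure1E//= probability_setT mule1.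
have mAT : measurable (A `*` [set: L.-tuple R]) by exact: measurableX.
apply: (@le_trans _ _ ((P1 \x N) (bad 1%R) + (P1 \x N) (bad (-1)%R))%E).
  apply: (le_trans _ (measureU2 _ (mbad 1) (mbad (-1)))).
  by apply: le_measure; rewrite ?inE//; exact: measurableU.
rewrite mule_natl; apply: leeD; apply: le_trans P2C; apply: Pbad.
  by rewrite expr1n.
by rewrite sqrrN expr1n.
Qed.

End finitely_many.

Theorem gaussian_comparison (g : nat -> E) (t : R) : 0 < t ->
  (P1 [set x | exists l, (2 * t < `|W (g l) x|)%R]
   <= 2%:E * P2 [set x | exists l, (t <= `|Z (g l) x|)%R])%E.
Proof.
move=> t0; set G := (X in (_ <= _ * P2 X)%E).
have mG : measurable G.
  apply: (measurable_exists (z := fun l => Z (g l)) (measurable_norm_ge t)) => l.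
  exact: lZ.1.
pose F L := [set x | exists2 l, (l < L)%N & 2 * t < `|W (g l) x|].
rewrite (_ : [set x | _] = \bigcup_L F L); last first.
  apply/seteqP; split => x /=; first by move=> [l lt]; exists l.+1 => //; exists l.
  by move=> [L _ [l _ lt]]; exists l.
apply: probability_bigcup_le => [L|L M LM x [l lL lt]|L].
- apply: (measurable_exists_in (z := fun l => W (g l)) (D := [set y : R | 2 * t < `|y|])
    [set l | (l < L)%N]); first exact: measurable_norm_gt.
  by move=> l; exact: lW.1.
- by exists l => //; exact: leq_trans LM.
- apply: (le_trans (gaussian_comparison_finite g L t0)).
  rewrite lee_wpmul2l//; apply: le_measure; rewrite ?inE//.
    apply: (measurable_exists_in (z := fun l => Z (g l)) (D := [set y : R | t <= `|y|])
      [set l | (l < L)%N]); first exact: measurable_norm_ge.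
    by move=> l; exact: lZ.1.
  by move=> x [l _ lt]; exists l.
Qed.

End gaussian_comparison.

(** * The continuous dual *)

Section dual_space.
Context {R : realType} (F : topologicalLmodType R).

Definition is_dual : {pred F -> R^o} :=
  [pred f : F -> R^o | `[< linear f /\ continuous f >]].

Lemma is_dual_submod : submod_closed is_dual.
Proof.
split.
  apply/asboolP; split; first by move=> a x y; rewrite scaler0 addr0.
  exact: cst_continuous.
move=> a f g /asboolP[lf cf] /asboolP[lg cg]; apply/asboolP; split.
  move=> b x y; rewrite !fctE lf lg !scalerDr addrACA; congr (_ + _ + _).
  by rewrite !scalerA mulrC.
move=> x; apply: (@cvgD _ R^o); last exact: cg.
by apply: cvgZr; exact: cf.
Qed.

HB.instance Definition _ := GRing.isSubmodClosed.Build R (F -> R^o) is_dual is_dual_submod.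

(** The dual is made a module so that the linear families of the comparison
   theorem can be indexed by it. *)
Record dual := Dual { dual_val :> F -> R^o; dual_valP : is_dual dual_val }.

HB.instance Definition _ := [isSub for dual_val].
HB.instance Definition _ := [Choice of dual by <:].
HB.instance Definition _ := [SubChoice_isSubLmodule of dual by <:].

Lemma dual_continuous (f : dual) : continuous f.
Proof. by have /asboolP[] := dual_valP f. Qed.

Lemma dual_linear (f : dual) : linear f.
Proof. by have /asboolP[] := dual_valP f. Qed.

HB.instance Definition _ (f : dual) :=
  GRing.isLinear.Build R F R^o *:%R f (dual_linear f).

Lemma dualD (f g : dual) x : (f + g) x = f x + g x. Proof. by []. Qed.
Lemma dualZ a (f : dual) x : (a *: f) x = a * f x. Proof. by []. Qed.
Lemma dualB (f g : dual) x : (f - g) x = f x - g x. Proof. by []. Qed.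
Lemma dual_sum I (s : seq I) (f : I -> dual) x :
  (\sum_(i <- s) f i) x = \sum_(i <- s) f i x.
Proof.
elim: s => [|i s IH]; first by rewrite !big_nil.
by rewrite !big_cons dualD IH.
Qed.

End dual_space.

(** * Seminorms and Frechet spaces *)

Section seminorm_theory.
Context {R : realType} {V : lmodType R} (p : V -> R).
Hypothesis sp : is_seminorm p.

Lemma seminorm0 : p 0 = 0.
Proof. by have := sp.2 0 0; rewrite scale0r normr0 mul0r. Qed.

Lemma seminormN x : p (- x) = p x.
Proof. by have := sp.2 (-1) x; rewrite scaleN1r normrN1 mul1r. Qed.

Lemma seminorm_ge0 x : 0 <= p x.
Proof.
have := sp.1 x (- x); rewrite subrr seminorm0 seminormN; lra.
Qed.

Lemma seminorm_distC x y : p (x - y) = p (y - x).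
Proof. by rewrite -seminormN opprB. Qed.

Lemma seminorm_triangle y x z : p (x - z) <= p (x - y) + p (y - z).
Proof. by rewrite (le_trans _ (sp.1 _ _))// addrA subrK. Qed.

Lemma seminorm_sum I (s : seq I) (f : I -> V) :
  p (\sum_(i <- s) f i) <= \sum_(i <- s) p (f i).
Proof.
elim: s => [|i s IH]; first by rewrite !big_nil seminorm0.
by rewrite !big_cons (le_trans (sp.1 _ _))// lerD2l.
Qed.

End seminorm_theory.

Section frechet.
Context {R : realType} {F : topologicalLmodType R} (q : nat -> F -> R).
Hypothesis frechetF : separable_frechet q.

Lemma frechet_seminorm k : is_seminorm (q k). Proof. by case: frechetF. Qed.

Let sq := frechet_seminorm.

Lemma frechet_le k m x : (k <= m)%N -> q k x <= q m x.
Proof.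
have [_ qle _ _ _] := frechetF.
elim: m => [|m IH]; first by rewrite leqn0 => /eqP ->.
by rewrite leq_eqVlt => /predU1P[->//|/IH /le_trans]; apply.
Qed.

Lemma frechet_nbhs (x : F) (A : set F) :
  nbhs x A <-> exists k e, 0 < e /\ [set y | q k (y - x) < e] `<=` A.
Proof. by have [_ _ H _ _] := frechetF; exact: H. Qed.

Lemma frechet_ball_nbhs k (x : F) e : 0 < e -> nbhs x [set y | q k (y - x) < e].
Proof. by move=> e0; apply/frechet_nbhs; exists k, e; split. Qed.

Lemma frechet_separated x : (forall k, q k x = 0) -> x = 0.
Proof.
move=> x0; have [_ _ _ [hF _] _] := frechetF.
apply: hF => A B /frechet_nbhs[k [e [e0 kA]]] /frechet_nbhs[m [d [d0 mB]]].
exists x; split; first by apply: kA; rewrite /= subrr (seminorm0 (sq k)).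
by apply: mB; rewrite /= subr0 x0.
Qed.

Lemma frechet_complete (u : nat -> F) :
  (forall k e, 0 < e -> \forall m & n \near \oo, q k (u m - u n) < e) ->
  exists l, forall k, q k (u n - l) @[n --> \oo] --> 0.
Proof.
move=> cu; have [_ _ _ [_ complF] _] := frechetF.
have [|l ul] := complF u.
  move=> U /frechet_nbhs[k [e [e0 kU]]].
  by apply: filterS (cu k e e0) => -[m n] /= h; apply: kU; rewrite /= subr0.
exists l => k; apply/cvgrPdist_lt => e e0.
have h : \forall n \near \oo, q k (u n - l) < e.
  exact: (ul _ (frechet_ball_nbhs k l e0)).
near=> n; rewrite sub0r normrN ger0_norm ?seminorm_ge0//.
by near: n.
Unshelve. all: end_near. Qed.

Lemma frechet_dense_sequence : exists d : nat -> F,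
  forall k x e, 0 < e -> exists j, q k (x - d j) < e.
Proof.
have [_ _ _ _ [D cD dD]] := frechetF.
have D0 : D !=set0.
  have [x [_ Dx]] := dD setT (ex_intro _ 0 I) openT.
  by exists x.
have /countable_injP[n ninj] := cD.
exists (fun j => xget 0 [set x | D x /\ n x = j]) => k x e e0.
have [y [Bxy Dy]] : [set y | q k (y - x) < e]^° `&` D !=set0.
  apply: dD; last exact: open_interior.
  by exists x; exact: frechet_ball_nbhs.
exists (n y); case: xgetP => [z _ [Dz nzy]|/(_ y)/=]; last by move=> /(_ (conj Dy erefl)).
have -> : z = y by apply: ninj; rewrite ?inE.
rewrite (seminorm_distC (sq k)). exact: (interior_subset Bxy).
Qed.

Lemma linear_dual (g : F -> R) k (C : R) :
  (forall (a : R) x y, g (a *: x + y) = a * g x + g y) ->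
  (forall x, `|g x| <= C * q k x) -> exists f : dual F, forall x, f x = g x.
Proof.
move=> lg gq.
suff df : is_dual (g : F -> R^o) by exists (Dual df).
apply/asboolP; split; first by move=> a x y; rewrite lg.
have gB x y : g (x - y) = g x - g y.
  have := lg (-1) y x; rewrite scaleN1r mulN1r addrC => ->.
  by rewrite addrC.
move=> x; apply/(@cvgrPdist_lt _ R^o) => e e0.
have C0 : 0 < `|C| + 1 by rewrite ltr_wpDl.
have e1 : 0 < e / (`|C| + 1) by rewrite divr_gt0.
apply: filterS (frechet_ball_nbhs k x e1) => y /=; rewrite ltr_pdivlMr// => h.
rewrite -gB (le_lt_trans (gq _))// (le_lt_trans _ h)// seminorm_distC// mulrC.
by rewrite ler_wpM2l ?seminorm_ge0// (le_trans (ler_norm C))// lerDl.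
Qed.

Lemma dual_bounded (f : dual F) :
  exists k (C : R), 0 < C /\ forall x, `|f x| <= C * q k x.
Proof.
have /(@cvgrPdist_lt _ R^o)/(_ _ ltr01) : f y @[y --> 0] --> f 0.
  exact: dual_continuous.
rewrite near_simpl => /frechet_nbhs[k [e [e0 kf]]].
have fe x : q k x < e -> `|f x| < 1.
  move=> xe; have := kf x; rewrite /= subr0 => /(_ xe).
  by rewrite linear0 sub0r normrN.
exists k, (2 / e); split; first by rewrite divr_gt0.
move=> x; have [x0|x0] := eqVneq (q k x) 0.
  rewrite x0 mulr0 leNgt; apply/negP => fx.
  have := fe (`|f x|^-1 *: x); rewrite (sq k).2 x0 mulr0 => /(_ e0).
  rewrite linearZ/= /GRing.scale/= normrM normfV normr_id mulVf ?gt_eqF//.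
  by rewrite ltxx.
have xp : 0 < q k x by rewrite lt_neqAle eq_sym x0 seminorm_ge0.
pose a := e / 2 / q k x; have a0 : 0 < a by rewrite !divr_gt0.
have := fe (a *: x); rewrite (sq k).2 (gtr0_norm a0).
have -> : a * q k x = e / 2 by rewrite /a divfK.
have -> : e / 2 < e by rewrite ltr_pdivrMr//; lra.
move=> /(_ isT); rewrite linearZ/= /GRing.scale/= normrM (gtr0_norm a0) => h.
rewrite -(ler_pM2l a0); apply: (le_trans (ltW h)).
suff -> : a * (2 / e * q k x) = 1 by [].
by rewrite /a; field; rewrite x0 gt_eqF.
Qed.

(** Countably many norming functionals suffice because F is separable; this is
   what makes the events of continuous seminorms cylindrical up to a limit. *)
Lemma norming_sequence (p : F -> R) k (C : R) : is_seminorm p ->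
  (forall x, p x <= C * q k x) -> forall d : nat -> F,
  exists g : nat -> dual F,
    (forall j x, `|g j x| <= p x) /\ (forall j, g j (d j) = p (d j)).
Proof.
move=> sp pq d.
have H j : exists g : dual F, (forall x, `|g x| <= p x) /\ g (d j) = p (d j).
  have [g [lg gp gd]] := hahn_banach_support (d j) sp.
  have [f fg] := linear_dual lg (fun x => le_trans (gp x) (pq x)).
  by exists f; split => [x|]; rewrite fg.
have [g Hg] := choice H.
by exists g; split => j; [exact: (Hg j).1|exact: (Hg j).2].
Qed.

Lemma norming_sequence_sup (p : F -> R) k (C : R) (d : nat -> F) (g : nat -> dual F) :
  0 < C -> is_seminorm p -> (forall x, p x <= C * q k x) ->
  (forall x e, 0 < e -> exists j, q k (x - d j) < e) ->
  (forall j x, `|g j x| <= p x) -> (forall j, g j (d j) = p (d j)) ->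
  forall x r, r < p x -> exists j, r < `|g j x|.
Proof.
move=> C0 sp pq dd gp gd x r rx; pose e := (p x - r) / (2 * C).
have e0 : 0 < e by rewrite divr_gt0 ?subr_gt0// mulr_gt0.
have [j xj] := dd x e e0; exists j.
have pxj : p (x - d j) < (p x - r) / 2.
  rewrite (le_lt_trans (pq _))// -ltr_pdivlMl//.
  by rewrite (lt_le_trans xj)// /e invfM mulrA mulrC.
have h1 : p x <= p (d j) + p (x - d j) by rewrite -{1}(subrK (d j) x) addrC sp.1.
have h2 : g j (d j) <= `|g j x| + p (x - d j).
  have := gp j (x - d j); rewrite linearB/= ler_norml => /andP[+ _].
  have := ler_norm (g j x); lra.
by rewrite gd in h2; lra.
Qed.

End frechet.

(** * The covariance of a centered Gaussian measure *)

Lemma dirac_integrable (R : realType) d (T : measurableType d) (a : T)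
  (f : T -> R) : measurable_fun setT f -> (\d_a).-integrable setT (EFin \o f).
Proof.
move=> mf; apply/integrableP; split; first exact/measurable_EFinP.
rewrite integral_dirac//=; last first.
  by apply/measurable_EFinP; exact: measurableT_comp.
by rewrite diracT mul1e ltry.
Qed.

Lemma Rintegral_dirac (R : realType) d (T : measurableType d) (a : T)
  (f : T -> R) : measurable_fun setT f -> \int[\d_a]_x f x = f a.
Proof.
move=> mf; rewrite /Rintegral integral_dirac//; last exact/measurable_EFinP.
by rewrite diracT mul1e.
Qed.

Lemma normal_integrable_id (R : realType) (m s : R) : s != 0 ->
  (normal_prob m s).-integrable setT (EFin \o id).
Proof.
move=> s0; rewrite (_ : EFin \o id = (fun x : R => (x - m)%:E + m%:E)%E); last first.
  by apply/funext => x; rewrite /= -EFinD subrK.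
apply: integrableD => //; last exact: finite_measure_integrable_cst.
apply: (@normal_integrable_quadratic _ _ _ s0 (fun x => x - m)).
  exact: measurable_funB.
move=> x; rewrite -(real_normK (num_real (x - m))).
by have := sqr_ge0 (`|x - m| - 1); have := normr_ge0 (x - m); nra.
Qed.

Section transfer_law.
Context {R : realType} d (T : measurableType d) (P : probability T R).
Variables (f : T -> measurableTypeR R) (nu : probability (measurableTypeR R) R).
Hypothesis mf : measurable_fun setT f.
Hypothesis law : forall B : set R, measurable B -> P (f @^-1` B) = nu B.

Lemma law_integrable (phi : R -> R) : measurable_fun setT phi ->
  nu.-integrable setT (EFin \o phi) -> P.-integrable setT (EFin \o (phi \o f)).
Proof.
move=> mphi /integrableP[_ intphi]; apply/integrableP; split.
  by apply/measurable_EFinP; exact: measurableT_comp.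
apply: le_lt_trans intphi; rewrite le_eqVlt; apply/orP; left; apply/eqP.
rewrite -(@eq_measure_integral _ _ _ _ _ (pushforward P f)); last first.
  by move=> A mA _; exact: law.
rewrite ge0_integral_pushforward ?preimage_setT//.
by apply: measurableT_comp => //; exact/measurable_EFinP.
Qed.

Lemma law_Rintegral (phi : R -> R) : measurable_fun setT phi ->
  nu.-integrable setT (EFin \o phi) -> \int[P]_x phi (f x) = \int[nu]_y phi y.
Proof.
move=> mphi intphi; congr fine.
rewrite -[RHS](@eq_measure_integral _ _ _ _ _ (pushforward P f)); last first.
  by move=> A mA _; exact: law.
rewrite integral_pushforward ?preimage_setT//; first exact/measurable_EFinP.
exact: law_integrable.
Qed.

End transfer_law.

Section gaussian_dual.
Context {R : realType} {F : topologicalLmodType R} (q : nat -> F -> R).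
Hypothesis frechetF : separable_frechet q.
Variable gamma : probability (borel F) R.

Lemma measurable_open (A : set (borel F)) : @open F A -> measurable A.
Proof. by move=> oA; exact: sub_sigma_algebra. Qed.

Lemma measurable_continuous (f : F -> R) : (forall x, f y @[y --> x] --> f x) ->
  measurable_fun setT (f : borel F -> R).
Proof.
move=> cf mD; apply: (measurability _ (RGenOpens.measurableE R)) => //.
move=> _ [_ [a [b ->] <-]]; rewrite setTI; apply: measurable_open.
have /continuousP : continuous (f : F -> R^o) by [].
by apply; exact: interval_open.
Qed.

Lemma measurable_dual (f : dual F) : measurable_fun setT (f : borel F -> R).
Proof. by apply: measurable_continuous => x; exact: dual_continuous. Qed.

Lemma measurable_seminorm_dist k (d : F) :
  measurable_fun setT (fun x : borel F => q k ((x : F) - d)).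
Proof.
apply: measurable_continuous => x; apply/cvgrPdist_lt => e e0.
have sq := frechet_seminorm frechetF k.
apply: filterS (frechet_ball_nbhs frechetF k x e0) => y /= h.
apply: le_lt_trans h; rewrite ler_norml.
have := seminorm_triangle sq y x d; have := seminorm_triangle sq x y d.
by rewrite (seminorm_distC sq y x); lra.
Qed.

Hypothesis gaussian_gamma : is_gaussian gamma.
Hypothesis centered_gamma : is_centered gamma.

Lemma dual_law (f : dual F) : exists s : R, forall B : set R, measurable B ->
  gamma (f @^-1` B) = gaussian_law 0 s B.
Proof.
have [m [s law]] := @gaussian_gamma (f : {linear F -> R^o}) (@dual_continuous R F f).
have mf := measurable_dual f.
have mean : \int[gamma]_x f x = 0.
  by rewrite /Rintegral (@centered_gamma (f : {linear F -> R^o}) (@dual_continuous R F f)).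
exists s; suff <- : m = 0 by [].
move: law mean; rewrite /gaussian_law; case: eqP => [_|/eqP s0] law.
  rewrite (law_Rintegral (nu := (\d_(m : measurableTypeR R) : probability (measurableTypeR R) R)) mf law (phi := id))//.
    by rewrite Rintegral_dirac.
  exact: dirac_integrable.
rewrite (law_Rintegral (nu := (normal_prob m s : probability (measurableTypeR R) R)) mf law (phi := id))//.
  by rewrite normal_mean.
exact: normal_integrable_id.
Qed.

Lemma dual_square_integrable (f : dual F) :
  gamma.-integrable setT (EFin \o (fun x => f x ^+ 2)).
Proof.
have [s law] := dual_law f; have mf := measurable_dual f.
move: law; rewrite /gaussian_law; case: eqP => [_|/eqP s0] law.
  apply: (law_integrable (nu := (\d_(0 : measurableTypeR R) : probability (measurableTypeR R) R)) mf law
    (phi := fun y => y ^+ 2)) => //; exact: dirac_integrable.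
apply: (law_integrable (nu := (normal_prob 0 s : probability (measurableTypeR R) R)) mf law (phi := fun y => y ^+ 2)) => //.
apply: (normal_integrable_quadratic s0) => // y.
by rewrite ger0_norm ?sqr_ge0// subr0 lerDr.
Qed.

(** The characteristic function is expressed by the second moment, which makes
   the variance parameter of the law disappear. *)
Lemma dual_cos (f : dual F) :
  \int[gamma]_x cos (f x) = expR (- (\int[gamma]_x (f x ^+ 2)) / 2).
Proof.
have [s law] := dual_law f; have mf := measurable_dual f.
have mc : measurable_fun setT (@cos R).
  exact: continuous_measurable_fun (@continuous_cos R).
move: law; rewrite /gaussian_law; case: eqP => [_|/eqP s0] law.
  rewrite (law_Rintegral (nu := (\d_(0 : measurableTypeR R) : probability (measurableTypeR R) R)) mf law
    (phi := fun y => y ^+ 2))//; last exact: dirac_integrable.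
  rewrite (law_Rintegral (nu := (\d_(0 : measurableTypeR R) : probability (measurableTypeR R) R)) mf law
    (phi := cos))//; last exact: dirac_integrable.
  rewrite !Rintegral_dirac//.
  by rewrite cos0 expr0n/= oppr0 mul0r expR0.
have icos := bounded_integrable (normal_prob 0 s) measurableT mc cos_norm_le1.
have isqr : (normal_prob 0 s).-integrable setT (EFin \o (fun y : R => y ^+ 2)).
  apply: (normal_integrable_quadratic s0) => // y.
  by rewrite ger0_norm ?sqr_ge0// subr0 lerDr.
rewrite (law_Rintegral (nu := (normal_prob 0 s : probability (measurableTypeR R) R)) mf law (phi := fun y => y ^+ 2))//.
rewrite (law_Rintegral (nu := (normal_prob 0 s : probability (measurableTypeR R) R)) mf law (phi := cos))//.
have := normal_variance 0 s0; under eq_Rintegral do rewrite subr0.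
move=> ->; have := normal_cos 0 s0 1 0.
under eq_Rintegral do rewrite subr0 addr0 mul1r.
by move=> ->; rewrite cos0 mulr1 expr1n mulr1 mulNr.
Qed.

(** The restriction to a set serves to bound the contribution of the complement
   of finitely many small balls. *)
Definition cov_on (A : set (borel F)) (f g : dual F) : R :=
  \int[gamma]_(x in A) (f x * g x).

Lemma dual_product_integrable (A : set (borel F)) (f g : dual F) : measurable A ->
  gamma.-integrable A (EFin \o (fun x => f x * g x)).
Proof.
move=> mA; apply: (integrableS measurableT) => //.
apply: (@le_integrable _ _ _ gamma _ measurableT _
  (fun x => (f x ^+ 2)%:E + (g x ^+ 2)%:E)%E) => //.
- by apply/measurable_EFinP; apply: measurable_funM; exact: measurable_dual.
- move=> x _; rewrite -EFinD lee_fin normrM [leRHS]ger0_norm ?addr_ge0 ?sqr_ge0//.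
  rewrite -(real_normK (num_real (f x))) -(real_normK (num_real (g x))).
  have := normr_ge0 (f x); have := normr_ge0 (g x).
  by have := sqr_ge0 (`|f x| - `|g x|); nra.
- by apply: integrableD => //; exact: dual_square_integrable.
Qed.

Lemma psd_cov_on (A : set (borel F)) : measurable A -> psd_form (cov_on A).
Proof.
move=> mA; split; rewrite /cov_on.
- by move=> f g; apply: eq_Rintegral => x _; rewrite mulrC.
- move=> a f g h; rewrite -RintegralZl//; last exact: dual_product_integrable.
  rewrite -RintegralD//; last 2 first.
  + rewrite /comp; under eq_fun do rewrite EFinM.
    by apply: (integrableZl mA); exact: dual_product_integrable.
  + exact: dual_product_integrable.
  by apply: eq_Rintegral => x _; rewrite dualD dualZ mulrDl mulrA.
- by move=> f; apply: Rintegral_ge0 => x _; rewrite -expr2 sqr_ge0.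
Qed.

Definition cov := cov_on setT.

Lemma psd_cov : psd_form cov. Proof. exact: psd_cov_on. Qed.

Lemma covE f : cov f f = \int[gamma]_x (f x ^+ 2).
Proof. by apply: eq_Rintegral => x _; rewrite expr2. Qed.

Lemma cov_on_le A f : measurable A -> cov_on A f f <= cov f f.
Proof.
move=> mA; rewrite /cov /cov_on [leLHS]Rintegral_mkcond; apply: le_Rintegral => //.
- rewrite (_ : EFin \o _ = (EFin \o (fun x => f x * f x)) \_ A); last first.
    by apply/funext => x /=; rewrite !patchE; case: ifP.
  by apply/(integrable_mkcond _ mA); exact: dual_product_integrable.
- exact: dual_product_integrable.
- by move=> x _; rewrite patchE; case: ifP => // _; rewrite -expr2 sqr_ge0.
Qed.

Lemma dual_family :
  linear_family (E := dual F) (fun (f : dual F) (x : borel F) => (f x : R)).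
Proof.
split; first exact: measurable_dual.
by move=> x a f g; rewrite dualD dualZ.
Qed.

Lemma dual_cos_cov (f : dual F) : \int[gamma]_x cos (f x) = expR (- cov f f / 2).
Proof. by rewrite dual_cos covE. Qed.

End gaussian_dual.

(** * The Cameron-Martin norm *)

Section cameron_martin_norm.
Context {R : realType} {F : topologicalLmodType R} (q : nat -> F -> R).
Hypothesis frechetF : separable_frechet q.
Variable gamma : probability (borel F) R.
Hypothesis gaussian_gamma : is_gaussian gamma.
Hypothesis centered_gamma : is_centered gamma.

Notation cov := (cov gamma).
Let psd : psd_form cov := psd_cov gaussian_gamma centered_gamma.

Lemma dual_Lnorm (f : dual F) :
  ('N[gamma]_2%:E[EFin \o (f : borel F -> R)] = (Num.sqrt (cov f f))%:E)%E.
Proof.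
have E : (\int[gamma]_x (`|(EFin \o (f : borel F -> R)) x| `^ 2) = (cov f f)%:E)%E.
  rewrite (covE gamma) fineK; last first.
    by apply: integrable_fin_num => //; exact: dual_square_integrable.
  apply: eq_integral => x _ /=.
  by rewrite powR_mulrn// real_normK// num_real.
rewrite unlock E poweR_EFin; congr (_%:E).
by rewrite -powR12_sqrt// (form_ge0 psd).
Qed.

Lemma dual_unit_ballP (f : dual F) :
  dual_unit_ball gamma (f : {linear F -> R^o}) <-> cov f f <= 1.
Proof.
rewrite /dual_unit_ball /mkset dual_Lnorm lee_fin.
have -> : (Num.sqrt (cov f f) <= 1) = (cov f f <= 1).
  by rewrite -{1}(sqrtr1 R) ler_sqrt.
by split => [[]//|fh]; split => //; exact: dual_continuous.
Qed.

(** A functional of variance 0 vanishes at h, since all its multiples belong to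
   the unit ball over which the supremum is taken. *)
Lemma cm_norm_dual (f : dual F) h : (cm_norm gamma h < +oo)%E ->
  `|f h| <= Num.sqrt (cov f f) * fine (cm_norm gamma h).
Proof.
move=> hy; have hf : cm_norm gamma h \is a fin_num.
  by rewrite ge0_fin_numE// cm_norm_ge0.
have ub (g : dual F) : cov g g <= 1 -> `|g h| <= fine (cm_norm gamma h).
  by move=> /dual_unit_ballP/(cm_norm_ub_abs h); rewrite -lee_fin fineK.
have [f0|f0] := eqVneq (cov f f) 0; last first.
  have s0 : 0 < Num.sqrt (cov f f).
    by rewrite sqrtr_gt0 lt_neqAle eq_sym f0 (form_ge0 psd).
  have := ub ((Num.sqrt (cov f f))^-1 *: f).
  rewrite (formZl psd) (formZr psd) mulrA -expr2 exprVn sqr_sqrtr ?(form_ge0 psd)//.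
  rewrite mulVf// lexx => /(_ isT).
  by rewrite dualZ normrM gtr0_norm ?invr_gt0// ler_pdivrMl.
rewrite f0 sqrtr0 mul0r leNgt; apply/negP => fh.
pose c := (fine (cm_norm gamma h) + 1) / `|f h|.
have := ub (c *: f); rewrite (formZl psd) (formZr psd) f0 !mulr0 ler01 => /(_ isT).
have N0 : 0 <= fine (cm_norm gamma h) by rewrite fine_ge0// cm_norm_ge0.
rewrite dualZ normrM ger0_norm; last by rewrite divr_ge0 ?addr_ge0.
by rewrite /c divfK ?gt_eqF//; lra.
Qed.

Lemma cm_norm_le (c : R) h : 0 <= c ->
  (forall f : dual F, `|f h| <= c * Num.sqrt (cov f f)) -> (cm_norm gamma h <= c%:E)%E.
Proof.
move=> c0 fc; apply: ge_ereal_sup => _ [f [cf f1] <-].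
have df : is_dual (f : F -> R^o) by apply/asboolP; split => // a x y; rewrite linearP.
have := fc (Dual df); have /dual_unit_ballP := conj cf f1 : dual_unit_ball gamma (Dual df : {linear F -> R^o}).
rewrite lee_fin => h1 h2; apply: (le_trans (ler_norm _)); apply: (le_trans h2).
by rewrite ler_piMr// -(sqrtr1 R) ler_sqrt.
Qed.

Lemma measurable_seminorm_gt k (M : R) : measurable [set x : borel F | M < q k x].
Proof.
rewrite (_ : [set x | _] =
    (fun x : borel F => q k ((x : F) - 0)) @^-1` [set` `]M, +oo[%R]).
  rewrite -[X in measurable X]setTI.
  by apply: (measurable_seminorm_dist frechetF k 0) => //; exact: measurable_itv.
by apply/seteqP; split => x /=; rewrite subr0 in_itv/= andbT.
Qed.

Lemma seminorm_le_probability k (e : R) : 0 < e ->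
  exists M : R, 0 < M /\ (gamma [set x : borel F | (M < q k x)%R] < e%:E)%E.
Proof.
move=> e0; pose A (n : nat) := [set x : borel F | n.+1%:R < q k x].
have mA n : measurable (A n) by exact: measurable_seminorm_gt.
have cvgA : gamma (A n) @[n --> \oo] --> gamma (\bigcap_n A n).
  apply: nonincreasing_cvg_mu => //.
  - by rewrite (le_lt_trans (probability_le1 gamma (mA 0%N)))// ltry.
  - exact: bigcap_measurableType.
  - move=> m n mn; apply/subsetPset => x; rewrite /A/=; apply: le_lt_trans.
    by rewrite ler_nat ltnS.
have A0 : \bigcap_n A n = set0.
  apply/seteqP; split => // x /(_ (Num.truncn (q k x)) I); rewrite /A/= => h.
  by have := lt_trans h (truncnS_gt (q k x)); rewrite ltxx.
move: cvgA; rewrite A0 measure0 => /fine_cvgP[fA /cvgrPdist_lt/(_ _ e0) cA].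
near \oo => n; exists n.+1%:R; split => //.
have h : `|0 - fine (gamma (A n))| < e by near: n.
rewrite -/(A n) -(fineK (fin_num_measure gamma _ (mA n))) lte_fin.
by move: h; rewrite sub0r normrN ger0_norm ?fine_ge0 ?measure_ge0.
Unshelve. all: end_near. Qed.

(** If g had a large variance, the expectation exp (- var / 2) of cos g would be
   small, although |g| <= q k is bounded with a high probability. *)
Lemma dual_cov_bounded k : exists C : R, 0 < C /\
  forall g : dual F, (forall x, `|g x| <= q k x) -> cov g g <= C.
Proof.
have e4 : 0 < 1 / 4 :> R by lra.
have [M [M0 PM]] := seminorm_le_probability k e4.
(* cos >= 1/2 off U and cos >= -1 on U, where U has probability < 1/4: the
   expectation is at least 1/2 - 3/8 = 1/8, whereas exp (-7) < 1/8. *)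
exists (14 * M ^+ 2); split; first by rewrite mulr_gt0 ?exprn_gt0.
move=> g gq; pose g' := M^-1 *: g.
have -> : cov g g = M ^+ 2 * cov g' g'.
  by rewrite (formZl psd) (formZr psd); field; rewrite gt_eqF.
rewrite mulrC ler_pM2r ?exprn_gt0//.
set U := [set x : borel F | M < q k x] in PM.
have mU : measurable U by exact: measurable_seminorm_gt.
have icos : gamma.-integrable setT (EFin \o (fun x => cos (g' x))).
  apply: (@bounded_integrable R _ _ _ _ 1) => //; last by move=> x; exact: cos_norm_le1.
  by apply: measurable_fun_cos; exact: measurable_dual.
have iind : gamma.-integrable setT (EFin \o (fun x => 1 / 2 - 3 / 2 * \1_U x)).
  apply: (@bounded_integrable R _ _ _ _ 2) => //.
    by apply: measurable_funB => //; apply: measurable_funM => //; exact: measurable_indic.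
  by move=> x; rewrite indicE; case: (_ \in _); rewrite ler_norml/=; lra.
have low : \int[gamma]_x (1 / 2 - 3 / 2 * \1_U x) <= \int[gamma]_x cos (g' x).
  apply: le_Rintegral => // x _; rewrite indicE; case: (boolP (x \in U)) => xU /=.
    by rewrite mulr1; have := cos_geN1 (g' x); lra.
  rewrite mulr0 subr0; apply: cos_ge_half.
  change (`|M^-1 * g x| <= 1); rewrite normrM gtr0_norm ?invr_gt0// ler_pdivrMl// mulr1.
  apply: (le_trans (gq _)); rewrite leNgt; apply/negP => h.
  by move: xU; rewrite notin_setE.
have i1 : gamma.-integrable setT (EFin \o (fun x : borel F => \1_U x : R)).
  apply: (@bounded_integrable R _ _ _ _ 1) => //; first exact: measurable_indic.
  by move=> x; rewrite indicE; case: (_ \in _); rewrite /= ?normr1 ?normr0.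
have E : \int[gamma]_x (1 / 2 - 3 / 2 * \1_U x) = 1 / 2 - 3 / 2 * fine (gamma U).
  rewrite RintegralB//; last 2 first.
  - exact: finite_measure_integrable_cst.
  - by rewrite /comp; under eq_fun do rewrite EFinM; exact: integrableZl.
  rewrite Rintegral_probability_cst RintegralZl//; congr (_ - _ * _).
  by rewrite /Rintegral integral_indic// setIT.
have PU : fine (gamma U) < 1 / 4.
  by rewrite -lte_fin fineK ?fin_num_measure.
move: low; rewrite E (dual_cos_cov gaussian_gamma centered_gamma) => low.
rewrite leNgt; apply/negP => c14.
have e8 : 8 < expR (cov g' g' / 2).
  by apply: lt_le_trans (expR_ge1Dx _); lra.
have : expR (- cov g' g' / 2) < 1 / 8.
  by rewrite mulNr expRN div1r ltf_pV2 ?posrE ?expR_gt0.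
lra.
Qed.

Theorem cm_norm_continuous k : exists C : R, 0 < C /\
  forall h, (cm_norm gamma h < +oo)%E -> q k h <= C * fine (cm_norm gamma h).
Proof.
have [C [C0 gC]] := dual_cov_bounded k.
exists (Num.sqrt C); split; first by rewrite sqrtr_gt0.
move=> h hy; have [g [lg gq gh]] := hahn_banach_support h (frechet_seminorm frechetF k).
have gq1 x : `|g x| <= 1 * q k x by rewrite mul1r.
have [f fg] := linear_dual frechetF lg gq1.
have N0 : 0 <= fine (cm_norm gamma h) by rewrite fine_ge0// cm_norm_ge0.
rewrite -gh -fg (le_trans (ler_norm _))// (le_trans (cm_norm_dual f hy))//.
apply: ler_wpM2r => //; rewrite ler_sqrt ?(ltW C0)//.
by apply: gC => x; rewrite fg.
Qed.

(** A Cauchy sequence converges in F by the continuity of the embedding, and the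
   norm is lower semicontinuous on F as a supremum of continuous functions. *)
Lemma cm_complete : hcomplete (cm_dot (gamma := gamma)).
Proof.
move=> u cu; pose v n : F := cm_val (u n).
have fin (h : cameron_martin gamma) : (cm_norm gamma h < +oo)%E := cm_valP h.
have hN (h : cameron_martin gamma) : hnorm (cm_dot (gamma := gamma)) h = fine (cm_norm gamma h).
  exact: hnorm_cm_dot.
have [|l vl] := frechet_complete frechetF (u := v).
  move=> k e e0; have [C [C0 qC]] := cm_norm_continuous k.
  have := cu (e / C) (divr_gt0 e0 C0); apply: filterS => -[m n] /=.
  rewrite hN ltr_pdivlMr// mulrC => h; apply: le_lt_trans h.
  exact: (qC _ (fin (u m - u n))).
have fl (f : dual F) : f (v n) @[n --> \oo] --> f l.
  have [k [C [C0 fC]]] := dual_bounded frechetF f.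
  apply/cvgrPdist_lt => e e0.
  have /cvgrPdist_lt/(_ _ (divr_gt0 e0 C0)) := vl k.
  apply: filterS => n; rewrite sub0r normrN ger0_norm; last first.
    exact: (seminorm_ge0 (frechet_seminorm frechetF k)).
  rewrite ltr_pdivlMr// mulrC => h; apply: le_lt_trans h.
  by rewrite distrC -linearB; exact: fC.
have close (e : R) : 0 < e -> \forall n \near \oo,
    (cm_norm gamma (v n - l)%R <= e%:E)%E.
  move=> e0; have := cu e e0.
  move=> [[A B] /= [[n0 _ An0] [m0 _ Bm0]] AB].
  exists n0 => // n /An0 An; apply: cm_norm_le; first exact: ltW.
  move=> f; rewrite linearB/=.
  have : `|f (v n) - f (v m)| @[m --> \oo] --> `|f (v n) - f l|.
    by apply: cvg_norm; apply: cvgB; [exact: cvg_cst|exact: fl].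
  move=> cvgf; apply: (ler_cvg_to cvgf (cvg_cst _)).
  exists m0 => // m /Bm0 Bm; rewrite -linearB.
  apply: (le_trans (cm_norm_dual f (fin (u n - u m)))).
  rewrite mulrC ler_wpM2r ?sqrtr_ge0//.
  by have /ltW := AB (n, m) (conj An Bm); rewrite /= hN.
have [n _ /(_ n (leqnn n)) n1] := close 1 ltr01.
have hl : in_cm gamma l.
  have : (cm_norm gamma (v n - (v n - l))%R < +oo)%E.
    apply: le_lt_trans (cm_normD _ _ _) _; rewrite lte_add_pinfty//; first exact: fin.
    by rewrite -scaleN1r cm_normZ normrN1 mul1e (le_lt_trans n1)// ltry.
  by rewrite opprB addrC subrK.
exists (CameronMartin hl).
apply/cvgrPdist_le => e e0; have := close e e0; apply: filterS => m h.
rewrite sub0r normrN ger0_norm ?sqrtr_ge0// hN -lee_fin fineK//.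
by rewrite ge0_fin_numE ?cm_norm_ge0//; exact: (fin (u m - CameronMartin hl)).
Qed.

End cameron_martin_norm.

(** * Barycenters *)

Lemma Rintegral_sum (R : realType) d (T : measurableType d)
    (mu : {measure set T -> \bar R}) (D : set T) (I : Type) (s : seq I)
    (f : I -> T -> R) : measurable D ->
  (forall i, mu.-integrable D (EFin \o f i)) ->
  mu.-integrable D (EFin \o (fun x => \sum_(i <- s) f i x)) /\
  \int[mu]_(x in D) (\sum_(i <- s) f i x) = \sum_(i <- s) \int[mu]_(x in D) f i x.
Proof.
move=> mD intf; elim: s => [|i s [IH1 IH2]].
  have E : EFin \o (fun x => \sum_(i <- [::]) f i x) = cst 0%E :> (T -> \bar R).
    by apply/funext => x; rewrite /= big_nil.
  split; first by rewrite E; exact: integrable0.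
  by rewrite /Rintegral big_nil; move: E; rewrite /comp => ->; rewrite integral0.
have E : (fun x => \sum_(j <- i :: s) f j x) = (fun x => f i x + \sum_(j <- s) f j x).
  by apply/funext => x; rewrite big_cons.
rewrite E; split.
  exact: (integrableD mD (intf i) IH1).
by rewrite RintegralD// IH2 big_cons.
Qed.

Section barycenter.
Context {R : realType} {F : topologicalLmodType R} (q : nat -> F -> R).
Hypothesis frechetF : separable_frechet q.
Variable gamma : probability (borel F) R.
Hypothesis gaussian_gamma : is_gaussian gamma.
Hypothesis centered_gamma : is_centered gamma.
Variable d : nat -> F.
Hypothesis dense_d : forall k x (e : R), 0 < e -> exists j, q k (x - d j) < e.

Notation cov := (cov gamma).
Notation cov_on := (cov_on gamma).
Let sq := frechet_seminorm frechetF.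

(* The sets A m j partition F into pieces around the points of the dense
   sequence, of diameter at most 2 / (m + 1) for q m. *)
Let B m j : set (borel F) := [set x : borel F | q m ((x : F) - d j) < m.+1%:R^-1].
Let A m := seqDU (B m).
Let U m n := \big[setU/set0]_(j < n) A m j.

Let mB m j : measurable (B m j).
Proof.
have -> : B m j = (fun x : borel F => q m ((x : F) - d j)) @^-1` [set` `]-oo, m.+1%:R^-1[%R].
  by apply/seteqP; split => x /=; rewrite /B/= in_itv/=.
rewrite -[X in measurable X]setTI.
by apply: (measurable_seminorm_dist frechetF m (d j)) => //; exact: measurable_itv.
Qed.

Let mA m j : measurable (A m j).
Proof. by apply: measurableD => //; exact: bigsetU_measurable. Qed.

Let mU m n : measurable (U m n).
Proof. exact: bigsetU_measurable. Qed.

Let coverU m x : exists n0, forall n, (n0 <= n)%N -> U m n x.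
Proof.
have m0 : 0 < m.+1%:R^-1 :> R by rewrite invr_gt0.
have [j xj] := dense_d m x m0.
have : (\bigcup_j A m j) x.
  by rewrite -seqDU_bigcup_eq; exists j.
move=> [i _ xi]; exists i.+1 => n ni.
by rewrite /U -bigcup_mkord; exists i.
Qed.

Lemma cov_on_tail (f : dual F) m : cov_on (~` U m n) f f @[n --> \oo] --> 0.
Proof.
pose ff (x : borel F) : R := f x * f x.
have mff : measurable_fun setT (EFin \o ff).
  exact: (measurable_int gamma (dual_product_integrable gaussian_gamma
    centered_gamma f f measurableT)).
pose h n := (EFin \o ff) \_ (~` U m n).
have mh n : measurable_fun setT (h n).
  apply/(measurable_restrictT _ _).1; first exact: measurableC.
  exact: measurable_funTS.
have h0 (x : borel F) : setT x -> h n x @[n --> \oo] --> 0%E.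
  move=> _; apply: cvg_near_cst; have [n0 Un] := coverU m x.
  exists n0 => // n /Un Unx; rewrite /h patchE; case: ifPn => //.
  by rewrite inE => /(_ Unx).
have hle n (x : borel F) : setT x ->
    (`|h n x| <= (EFin \o ff) x)%E.
  move=> _; rewrite /h patchE; case: ifP => _ /=.
    by rewrite ger0_norm// /ff -expr2 sqr_ge0.
  by rewrite normr0 lee_fin /ff -expr2 sqr_ge0.
have iff : gamma.-integrable setT (EFin \o ff).
  exact: dual_product_integrable.
have [_ _ H] := @dominated_convergence _ _ _ gamma _ measurableT h (cst 0%E) _
  mh (measurable_cst _) (aeW _ h0) iff (aeW _ (fun x n Dx => hle n x Dx)).
rewrite /cov_on /Rintegral -[X in _ --> X]/(fine 0%E); apply: fine_cvg.
rewrite integral_cst// mul0e in H.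
by under eq_fun do rewrite integral_mkcond; exact: H.
Qed.

Section fixed_functional.
Variable f : dual F.

(* The first J m pieces carry all the variance of f but at most
   1 / (m + 1)^2. *)
Let J m := get [set n | cov_on (~` U m n) f f <= m.+1%:R^-1 ^+ 2].

Let JP m : cov_on (~` U m (J m)) f f <= m.+1%:R^-1 ^+ 2.
Proof.
rewrite /J; apply: (@getPex _ [set n | cov_on (~` U m n) f f <= m.+1%:R^-1 ^+ 2]).
have m0 : 0 < m.+1%:R^-1 ^+ 2 :> R by rewrite exprn_gt0// invr_gt0.
have /cvgrPdist_le/(_ _ m0)[n _ /(_ n (leqnn n))] := cov_on_tail f m.
rewrite sub0r normrN => h; exists n; rewrite /mkset.
by apply: le_trans h; exact: ler_norm.
Qed.

(* Riemann sums of the vector integral of f x *: x. *)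
Let h m : F := \sum_(j < J m) (\int[gamma]_(x in A m j) f x) *: d j.

Let int_f D : measurable D -> gamma.-integrable D (EFin \o (f : borel F -> R)).
Proof.
move=> mD; apply: (integrableS measurableT) => //.
apply: (@le_integrable _ _ _ gamma _ measurableT _
  (fun x => (1%:E + (f x ^+ 2)%:E)%E)) => //.
- by apply/measurable_EFinP; exact: measurable_dual.
- move=> x _; rewrite -EFinD lee_fin [leRHS]ger0_norm ?addr_ge0 ?sqr_ge0//.
  rewrite -(real_normK (num_real (f x))).
  by have := sqr_ge0 (`|f x| - 1); have := normr_ge0 (f x); nra.
- apply: integrableD => //; first exact: finite_measure_integrable_cst.
  exact: dual_square_integrable.
Qed.

Let c := \int[gamma]_x `|f x|.

Let integrable_step_term m (g : dual F) (j : 'I_(J m)) :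
  gamma.-integrable (U m (J m)) (EFin \o (fun x => g (d j) * \1_(A m j) x * f x)).
Proof.
have I1 : gamma.-integrable setT (EFin \o (fun x => \1_(A m j) x * f x)).
  rewrite (_ : EFin \o _ = (EFin \o (f : borel F -> R)) \_ (A m j)); last first.
    apply/funext => x /=; rewrite patchE indicE; case: (_ \in _).
      by rewrite mul1r.
    by rewrite mul0r.
  by apply/(integrable_mkcond _ (mA m j)); exact: int_f.
apply: (integrableS measurableT) => //.
rewrite (_ : EFin \o _ = (fun x => (g (d j))%:E * (\1_(A m j) x * f x)%:E)%E).
  exact: (integrableZl measurableT _ I1).
by apply/funext => x /=; rewrite -EFinM mulrA.
Qed.

Let integrable_step m (g : dual F) : gamma.-integrable (U m (J m))
  (EFin \o (fun x => \sum_(j < J m) g (d j) * \1_(A m j) x * f x)).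
Proof.
by have [] := Rintegral_sum (index_enum 'I_(J m)) (mU m (J m))
  (integrable_step_term g).
Qed.

Let gE m (g : dual F) : g (h m) =
  \int[gamma]_(x in U m (J m)) (\sum_(j < J m) g (d j) * \1_(A m j) x * f x).
Proof.
have [_ ->] := Rintegral_sum (index_enum 'I_(J m)) (mU m (J m))
  (integrable_step_term g).
rewrite /h linear_sum/=; apply: eq_bigr => j _.
rewrite linearZ/= /GRing.scale/= mulrC -RintegralZl//; last exact: int_f.
rewrite [LHS]Rintegral_mkcond [RHS]Rintegral_mkcond; apply: eq_Rintegral => x _.
rewrite !patchE indicE; case: (boolP (x \in A m j)) => xA.
  rewrite mulr1 ifT//; rewrite !inE in xA *.
  by rewrite /U -bigcup_mkord; exists j => //=.
by rewrite mulr0 mul0r; case: ifP.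
Qed.

Let approx k m (g : dual F) (C : R) : (k <= m)%N -> (forall x, `|g x| <= q k x) ->
  cov g g <= C -> `|(g (h m) : R) - cov g f| <= (c + Num.sqrt C) * m.+1%:R^-1.
Proof.
move=> km gq gC; set e := m.+1%:R^-1; have e0 : 0 < e by rewrite invr_gt0.
set V := U m (J m).
have mV : measurable V by exact: mU.
have mVC : measurable (~` V) by exact: measurableC.
have IV : gamma.-integrable V (EFin \o (fun x => g x * f x)).
  exact: dual_product_integrable.
have -> : cov g f = \int[gamma]_(x in V) (g x * f x) + cov_on (~` V) g f.
  rewrite /cov /cov_on -Rintegral_setU ?setUv//; last exact/disj_setPRL.
  exact: dual_product_integrable.
rewrite opprD addrA mulrDl; apply: (le_trans (ler_normB _ _)); apply: lerD; last first.
  rewrite -(ler_pXn2r (ltn0Sn 1)) ?nnegrE ?mulr_ge0 ?sqrtr_ge0 ?(ltW e0)//.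
  have C0 : 0 <= C by apply: le_trans gC; exact: (form_ge0 (psd_cov gaussian_gamma centered_gamma)).
  rewrite real_normK ?num_real// exprMn sqr_sqrtr//.
  have psdV := psd_cov_on gaussian_gamma centered_gamma mVC.
  apply: (le_trans (form_cauchy_schwarz psdV g f)).
  rewrite ler_pM//; try exact: (form_ge0 psdV).
    by apply: le_trans gC; exact: cov_on_le.
  exact: JP.
have IS : gamma.-integrable V
    (EFin \o (fun x => \sum_(j < J m) g (d j) * \1_(A m j) x * f x)).
  exact: (integrable_step m g).
rewrite gE -(RintegralB mV IS IV).
have IB := integrableB mV IS IV.
apply: (le_trans (le_normr_Rintegral mV IB)).
have If := integrable_norm (int_f measurableT).
have Ief : gamma.-integrable setT (EFin \o (fun x => e * `|f x|)).
  exact: (integrableZl measurableT e If).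
apply: (@le_trans _ _ (\int[gamma]_(x in V) (e * `|f x|))).
  apply: le_Rintegral => //; first exact: (integrable_norm IB).
    exact: (integrableS measurableT mV _ Ief).
  move=> x; rewrite /V /U -bigcup_mkord => -[i /= iJ Aix].
  rewrite (bigD1 (Ordinal iJ))//= indicE mem_set// mulr1 big1 ?addr0.
    rewrite -mulrBl normrM ler_wpM2r// -linearB (le_trans (gq _))//.
    rewrite (le_trans (frechet_le frechetF _ km))// (seminorm_distC (sq m)) ltW//.
    exact: (@subset_seqDU _ (B m) i x Aix).
  move=> j ji; rewrite indicE memNset ?mulr0 ?mul0r// => Ajx.
  have /trivIsetP/(_ j i I I) := @trivIset_seqDU _ (B m).
  have -> : (j : nat) != i by apply: contra ji => /eqP E; apply/eqP; exact: val_inj.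
  by move=> /(_ isT)/seteqP[/(_ x (conj Ajx Aix))].
rewrite mulrC -RintegralZl// [leLHS]Rintegral_mkcond; apply: le_Rintegral => //.
- rewrite (_ : EFin \o _ = (EFin \o (fun x => e * `|f x|)) \_ V); last first.
    by apply/funext => x /=; rewrite !patchE; case: ifP.
  apply/(integrable_mkcond _ mV).
  exact: (integrableS measurableT mV _ Ief).
- by move=> x _; rewrite patchE; case: ifP => // _; rewrite mulr_ge0// ltW.
Qed.

(** The barycenter is the vector integral of f x *: x.  The estimate of the
   Riemann sums is uniform over the functionals bounded by q k, so that they form
   a Cauchy sequence in F. *)
Lemma exists_barycenter : exists r : F, forall g : dual F, g r = cov g f.
Proof.
have c0 : 0 <= c by apply: Rintegral_ge0.
have e_cvg K : K * n.+1%:R^-1 @[n --> \oo] --> (0 : R).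
  by rewrite -[X in _ --> X](mulr0 K); apply: cvgMr; exact: cvg_harmonic.
have [|r hr] := frechet_complete frechetF (u := h).
  move=> k e e0.
  have [C [C0 gC]] := dual_cov_bounded frechetF gaussian_gamma centered_gamma k.
  pose K := c + Num.sqrt C.
  have K0 : 0 <= K by rewrite addr_ge0 ?sqrtr_ge0.
  have e20 : 0 < e / 2 by rewrite divr_gt0.
  have /cvgrPdist_lt/(_ _ e20)[N _ HN] := e_cvg K.
  have HK m : (maxn N k <= m)%N -> K * m.+1%:R^-1 < e / 2.
    move=> Nm; have := HN m (leq_trans (leq_maxl N k) Nm).
    by rewrite sub0r normrN ger0_norm// mulr_ge0.
  exists ([set m | (maxn N k <= m)%N], [set m | (maxn N k <= m)%N]).
    by split; exists (maxn N k).
  move=> [m n] /= [Nm Nn].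
  have [g [lg gq gh]] := hahn_banach_support (h m - h n) (sq k).
  have gq1 x : `|g x| <= 1 * q k x by rewrite mul1r.
  have [g' g'g] := linear_dual frechetF lg gq1.
  have g'q x : `|g' x| <= q k x by rewrite g'g.
  rewrite -gh -g'g linearB/=.
  have km := leq_trans (leq_maxr N k) Nm; have kn := leq_trans (leq_maxr N k) Nn.
  have := approx km g'q (gC _ g'q); have := approx kn g'q (gC _ g'q).
  have := HK m Nm; have := HK n Nn; rewrite -/K.
  have half (a b v x y : R) : y < e / 2 -> x < e / 2 ->
      `|b - v| <= y -> `|a - v| <= x -> a - b < e.
    by move=> ? ? /ler_normlP[? ?] /ler_normlP[? ?]; lra.
  exact: half.
exists r => g.
have [k [C [C0 gC]]] := dual_bounded frechetF g.
pose g' := C^-1 *: g.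
have g'q x : `|g' x| <= q k x.
  by change (`|C^-1 * g x| <= q k x); rewrite normrM gtr0_norm ?invr_gt0// ler_pdivrMl.
suff H : g' r = cov g' f.
  have gg' : g = C *: g' by rewrite /g' scalerA mulfV ?gt_eqF// scale1r.
  rewrite gg' (formZl (psd_cov gaussian_gamma centered_gamma)) -H.
  by [].
have c1 : g' (h n) @[n --> \oo] --> g' r.
  apply/cvgrPdist_lt => e e0; have /cvgrPdist_lt/(_ _ e0) := hr k.
  apply: filterS => n; rewrite sub0r normrN ger0_norm ?(seminorm_ge0 (sq k))//.
  by apply: le_lt_trans; rewrite distrC -linearB; exact: g'q.
have c2 : g' (h n) @[n --> \oo] --> cov g' f.
  apply/cvgrPdist_lt => e e0.
  have /cvgrPdist_lt/(_ _ e0)[N _ HN] := e_cvg (c + Num.sqrt (cov g' g')).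
  exists (maxn N k) => // n /= Nn.
  have := HN n (leq_trans (leq_maxl N k) Nn).
  rewrite sub0r normrN ger0_norm ?mulr_ge0 ?addr_ge0 ?sqrtr_ge0//; apply: le_lt_trans.
  by rewrite distrC; apply: approx g'q _ => //; exact: leq_trans (leq_maxr N k) Nn.
by apply: (@cvg_unique _ (@Rhausdorff R) _ _ _ _ c1 c2).
Qed.

End fixed_functional.
End barycenter.

(** * The Hilbert space structure of the Cameron-Martin space *)

Section cameron_martin_basis.
Context {R : realType} {F : topologicalLmodType R} (q : nat -> F -> R).
Hypothesis frechetF : separable_frechet q.
Variable gamma : probability (borel F) R.
Hypothesis gaussian_gamma : is_gaussian gamma.
Hypothesis centered_gamma : is_centered gamma.
Variable d : nat -> F.
Hypothesis dense_d : forall k x (e : R), 0 < e -> exists j, q k (x - d j) < e.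
Variable phi : nat -> nat -> dual F.
Hypothesis phi_le : forall k j x, `|phi k j x| <= q k x.
Hypothesis phi_d : forall k j, phi k j (d j) = q k (d j).

Notation cov := (cov gamma).
Notation H := (cameron_martin gamma).
Notation dot := (cm_dot (gamma := gamma)).
Let sq := frechet_seminorm frechetF.
Let psd : psd_form cov := psd_cov gaussian_gamma centered_gamma.

Definition cm_real_norm (h : F) : R := fine (cm_norm gamma h).
Notation N := cm_real_norm.

Let finH (h : H) : (cm_norm gamma h < +oo)%E := cm_valP h.

Let N_ge0 (h : F) : 0 <= N h. Proof. by rewrite fine_ge0// cm_norm_ge0. Qed.

Let dualH (f : dual F) (h : H) : `|f h| <= Num.sqrt (cov f f) * N h.
Proof. exact: (cm_norm_dual gaussian_gamma centered_gamma f (finH h)). Qed.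

Let N_le (c : R) (h : F) : 0 <= c ->
  (forall f : dual F, `|f h| <= c * Num.sqrt (cov f f)) -> N h <= c.
Proof.
move=> c0 fc; have hc := cm_norm_le gaussian_gamma centered_gamma c0 fc.
rewrite -lee_fin fineK// ge0_fin_numE ?cm_norm_ge0//.
by apply: le_lt_trans hc _; rewrite ltry.
Qed.

Let NE (h : H) : hnorm dot h = N h. Proof. exact: hnorm_cm_dot. Qed.

Let ND (h k : H) : N (h + k) <= N h + N k.
Proof.
rewrite -lee_fin EFinD !fineK ?ge0_fin_numE ?cm_norm_ge0//.
exact: cm_normD.
Qed.

Let NZ (a : R) (h : H) : N (a *: (h : F)) = `|a| * N h.
Proof. by rewrite /N cm_normZ fineM// ge0_fin_numE ?cm_norm_ge0. Qed.

Let NB (h k : H) : N (h - k) = N (k - h).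
Proof. by rewrite -opprB -scaleN1r (NZ (-1) (k - h)) normrN1 mul1r. Qed.

(** A single sequence norms all the seminorms at all the points d j. *)
Let psi n : dual F := if unpickle n is Some (k, j) then phi k j else 0.

(** These functionals are the coordinates of the Cameron-Martin space: they are
   orthonormal, or null, in the space of square integrable functions. *)
Definition cm_functional : nat -> dual F := gram_schmidt cov psi.
Notation f := cm_functional.

Let sf : subnormal_seq cov f := gram_schmidt_subnormal psd psi.

Let barycenterP i : exists r : F, forall g : dual F, g r = cov g (f i).
Proof. exact: (exists_barycenter frechetF gaussian_gamma centered_gamma dense_d). Qed.

Let vec i : F := projT1 (cid (barycenterP i)).

Let vecE i (g : dual F) : g (vec i) = cov g (f i).
Proof. exact: (projT2 (cid (barycenterP i))). Qed.

Let vec_cm i : in_cm gamma (vec i).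
Proof.
apply: (@le_lt_trans _ _ (Num.sqrt (cov (f i) (f i)))%:E); last by rewrite ltry.
apply: (cm_norm_le gaussian_gamma centered_gamma); first exact: sqrtr_ge0.
move=> g; rewrite vecE -(ler_pXn2r (ltn0Sn 1)) ?nnegrE ?mulr_ge0 ?sqrtr_ge0//.
rewrite real_normK ?num_real// exprMn !sqr_sqrtr ?(form_ge0 psd)// mulrC.
exact: (form_cauchy_schwarz psd).
Qed.

(** By cm_dot_vector below, cm_vector i is the Riesz representative of
   cm_functional i. *)
Definition cm_vector i : H := CameronMartin (vec_cm i).
Notation e := cm_vector.

Lemma cm_vectorE i (g : dual F) : g (e i) = cov g (f i).
Proof. exact: vecE. Qed.


Let comb n (a : nat -> R) : H := \sum_(i < n) a i *: e i.

Let dual_comb n a (g : dual F) : g (comb n a) = cov g (\sum_(i < n) a i *: f i).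
Proof.
rewrite /comb (form_sumr psd) -[cm_val _]/(cm_embedding gamma _) !linear_sum/=.
apply: eq_bigr => i _; rewrite (formZr psd) -cm_vectorE.
by rewrite -[LHS]/(g (a i *: (e i : F))) linearZ.
Qed.

Let comb_norm n a : N (comb n a) <= Num.sqrt (\sum_(i < n) a i ^+ 2).
Proof.
apply: N_le; first exact: sqrtr_ge0.
move=> g; rewrite dual_comb -(ler_pXn2r (ltn0Sn 1)) ?nnegrE ?mulr_ge0 ?sqrtr_ge0//.
rewrite real_normK ?num_real// exprMn !sqr_sqrtr ?(form_ge0 psd) ?sumr_ge0// => [|i _]; last exact: sqr_ge0.
apply: (le_trans (form_cauchy_schwarz psd _ _)); rewrite mulrC.
apply: ler_wpM2r; first exact: (form_ge0 psd).
exact: (form_comb_le psd sf).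
Qed.

Lemma cm_bessel n (h : H) : \sum_(i < n) (f i h : R) ^+ 2 <= N h ^+ 2.
Proof.
pose a i : R := f i h; pose s := \sum_(i < n) a i ^+ 2.
have s0 : 0 <= s by apply: sumr_ge0 => i _; exact: sqr_ge0.
have := dualH (\sum_(i < n) a i *: f i) h.
have -> : (\sum_(i < n) a i *: f i) h = s :> R.
  by rewrite dual_sum; apply: eq_bigr => i _; rewrite dualZ expr2.
rewrite ger0_norm// => sN; rewrite -[leLHS]/s.
have {}sN : s <= Num.sqrt s * N h.
  by apply: (le_trans sN); apply: ler_wpM2r => //; rewrite ler_sqrt//; exact: (form_comb_le psd sf).
have [->|sn0] := eqVneq s 0; first exact: sqr_ge0.
have sp : 0 < Num.sqrt s by rewrite sqrtr_gt0 lt_neqAle eq_sym sn0.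
rewrite -{1}(sqr_sqrtr s0) ler_pXn2r ?nnegrE ?sqrtr_ge0//.
by rewrite -(ler_pM2l sp) -expr2 sqr_sqrtr.
Qed.

Let functional_eq0 (g : dual F) (h : H) : cov g g = 0 -> g h = 0 :> R.
Proof.
by move=> g0; have := dualH g h; rewrite g0 sqrtr0 mul0r normr_le0 => /eqP.
Qed.

Let expand n (h : H) : H := comb n (fun i => f i h).

Let f_expand i n (h : H) : (i < n)%N -> f i (expand n h) = f i h :> R.
Proof.
move=> i_n; rewrite dual_comb (form_sumr psd) (bigD1 (Ordinal i_n))//= big1 => [|j ji].
  rewrite addr0 (formZr psd); case: sf => _ /(_ i)[fi|->]; last by rewrite mulr1.
  by rewrite fi mulr0 functional_eq0.
by rewrite (formZr psd) sf.1 ?mulr0// eq_sym.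
Qed.

Let cm_separated (x : H) : (forall i, f i x = 0 :> R) -> x = 0.
Proof.
move=> fx; apply: val_inj => /=; apply: (frechet_separated frechetF) => k.
have psix n : psi n x = 0 :> R.
  have := functional_eq0 x (gram_schmidt_null psd psi (ltnSn n)).
  rewrite dualB dual_sum big1 ?subr0// => i _.
  by rewrite dualZ fx mulr0.
apply/eqP; rewrite eq_le (seminorm_ge0 (sq k)) andbT leNgt; apply/negP => qx.
have qq y : q k y <= 1 * q k y by rewrite mul1r.
have [j] := norming_sequence_sup ltr01 (sq k) qq (dense_d k) (phi_le k) (phi_d k) qx.
by have := psix (pickle (k, j)); rewrite /psi pickleK => ->; rewrite normr0 ltxx.
Qed.

(** The expansion is Cauchy by the Bessel inequality; its limit has the same
   coordinates as h, and the coordinates separate the points because the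
   functionals phi are norming. *)
Lemma cm_expansion (h : H) : N (h - expand n h) @[n --> \oo] --> 0.
Proof.
pose A n := \sum_(i < n) (f i h : R) ^+ 2.
have ltr0Sn2 : 0 < 2 :> R by [].
have Amono : nondecreasing_seq A.
  by apply/nondecreasing_seqP => n; rewrite /A big_ord_recr/= lerDl; exact: sqr_ge0.
have cA : cvgn A.
  apply: nondecreasing_is_cvgn => //.
  by exists (N h ^+ 2) => _ [n _ <-]; exact: cm_bessel.
have dist m n : (m <= n)%N -> N (expand n h - expand m h) <= Num.sqrt (A n - A m).
  move=> mn; pose b i := if (m <= i)%N then f i h : R else 0.
  have E (V : zmodType) (G : nat -> V) (G' : nat -> V) :
      (forall i, G' i = if (m <= i)%N then G i else 0) ->
      \sum_(i < n) G i - \sum_(i < m) G i = \sum_(i < n) G' i.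
    move=> GG; rewrite -!(big_mkord xpredT G) -(big_mkord xpredT G').
    rewrite (big_cat_nat (leq0n m) mn)/= addrAC subrr add0r.
    rewrite [RHS](big_cat_nat (leq0n m) mn)/=.
    have -> : \sum_(0 <= i < m) G' i = 0.
      by rewrite big_nat big1 // => i /andP[_ im]; rewrite GG leqNgt im.
    by rewrite add0r !big_nat; apply: eq_bigr => i /andP[mi _]; rewrite GG mi.
  have -> : A n - A m = \sum_(i < n) b i ^+ 2.
    apply: (E R (fun i => (f i h : R) ^+ 2) (fun i => b i ^+ 2)) => i.
    by rewrite /b; case: ifP => // _; rewrite expr0n.
  have -> : (expand n h - expand m h : F) = comb n b.
    rewrite -[RHS]/(cm_embedding gamma (comb n b)) -[LHS]/(cm_embedding gamma (expand n h - expand m h)).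
    congr (cm_embedding gamma _).
    apply: (E H (fun i => (f i h : R) *: e i) (fun i => b i *: e i)) => i.
    by rewrite /b; case: ifP => // _; rewrite scale0r.
  exact: comb_norm.
have [|s cs] := cm_complete frechetF gaussian_gamma centered_gamma (u := fun n => expand n h).
  move=> eps e0; have e2 : 0 < eps ^+ 2 by rewrite exprn_gt0.
  have /cvgrPdist_lt/(_ _ (divr_gt0 e2 ltr0Sn2))[n0 _ An] := cA.
  exists ([set m | (n0 <= m)%N], [set m | (n0 <= m)%N]); first by split; exists n0.
  move=> [m n] /= [nm nn]; rewrite NE.
  wlog mn : m n nm nn / (n <= m)%N => [W|].
    have [mn|/ltnW mn] := leqP n m; first exact: W.
    by rewrite NB; exact: W.
  apply: (le_lt_trans (dist _ _ mn)).
  rewrite -(ltr_pXn2r (ltn0Sn 1)) ?nnegrE ?sqrtr_ge0 ?(ltW e0)//.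
  have Amn : 0 <= A m - A n by rewrite subr_ge0; exact: Amono.
  rewrite sqr_sqrtr//.
  have := An m nm; have := An n nn; rewrite !ltr_norml => /andP[? ?] /andP[? ?].
  lra.
have fs i : f i s = f i h :> R.
  apply/eqP; rewrite -subr_eq0 -normr_le0.
  have c1 : Num.sqrt (cov (f i) (f i)) * hnorm dot (expand n h - s) @[n --> \oo] --> (0 : R).
    by rewrite -[X in _ --> X](mulr0 (Num.sqrt (cov (f i) (f i)))); exact: cvgMr.
  apply: (ler_cvg_to (cvg_cst _) c1); exists i.+1 => // n /= i_n.
  rewrite NE -(f_expand h i_n) distrC -linearB.
  exact: (dualH (f i) (expand n h - s)).
have hs : h = s.
  apply/eqP; rewrite -subr_eq0; apply/eqP; apply: cm_separated => i.
  by rewrite linearB/= fs subrr.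
by move: cs; rewrite -hs; under eq_fun do rewrite NE NB.
Qed.

Lemma cm_parseval (h : H) : \sum_(i < n) (f i h : R) ^+ 2 @[n --> \oo] --> N h ^+ 2.
Proof.
pose A n := \sum_(i < n) (f i h : R) ^+ 2.
have A0 n : 0 <= A n by apply: sumr_ge0 => i _; exact: sqr_ge0.
have cA : Num.sqrt (A n) @[n --> \oo] --> N h.
  apply: (@squeeze_cvgr _ _ _ _ (fun n => N h - N (h - expand n h)) (cst (N h))).
  - near=> n; apply/andP; split.
      rewrite lerBlDl -{1}(subrK (expand n h) h).
      by rewrite (le_trans (ND _ _))// lerD2l comb_norm.
    by rewrite (le_trans (ler_wsqrtr (cm_bessel n h)))// sqrtr_sqr ger0_norm.
  - rewrite -[X in _ --> X](subr0 (N h)).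
    exact: (cvgB (cvg_cst (N h)) (cm_expansion h)).
  - exact: cvg_cst.
have AE : A = (fun n => Num.sqrt (A n) * Num.sqrt (A n)).
  by apply/funext => n; rewrite -expr2 sqr_sqrtr.
by rewrite expr2 -/A AE; exact: (cvgM cA cA).
Unshelve. all: end_near. Qed.

(** Polarization in each coordinate.  The form cm_dot, defined from the norm, is
   bilinear because this limit is. *)
Lemma cm_dot_cvg (h k : H) :
  \sum_(i < n) (f i h : R) * f i k @[n --> \oo] --> dot h k.
Proof.
have c := cvgM (cvgB (@cm_parseval (h + k)) (@cm_parseval (h - k))) (cvg_cst (4^-1 : R)).
have E : (fun n => \sum_(i < n) (f i h : R) * f i k) =
    (fun n => (\sum_(i < n) (f i (h + k) : R) ^+ 2 - \sum_(i < n) (f i (h - k) : R) ^+ 2) / 4).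
  apply/funext => n.
  rewrite -sumrB mulr_suml; apply: eq_bigr => i _.
  have -> : f i (h + k) = (f i h : R) + f i k :> R by exact: (linearD (f i)).
  have -> : f i (h - k) = (f i h : R) - f i k :> R by exact: (linearB (f i)).
  have aux (x y : R) : x * y = ((x + y) ^+ 2 - (x - y) ^+ 2) / 4 by field.
  exact: aux.
by rewrite E; exact: c.
Qed.

Let dot_unique (u : nat -> R) (l : R) (h k : H) :
  u n @[n --> \oo] --> l -> (\forall n \near \oo, \sum_(i < n) (f i h : R) * f i k = u n) ->
  dot h k = l.
Proof.
move=> ul un; apply: (@cvg_unique _ (@Rhausdorff R) _ _ _ _ (@cm_dot_cvg h k)).
by apply: cvg_trans ul; apply: near_eq_cvg; apply: filterS un => n ->.
Qed.

Lemma cm_inner_product : is_inner_product dot.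
Proof.
split.
- move=> x y; apply: (dot_unique (@cm_dot_cvg y x)).
  by apply: nearW => n; apply: eq_bigr => i _; rewrite mulrC.
- move=> a x y z.
  apply: (dot_unique (cvgD (cvgM (cvg_cst a) (@cm_dot_cvg x z)) (@cm_dot_cvg y z))).
  apply: nearW => n /=; rewrite mulr_sumr -big_split/=; apply: eq_bigr => i _.
  rewrite mulrA -mulrDl; congr (_ * _); rewrite -[LHS]/(f i (a *: (x : F) + (y : F))).
  by rewrite linearP.
- move=> x x0; have -> : dot x x = N x ^+ 2.
    by apply: (dot_unique (@cm_parseval x)); apply: nearW => n; apply: eq_bigr => i _; rewrite expr2.
  rewrite exprn_gt0// lt_neqAle N_ge0 andbT; apply: contra x0 => /eqP N0.
  apply/eqP; apply: cm_separated => i; apply/eqP; rewrite -normr_le0.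
  by have := dualH (f i) x; rewrite -N0 mulr0.
Qed.

Lemma cm_dot_vector i (h : H) : dot (e i) h = f i h.
Proof.
apply: (dot_unique (u := fun n => f i h) (cvg_cst _)).
exists i.+1 => // n /= i_n; rewrite (bigD1 (Ordinal i_n))//= big1 => [|j ji].
  rewrite addr0 cm_vectorE; case: sf => _ /(_ i)[fi|->]; last by rewrite mul1r.
  by rewrite fi mul0r functional_eq0.
by rewrite cm_vectorE sf.1 ?mul0r.
Qed.

Lemma cm_separable : hseparable dot.
Proof.
exists (range (fun s : seq rat => comb (size s) (fun i => ratr (nth 0 s i)))).
  by apply: sub_countable (card_image_le _ _) _; exact: countableP.
move=> x eps e0; have e2 : 0 < eps / 2 by rewrite divr_gt0.
have /cvgrPdist_lt/(_ _ e2)[n _ /(_ n (leqnn n))] := cm_expansion x.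
rewrite sub0r normrN ger0_norm// => xn.
pose del := eps / 2 / n.+1%:R; have del0 : 0 < del by rewrite !divr_gt0.
have app i : exists r : rat, `|ratr r - (f i x : R)| < del.
  have lt_del : (f i x : R) - del < f i x + del by rewrite (lt_trans (y := f i x))// ?ltrDl// ltrBlDr ltrDl.
  have [r] := rat_in_itvoo lt_del.
  by rewrite in_itv/= => /andP[r1 r2]; exists r; rewrite ltr_distl r1 r2.
have [r rf] := choice app.
have Er : comb (size (mkseq r n)) (fun i => ratr (nth 0 (mkseq r n) i)) = comb n (fun i => ratr (r i)).
  by rewrite size_mkseq; apply: eq_bigr => i _; rewrite nth_mkseq.
exists (comb n (fun i => ratr (r i))); first by exists (mkseq r n).
rewrite /hball /= NE.
have -> : (comb n (fun i => ratr (r i)) - x : H) =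
   comb n (fun i => ratr (r i) - (f i x : R)) - (x - expand n x).
  rewrite opprB addrA; congr (_ - _); rewrite -big_split/=.
  by apply: eq_bigr => i _; rewrite -scalerDl subrK.
apply: (le_lt_trans (ND _ _)).
have -> : N (- (x - expand n x)) = N (x - expand n x).
  by rewrite -scaleN1r (NZ (-1) (x - expand n x)) normrN1 mul1r.
have -> : eps = eps / 2 + eps / 2 by field.
apply: ler_ltD => //; apply: (le_trans (comb_norm _ _)).
rewrite -(ger0_norm (ltW e2)) -sqrtr_sqr ler_sqrt ?sqr_ge0//.
apply: (@le_trans _ _ (\sum_(i < n) del ^+ 2)).
  apply: ler_sum => i _; rewrite -(real_normK (num_real (_ - _))).
  by rewrite ler_pXn2r ?nnegrE ?(ltW del0)// ltW.
have -> : eps / 2 = del * n.+1%:R by rewrite /del divfK.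
clearbody del; rewrite sumr_const card_ord -(mulr_natr _ n) exprMn.
apply: ler_wpM2l; first exact: sqr_ge0.
by rewrite -natrX ler_nat (leq_trans (leqnSn n))// leq_pmulr.
Qed.

End cameron_martin_basis.

(** * Gauges of finite-dimensional hulls *)

Section hull_gauge.
Context {R : realType} {V : lmodType R} (q : V -> R).
Hypothesis sq : is_seminorm q.
Variables (J : nat) (d : nat -> V) (eps : R).
Hypothesis eps0 : 0 < eps.

Definition hull_cost (y : V) (a : nat -> R) : R :=
  q (y - \sum_(j < J) a j *: d j) / eps + \sum_(j < J) `|a j|.

(** The gauge of the sum of the q-ball of radius eps and of the symmetric
   convex hull of d 0, .., d (J - 1), up to a factor 2.  As an infimum of a
   seminorm over linear fibres it is a seminorm. *)
Definition hull_gauge (y : V) : R := inf (range (hull_cost y)).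

Let cost_ge0 y a : 0 <= hull_cost y a.
Proof.
by rewrite addr_ge0 ?divr_ge0 ?(seminorm_ge0 sq) ?(ltW eps0)// sumr_ge0.
Qed.

Let cost_inf y : has_inf (range (hull_cost y)).
Proof.
split; first by exists (hull_cost y (fun=> 0)); exists (fun=> 0).
by exists 0 => _ [a _ <-].
Qed.

Lemma hull_gauge_le y a : hull_gauge y <= hull_cost y a.
Proof. by apply: ge_inf; [exact: (cost_inf y).2|exists a]. Qed.

Lemma hull_gauge_ge (c : R) y : (forall a, c <= hull_cost y a) -> c <= hull_gauge y.
Proof.
by move=> H; apply: lb_le_inf; [exact: (cost_inf y).1|move=> _ [a _ <-]].
Qed.

Lemma hull_gauge_lt (c : R) y : hull_gauge y < c -> exists a, hull_cost y a < c.
Proof.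
move=> yc; apply: contrapT => H; move: yc; rewrite ltNge => /negP; apply.
apply: hull_gauge_ge => a; rewrite leNgt; apply/negP => h.
by apply: H; exists a.
Qed.

Let gauge_ge0 y : 0 <= hull_gauge y. Proof. exact: hull_gauge_ge. Qed.

Let costZ (c : R) y a : hull_cost (c *: y) (fun j => c * a j) = `|c| * hull_cost y a.
Proof.
rewrite /hull_cost mulrDr mulrA -sq.2 scalerBr scaler_sumr mulr_sumr.
congr (q (_ - _) / _ + _); first by apply: eq_bigr => j _; rewrite scalerA.
by apply: eq_bigr => j _; rewrite normrM.
Qed.

Lemma hull_gauge_seminorm : is_seminorm hull_gauge.
Proof.
split=> [x y|c y].
  rewrite -lerBlDl; apply: hull_gauge_ge => b.
  rewrite lerBlDl -lerBlDr; apply: hull_gauge_ge => a; rewrite lerBlDr.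
  apply: (le_trans (hull_gauge_le _ (fun j => a j + b j))).
  rewrite /hull_cost.
  have -> : \sum_(j < J) (a j + b j) *: d j = \sum_(j < J) a j *: d j + \sum_(j < J) b j *: d j.
    by rewrite -big_split; apply: eq_bigr => j _; rewrite scalerDl.
  rewrite [leRHS]addrACA -mulrDl; apply: lerD.
    by rewrite opprD addrACA ler_pM2r ?invr_gt0// sq.1.
  by rewrite -big_split/=; apply: ler_sum => j _; exact: ler_normD.
have leZ (b : R) z : hull_gauge (b *: z) <= `|b| * hull_gauge z.
  have [->|b0] := eqVneq b 0.
    rewrite scale0r normr0 mul0r (le_trans (hull_gauge_le 0 (fun=> 0)))//.
    rewrite /hull_cost big1 => [|j _]; last by rewrite scale0r.
    by rewrite subr0 (seminorm0 sq) mul0r add0r big1// => j _; rewrite normr0.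
  have bp : 0 < `|b| by rewrite normr_gt0.
  rewrite -ler_pdivrMl//; apply: hull_gauge_ge => a.
  by rewrite ler_pdivrMl// -costZ hull_gauge_le.
have [->|c0] := eqVneq c 0.
  apply/eqP; rewrite eq_le leZ/= normr0 mul0r; exact: gauge_ge0.
apply/eqP; rewrite eq_le leZ/= -ler_pdivlMl ?normr_gt0//.
by have := leZ c^-1 (c *: y); rewrite scalerA mulVf// scale1r normfV.
Qed.

Lemma hull_gauge_seminorm_le y : hull_gauge y <= eps^-1 * q y.
Proof.
apply: (le_trans (hull_gauge_le y (fun=> 0))); rewrite /hull_cost.
rewrite big1 => [|j _]; last by rewrite scale0r.
rewrite big1 => [|j _]; last by rewrite normr0.
by rewrite subr0 addr0 mulrC.
Qed.

Lemma hull_gauge_near j y : (j < J)%N -> q (y - d j) < eps -> hull_gauge y <= 2.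
Proof.
move=> jJ yj; apply: (le_trans (hull_gauge_le y (fun i => (i == j)%:R))).
rewrite /hull_cost (bigD1 (Ordinal jJ))//= eqxx scale1r big1 => [|i ij]; last first.
  by rewrite (_ : _ == _ = false) ?scale0r//; exact: negbTE.
rewrite addr0 [X in _ + X](bigD1 (Ordinal jJ))//= eqxx normr1 big1 => [|i ij]; last first.
  by rewrite (_ : _ == _ = false) ?normr0//; exact: negbTE.
rewrite addr0 -[leRHS]/(1 + 1 : R) lerD2r ler_pdivrMr// mul1r.
exact: ltW.
Qed.

End hull_gauge.

(** The net is the image of a grid of mesh eta in the box of coefficients. *)
Lemma box_net (R : realType) (V : lmodType R) (q : V -> R) (J : nat)
    (d : nat -> V) (M eps : R) : is_seminorm q -> 0 < eps ->
  exists (T : finType) (y : T -> V), forall a : nat -> R,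
    (forall j, (j < J)%N -> `|a j| <= M) ->
    exists c, q (\sum_(j < J) a j *: d j - y c) < eps.
Proof.
move=> sq eps0.
pose S := 1 + \sum_(j < J) q (d j).
have S0 : 0 < S by rewrite ltr_pwDl// sumr_ge0// => j _; exact: seminorm_ge0.
pose eta := eps / S; have eta0 : 0 < eta by rewrite divr_gt0.
pose K := (Num.truncn (2 * M / eta)).+1.
pose grid (i : 'I_K) : R := i%:R * eta - M.
exists {ffun 'I_J -> 'I_K}, (fun c : {ffun 'I_J -> 'I_K} => \sum_(j < J) grid (c j) *: d j) => a aM.
have H (j : 'I_J) : exists i : 'I_K, `|a j - grid i| < eta.
  have := aM j (ltn_ord j); rewrite ler_norml => /andP[a1 a2].
  have b0 : 0 <= (a j + M) / eta by rewrite divr_ge0 ?(ltW eta0)//; lra.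
  have iK : (Num.truncn ((a j + M) / eta) < K)%N.
    rewrite ltnS; apply: le_truncn; rewrite ler_pM2r ?invr_gt0//; lra.
  exists (Ordinal iK); rewrite /grid/=.
  have /andP[] := truncn_itv b0; set n := Num.truncn _.
  rewrite ler_pdivlMr// ltr_pdivrMr// -natr1 mulrDl mul1r => n1 n2.
  rewrite ltr_norml; apply/andP; split; lra.
have [i Hi] := choice H.
exists [ffun j => i j]; rewrite -sumrB.
apply: (le_lt_trans (seminorm_sum sq _ _)).
apply: (@le_lt_trans _ _ (eta * \sum_(j < J) q (d j))).
  rewrite mulr_sumr; apply: ler_sum => j _; rewrite ffunE -scalerBl sq.2.
  by rewrite ler_wpM2r ?seminorm_ge0// ltW.
by rewrite /eta mulrAC ltr_pdivrMr// ltr_pM2l// ltrDr.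
Qed.

(** * The residuals of a Gaussian measure *)

Section residual.
Context {R : realType} {F : topologicalLmodType R} (q : nat -> F -> R).
Hypothesis frechetF : separable_frechet q.
Variable gamma : probability (borel F) R.
Hypothesis gaussian_gamma : is_gaussian gamma.
Hypothesis centered_gamma : is_centered gamma.

Notation cov := (cov gamma).
Let psd : psd_form cov := psd_cov gaussian_gamma centered_gamma.
Let sq := frechet_seminorm frechetF.

Lemma dual_null (g : dual F) : cov g g = 0 -> \forall x \ae gamma, g x = 0 :> R.
Proof.
move=> g0; pose g2 := EFin \o (fun x : borel F => (g x : R) ^+ 2).
have mg2 : measurable_fun setT g2.
  apply/measurable_EFinP; apply: measurable_funX; exact: measurable_dual.
have : (\int[gamma]_x `|g2 x| = 0)%E.
  transitivity (cov g g)%:E; last by rewrite g0.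
  rewrite (covE gamma) fineK; last first.
    by apply: integrable_fin_num => //; exact: dual_square_integrable.
  by apply: eq_integral => x _ /=; rewrite ger0_norm ?sqr_ge0.
move/(ae_eq_integral_abs _ measurableT mg2); apply: filterS => x /(_ I)/=.
by case=> /eqP; rewrite sqrf_eq0 => /eqP.
Qed.

Lemma measurable_far (d : nat -> F) k (eps : R) J : measurable [set x : borel F |
  forall j, (j < J)%N -> (eps <= q k ((x : F) - d j))%R].
Proof.
rewrite (_ : [set x | _] = ~` [set x : borel F | exists2 j, [set j | (j < J)%N] j &
    [set` `]-oo, eps[%R] (q k ((x : F) - d j))]); last first.
  apply/seteqP; split => x /=.
    by move=> h [j /h]; rewrite in_itv/= leNgt => /negP.
  by move=> h j jJ; rewrite leNgt; apply/negP => h'; apply: h; exists j.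
apply: measurableC; apply: (measurable_exists_in (z := fun j (x : borel F) => q k ((x : F) - d j))).
  exact: measurable_itv.
by move=> j; exact: measurable_seminorm_dist.
Qed.

(** This is the tightness of gamma for one seminorm. *)
Lemma finitely_many_balls (d : nat -> F) k (eps del : R) :
  (forall x e, 0 < e -> exists j, q k (x - d j) < e) -> 0 < eps -> 0 < del ->
  exists J, (gamma [set x : borel F |
    forall j, (j < J)%N -> (eps <= q k ((x : F) - d j))%R] < del%:E)%E.
Proof.
move=> dd e0 d0; pose G J := [set x : borel F |
  forall j, (j < J)%N -> eps <= q k ((x : F) - d j)].
have mG J : measurable (G J) by exact: measurable_far.
have UT : \bigcup_J ~` G J = setT.
  apply/seteqP; split => // x _; have [j xj] := dd x eps e0.
  by exists j.+1 => // /(_ j (ltnSn j)); rewrite leNgt xj.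
apply: contrapT => /forallNP H.
have : (gamma (\bigcup_J ~` G J) <= (1 - del)%:E)%E.
  apply: probability_bigcup_le => [J|m n mn x|J]; first exact: measurableC.
    by apply: contra_not => Gx j jm; apply: Gx; exact: leq_trans mn.
  have := H J; rewrite -/(G J) => /negP; rewrite -leNgt probability_setC//.
  rewrite -(fineK (fin_num_measure gamma _ (mG J))) -EFinB !lee_fin; lra.
by rewrite UT probability_setT lee_fin; lra.
Qed.

Variable phi : nat -> nat -> dual F.
Notation f := (cm_functional gamma phi).

(** By residualE below, this is the functional g evaluated at the tail
   x - \sum_(i < N) f i x *: e i of the expansion of x: residuals describe the law
   of the tail without a random series in F. *)
Definition residual N (g : dual F) : dual F := g - form_proj cov f N g.

Let sf : subnormal_seq cov f := gram_schmidt_subnormal psd _.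

Lemma residualP N (a : R) g g' :
  residual N (a *: g + g') = a *: residual N g + residual N g'.
Proof.
rewrite /residual scalerBr addrACA -opprD; congr (_ - _).
rewrite /form_proj scaler_sumr -big_split; apply: eq_bigr => i _ /=.
by rewrite (formPl psd) scalerDl scalerA.
Qed.

Definition cov_residual N (g g' : dual F) := cov (residual N g) (residual N g').

Lemma psd_cov_residual N : psd_form (cov_residual N).
Proof.
split; first by move=> g g'; exact: (form_sym psd).
  by move=> a g g' g''; rewrite /cov_residual residualP (formPl psd).
by move=> g; exact: (form_ge0 psd).
Qed.

Lemma cov_residual_le N g : cov_residual N g g <= cov g g.
Proof.
rewrite /cov_residual /residual (form_residual psd sf) lerBlDr lerDl.
by apply: sumr_ge0 => i _; rewrite -expr2 sqr_ge0.
Qed.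

Lemma residual_family N :
  linear_family (fun (g : dual F) (x : borel F) => (residual N g x : R)).
Proof.
split; first by move=> g; exact: measurable_dual.
by move=> x a g g'; rewrite residualP dualD dualZ.
Qed.

Lemma residual_cos N (g : dual F) :
  \int[gamma]_x cos (residual N g x) = expR (- cov_residual N g g / 2).
Proof. exact: (dual_cos_cov gaussian_gamma centered_gamma). Qed.

Variable d : nat -> F.
Hypothesis dense_d : forall k x (e : R), 0 < e -> exists j, q k (x - d j) < e.
Hypothesis phi_le : forall k j x, `|phi k j x| <= q k x.
Hypothesis phi_d : forall k j, phi k j (d j) = q k (d j).

Notation e := (cm_vector frechetF gaussian_gamma centered_gamma dense_d phi).

Lemma residualE N (g : dual F) (x : F) :
  residual N g x = g (x - \sum_(i < N) (f i x : R) *: (e i : F)).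
Proof.
rewrite dualB /form_proj dual_sum [RHS](linearB g) (linear_sum g).
congr (_ - _); apply: eq_bigr => i _.
transitivity ((f i x : R) * g (e i)); first by rewrite dualZ cm_vectorE mulrC.
by rewrite [RHS]linearZ.
Qed.

Lemma residual_norming_null k j N : (pickle (k, j) < N)%N ->
  \forall x \ae gamma, residual N (phi k j) x = 0 :> R.
Proof.
move=> kN; apply: dual_null.
have := gram_schmidt_null psd (fun n => if unpickle n is Some (k, j) then phi k j else 0) kN.
by rewrite pickleK.
Qed.

(** The tail of the expansion is small in probability.  Most of gamma lies
   in the sum of a small ball and of the hull of finitely many points, where the
   gauge p is bounded.  By comparison the tail has a bounded gauge with a high probability, so
   it is close to the hull, hence close to a point of a finite net; and almost
   surely the norming functionals at the points of the net vanish on the tail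
   once N is large, which forces the tail to be small. *)
Lemma residual_small k (eps del : R) : 0 < eps -> 0 < del -> exists N,
  (gamma [set x : borel F | exists l, (eps <= `|residual N (phi k l) x : R|)%R] <= del%:E)%E.
Proof.
move=> eps0 del0; pose e' := eps / 18; have e'0 : 0 < e' by rewrite divr_gt0.
have del2 : 0 < del / 2 by rewrite divr_gt0.
have [J PJ] := finitely_many_balls (dense_d k) e'0 del2.
pose p := hull_gauge (q k) J d e'.
have sp : is_seminorm p := hull_gauge_seminorm (sq k) J d e'0.
have pq := hull_gauge_seminorm_le (sq k) J d e'0.
have [g [gp gd]] := norming_sequence frechetF sp pq d.
have [T [y Ty]] := box_net J d 7 (sq k) e'0.
have [m ym] := choice (fun c : T => dense_d k (y c) e'0).
(* Beyond N the functionals phi k (m c) are combinations, up to null ones, of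
   the f i already removed. *)
pose N := \max_(c : T) (pickle (k, m c)).+1; exists N.
have : \forall x \ae gamma, forall c, residual N (phi k (m c)) x = 0 :> R.
  apply: filter_forall => c; apply: residual_norming_null.
  exact: (leq_bigmax (F := fun c => (pickle (k, m c)).+1) c).
move=> [D [mD D0 hD]].
(* The gauge is at most 2 on the balls, hence the threshold 3. *)
pose A := [set x : borel F | exists l, (2 * 3 < `|residual N (g l) x : R|)%R].
have mA : measurable A.
  apply: (measurable_exists (z := fun l (x : borel F) => residual N (g l) x)
    (measurable_norm_gt _)) => l.
  exact: measurable_dual.
have PA : (gamma A <= del%:E)%E.
  apply: (le_trans (gaussian_comparison (residual_family N) dual_family
    (psd_cov_residual N) psd (cov_residual_le N) (residual_cos N)
    (dual_cos_cov gaussian_gamma centered_gamma) g (ltr0Sn _ 2))).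
  have -> : (del%:E = 2%:E * (del / 2)%:E)%E by rewrite -EFinM mulrC divfK.
  apply: lee_wpmul2l => //; apply: le_trans (ltW PJ).
  apply: le_measure; rewrite ?inE.
  - apply: (measurable_exists (z := fun l (x : borel F) => g l x)
      (measurable_norm_ge _)) => l.
    exact: measurable_dual.
  - exact: measurable_far.
  - move=> x [l gl] j jJ; rewrite leNgt; apply/negP => /(hull_gauge_near (sq k) e'0 jJ) px.
    have := le_trans (le_trans gl (gp l x)) px.
    by rewrite ler_nat.
have cover x : ~ A x -> ~ D x -> forall l, `|residual N (phi k l) x : R| < eps.
  move=> nA nD l; set X := x - \sum_(i < N) (f i x : R) *: (e i : F).
  have pX : p X <= 6.
    rewrite leNgt; apply/negP => h.
    have e'V : 0 < e'^-1 by rewrite invr_gt0.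
    have [j gj] := norming_sequence_sup e'V sp pq (dense_d k) gp gd h.
    by apply: nA; exists j; rewrite residualE -/X -natrM.
  have [|a] := @hull_gauge_lt _ _ _ (sq k) J d _ e'0 7 X; first by apply: le_lt_trans pX _; rewrite ltr_nat.
  rewrite /hull_cost; set s := \sum_(j < J) a j *: d j => aX.
  have qs : q k (X - s) < 7 * e'.
    rewrite -ltr_pdivrMr//; apply: le_lt_trans aX; rewrite lerDl.
    by apply: sumr_ge0.
  have aj j : (j < J)%N -> `|a j| <= 7.
    move=> jJ; apply: ltW; apply: le_lt_trans aX.
    rewrite (bigD1 (Ordinal jJ))//= addrCA lerDl addr_ge0 ?sumr_ge0//.
    by rewrite divr_ge0 ?(seminorm_ge0 (sq k))// ltW.
  have [c yc] := Ty a aj.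
  (* the distance from X to d (m c) is less than (7 + 1 + 1) e', and it bounds the
     seminorm of d (m c); hence the factor 18 = 9 + 9 between eps and e' *)
  have phi0 : phi k (m c) X = 0 :> R.
    by rewrite /X -residualE; apply: contrapT => h; apply: nD; apply: hD => /(_ c).
  have sd : q k (s - d (m c)) < 2 * e'.
    apply: (le_lt_trans (seminorm_triangle (sq k) (y c) _ _)).
    by have := ym c; have := yc; rewrite -/s; lra.
  have Xd : q k (X - d (m c)) < 9 * e'.
    apply: (le_lt_trans (seminorm_triangle (sq k) s _ _)).
    by move: qs sd; lra.
  have qd : q k (d (m c)) <= q k (X - d (m c)).
    rewrite -phi_d (seminorm_distC (sq k)); apply: le_trans (phi_le _ (m c) _).
    by rewrite linearB/= phi0 subr0 ler_norm.
  apply: le_lt_trans (_ : q k X < eps); first by rewrite residualE phi_le.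
  rewrite -[X](subrK (d (m c))); apply: (le_lt_trans ((sq k).1 _ _)).
  have : eps = 18 * e' by rewrite /e' mulrC divfK.
  by move: Xd qd; lra.
have {}D0 : (gamma D <= 0)%E by rewrite le_eqVlt; apply/orP; left; apply/eqP.
apply: (@le_trans _ _ (gamma (A `|` D))).
  apply: le_measure; rewrite ?inE; last first.
  - move=> x [l lx]; apply: contrapT => /not_orP[nA nD].
    by have := cover x nA nD l; rewrite ltNge lx.
  - exact: measurableU.
  - apply: (measurable_exists (z := fun l (x : borel F) => residual N (phi k l) x)
      (measurable_norm_ge _)) => l.
    exact: measurable_dual.
apply: (le_trans (measureU2 _ mA mD)).
by rewrite -[leRHS]adde0; exact: leeD.
Qed.

End residual.

(** * Gross measurability *)

Section orthogonal_projections.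
Context {R : realType} {H : lmodType R} (dot : H -> H -> R).
Hypothesis inner : is_inner_product dot.

Lemma psd_inner_product : psd_form dot.
Proof.
have [sym lin pos] := inner; split=> // x.
have [->|/pos/ltW//] := eqVneq x 0.
have := lin 1 0 0 0; rewrite scale1r addr0 mul1r; lra.
Qed.

Let psd := psd_inner_product.

Lemma fin_orth_form_proj (w : nat -> H) N : subnormal_seq dot w ->
  exists2 P : {linear H -> H}, fin_orth_proj dot P & P =1 form_proj dot w N.
Proof.
move=> sw; have linP : linear (form_proj dot w N).
  move=> a x y; rewrite /form_proj scaler_sumr -big_split; apply: eq_bigr => i _ /=.
  by rewrite (formPl psd) scalerDl scalerA.
pose P : {linear H -> H} := HB.pack (form_proj dot w N)
  (GRing.isLinear.Build R H H *:%R _ linP).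
exists P => //; split=> [x|x y|].
- by rewrite /= {1}/form_proj; apply: eq_bigr => i _; rewrite (form_projw psd sw).
- rewrite /= (form_projC psd) (form_sym psd x) (form_projC psd).
  by apply: eq_bigr => i _; rewrite mulrC.
- exists N, [tuple w i | i < N] => x; exists [tuple dot x (w i) | i < N].
  by apply: eq_bigr => i _; rewrite !tnth_mktuple.
Qed.

Lemma fin_orth_proj_le (P : {linear H -> H}) x : fin_orth_proj dot P ->
  dot (P x) (P x) <= dot x x.
Proof.
move=> [PP Psym _]; have E : dot x (P x) = dot (P x) (P x) by rewrite Psym PP.
have := form_cauchy_schwarz psd x (P x); rewrite E expr2.
have := form_ge0 psd (P x); rewrite le_eqVlt => /predU1P[<- _|p]; first exact: form_ge0.
by rewrite ler_pM2r.
Qed.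

Lemma orthonormal_lincomb n (b : n.-tuple H) (c : n.-tuple R) :
  (forall i j, dot (tnth b i) (tnth b j) = (i == j)%:R) ->
  dot (lincomb b c) (lincomb b c) = \sum_(i < n) tnth c i ^+ 2.
Proof.
move=> ob; rewrite /lincomb (form_suml psd); apply: eq_bigr => i _.
rewrite (formZl psd) (form_sumr psd) (bigD1 i)//= big1 => [|j ji].
  by rewrite addr0 (formZr psd) ob eqxx mulr1 expr2.
by rewrite (formZr psd) ob eq_sym (negbTE ji) mulr0.
Qed.

End orthogonal_projections.

Section gross.
Context {R : realType} {F : topologicalLmodType R} (q : nat -> F -> R).
Hypothesis frechetF : separable_frechet q.
Variable gamma : probability (borel F) R.
Hypothesis gaussian_gamma : is_gaussian gamma.
Hypothesis centered_gamma : is_centered gamma.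
Variable d : nat -> F.
Hypothesis dense_d : forall k x (e : R), 0 < e -> exists j, q k (x - d j) < e.
Variable phi : nat -> nat -> dual F.
Hypothesis phi_le : forall k j x, `|phi k j x| <= q k x.
Hypothesis phi_d : forall k j, phi k j (d j) = q k (d j).

Notation cov := (cov gamma).
Notation H := (cameron_martin gamma).
Notation dot := (cm_dot (gamma := gamma)).
Notation iota := (cm_embedding gamma).
Notation f := (cm_functional gamma phi).
Notation e := (cm_vector frechetF gaussian_gamma centered_gamma dense_d phi).
Let sq := frechet_seminorm frechetF.
Let psd : psd_form cov := psd_cov gaussian_gamma centered_gamma.
Let inner : is_inner_product dot :=
  cm_inner_product frechetF gaussian_gamma centered_gamma dense_d phi_le phi_d.
Let psd_dot := psd_inner_product inner.

Let dot_e i h : dot (e i) h = f i h.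
Proof. exact: cm_dot_vector. Qed.

Lemma cm_vector_subnormal : subnormal_seq dot e.
Proof.
have sf : subnormal_seq cov f := gram_schmidt_subnormal psd _.
have E i j : dot (e i) (e j) = cov (f i) (f j) by rewrite dot_e cm_vectorE.
by split=> [i j ij|i]; rewrite E; [exact: sf.1|exact: sf.2].
Qed.

Let embedding_seminorm k : is_seminorm (q k \o iota).
Proof.
by split=> [x y|a x] /=; [exact: (sq k).1|exact: (sq k).2].
Qed.

Section cylinder.
Variables (P P0 : {linear H -> H}) (N : nat).
Hypothesis projP : fin_orth_proj dot P.
Hypothesis projP0 : fin_orth_proj dot P0.
Hypothesis P0E : P0 =1 form_proj dot e N.
Hypothesis PP0 : forall x y, dot (P x) (P0 y) = 0.
Variables (n : nat) (b : n.-tuple H).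
Hypothesis ob : forall i j, dot (tnth b i) (tnth b j) = (i == j)%:R.

Let coef (g : dual F) (i : nat) : R := g (iota (P (nth 0 b i))).

Let W (g : dual F) (t : n.-tuple R) : R := g (iota (P (lincomb b t))).

Let WE g t : W g t = \sum_(i < n) coef g i * tnth t i.
Proof.
rewrite /W /lincomb !linear_sum/=; apply: eq_bigr => i _.
rewrite !linearZ/=.
by rewrite /coef -tnth_nth; exact: mulrC.
Qed.

Let B (g g' : dual F) : R := \sum_(i < n) coef g i * coef g' i.

Let psdB : psd_form B.
Proof.
split.
- by move=> g g'; apply: eq_bigr => i _; rewrite mulrC.
- move=> a g g' g''; rewrite mulr_sumr -big_split; apply: eq_bigr => i _ /=.
  by rewrite mulrA -mulrDl.
- by move=> g; apply: sumr_ge0 => i _; rewrite -expr2 sqr_ge0.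
Qed.

Let W_family : linear_family W.
Proof.
split; last by move=> t a g g'.
move=> g; rewrite (_ : W g = fun t => \sum_(i < n) coef g i * tnth t i); last first.
  by apply/funext => t; exact: WE.
apply: measurable_sum => i; apply: measurable_funM => //.
exact: measurable_tnth.
Qed.

Let W_cos g : \int[std_gaussian n]_t cos (W g t) = expR (- B g g / 2).
Proof.
have := std_gaussian_cos n (coef g) 0; rewrite cos0 mulr1.
under eq_Rintegral do rewrite addr0 -WE.
by move=> ->; rewrite mulNr.
Qed.

(** On the range of P the functional g agrees with its residual, which is bounded
   on the unit ball by its standard deviation. *)
Let B_le g : B g g <= cov_residual gamma phi N g g.
Proof.
set C := cov_residual _ _ _ _ _.
pose c : n.-tuple R := [tuple coef g i | i < n].
pose y := lincomb b c; pose s := \sum_(i < n) tnth c i ^+ 2.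
have -> : B g g = s.
  by apply: eq_bigr => i _; rewrite tnth_mktuple expr2.
have s0 : 0 <= s by apply: sumr_ge0 => i _; exact: sqr_ge0.
have gs : g (iota (P y)) = s :> R.
  rewrite -[LHS]/(W g c) WE; apply: eq_bigr => i _.
  by rewrite tnth_mktuple expr2.
have fP i : (i < N)%N -> f i (iota (P y)) = 0 :> R.
  move=> iN; rewrite -[LHS]dot_e (form_sym psd_dot).
  rewrite -(form_projw psd_dot cm_vector_subnormal _ iN) -P0E.
  by have [_ -> _] := projP0; rewrite PP0.
have rs : residual gamma phi N g (iota (P y)) = s :> R.
  rewrite dualB dual_sum gs big1 ?subr0// => i _.
  by rewrite dualZ fP// mulr0.
have C0 : 0 <= C by exact: (form_ge0 (psd_cov_residual gaussian_gamma centered_gamma phi N)).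
have := cm_norm_dual gaussian_gamma centered_gamma (residual gamma phi N g) (cm_valP (P y)).
rewrite -(hnorm_cm_dot (P y)) rs ger0_norm// => sC.
have Pys : dot (P y) (P y) <= s.
  by rewrite /s -(orthonormal_lincomb inner c ob); exact: fin_orth_proj_le.
have {}sC : s <= Num.sqrt C * Num.sqrt s.
  by apply: (le_trans sC); apply: ler_wpM2l; [exact: sqrtr_ge0|exact: ler_wsqrtr].
have [->//|sn0] := eqVneq s 0.
have sp : 0 < Num.sqrt s by rewrite sqrtr_gt0 lt_neqAle eq_sym sn0.
move: sC; rewrite -{1}(sqr_sqrtr s0) expr2 ler_pM2r//.
by rewrite ler_sqrt.
Qed.

(** The image under P of the standard Gaussian vector along b is dominated in
   covariance by the tail of gamma, since the range of P is orthogonal to the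
   first N vectors e. *)
Lemma cylinder_tail_le k (eps : R) : 0 < eps ->
  (std_gaussian n [set t | (eps < q k (iota (P (lincomb b t))))%R] <=
   2%:E * gamma [set x : borel F | exists l, (eps / 2 <= `|residual gamma phi N (phi k l) x : R|)%R])%E.
Proof.
move=> eps0.
have -> : [set t | eps < q k (iota (P (lincomb b t)))] =
    [set t | exists l, 2 * (eps / 2) < `|W (phi k l) t|].
  have -> : 2 * (eps / 2) = eps by rewrite mulrC divfK.
  apply/seteqP; split => t /=; last first.
    by move=> [l]; move/lt_le_trans; apply; exact: phi_le.
  have qq y : q k y <= 1 * q k y by rewrite mul1r.
  exact: (norming_sequence_sup ltr01 (sq k) qq (dense_d k) (phi_le k) (phi_d k)).
exact: (gaussian_comparison W_family (residual_family gaussian_gamma centered_gamma phi N) psdB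
  (psd_cov_residual gaussian_gamma centered_gamma phi N) B_le W_cos
  (residual_cos gaussian_gamma centered_gamma phi N) (phi k) (divr_gt0 eps0 (ltr0Sn _ 1))).
Qed.

End cylinder.

(** The exceptional projection is the one on the span of the first N vectors e,
   with N given by residual_small. *)
Theorem cm_gross_measurable k : gross_measurable dot (q k \o iota).
Proof.
split; first exact: embedding_seminorm.
move=> eps eps0.
have eps2 : 0 < eps / 2 by rewrite divr_gt0.
have eps4 : 0 < eps / 4 by rewrite divr_gt0.
have [N smallN] := residual_small frechetF gaussian_gamma centered_gamma
  dense_d phi_le phi_d k eps2 eps4.
have [P0 projP0 P0E] := fin_orth_form_proj inner N cm_vector_subnormal.
exists P0 => // P projP PP0; rewrite /cylindrical_gaussian.
case: xgetP => [v _ [P' [A [n [b [projP' _ PA [ob rangeb] ->]]]]]|_]; last first.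
  by rewrite lte_fin.
have -> : lincomb b @^-1` A = [set t | eps < q k (iota (P (lincomb b t)))].
  (* a cylinder set may be based on a projection P' other than P; P' fixes the
     points of its range, where the Gaussian vector lives *)
  apply/seteqP.
  have PL t : P' (lincomb b t) = lincomb b t.
    have [PP _ _] := projP'.
    have : range P' (lincomb b t) by rewrite -rangeb; exists t.
    by move=> [y _ <-]; rewrite PP.
  have PAt t : [set x | eps < q k (iota (P x))] (lincomb b t) = A (lincomb b t).
    by rewrite -{2}PL; rewrite -[RHS]/((P' @^-1` A) _) -PA.
  by split => t; rewrite /preimage /mkset -PAt.
apply: (le_lt_trans (cylinder_tail_le projP projP0 P0E PP0 ob k eps0)).
apply: (@le_lt_trans _ _ (2%:E * (eps / 4)%:E)%E); first exact: lee_wpmul2l.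
by rewrite -EFinM lte_fin; lra.
Qed.

End gross.

(** * The abstract Wiener space *)

Local Open Scope ereal_scope.

Theorem theorem3p2 (R : realType) (F : topologicalLmodType R)
    (q : nat -> F -> R) (gamma : probability (borel F) R)
    (frechetF : separable_frechet q)
    (gaussian_gamma : is_gaussian gamma)
    (centered_gamma : is_centered gamma)
    (dense_cm : dense [set h : F | cm_norm gamma h < +oo]) :
  abstract_wiener_space q (cm_dot (gamma := gamma)) (cm_embedding gamma).
Proof.
have sq := frechet_seminorm frechetF.
have [d dense_d] := frechet_dense_sequence frechetF.
have qq k x : (q k x <= 1 * q k x)%R by rewrite mul1r.
have [phi phiP] := choice (fun k => norming_sequence frechetF (sq k) (qq k) d).
have phi_le k := (phiP k).1; have phi_d k := (phiP k).2.
have inner := cm_inner_product frechetF gaussian_gamma centered_gamma dense_d phi_le phi_d.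
split.
- exact: frechetF.
- split; first exact: inner.
    exact: (cm_complete frechetF gaussian_gamma centered_gamma).
  exact: (cm_separable frechetF gaussian_gamma centered_gamma dense_d phi_le phi_d).
- split; first exact: val_inj.
  move=> h A /(frechet_nbhs frechetF)[k [e [e0 kA]]].
  have [C [C0 qC]] := cm_norm_continuous frechetF gaussian_gamma centered_gamma k.
  exists (e / C)%R; first by rewrite /= divr_gt0.
  move=> y; rewrite /hball /= hnorm_cm_dot ltr_pdivlMr// mulrC => yh; apply: kA.
  exact: le_lt_trans (qC _ (cm_valP (y - h)%R)) yh.
- rewrite (_ : range _ = [set h : F | cm_norm gamma h < +oo])//.
  apply/seteqP; split => [_ [h _ <-]|h hy]; first exact: cm_valP.
  by exists (CameronMartin (hy : in_cm gamma h)).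
- exact: (cm_gross_measurable frechetF gaussian_gamma centered_gamma dense_d phi_le phi_d).
Qed.
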